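(* Consider Problem S (described in the context) with data $\lambda$, $\gamma_i$, $\sigma_i,\alpha_i,\beta_i$, $P_i$, $f$ ($i=1,2,3$). Suppose that $$P_i(t,s)=P_{i,1}(t)\,P_{i,2}(s)\quad (i=1,2,3),\qquad P_{j,2}(1)=0\quad (j=2,3),$$ and that the following conditions hold for all values of the argument $x$, resp. $t$, in $[0,1]$: $$\frac{\beta_1(\sigma_1-1)}{2(\sigma_1+1)}\ge 0,\qquad P_{1,1}(x)P_{1,2}(x)\ge 0,\qquad \left(\frac{P_{1,1}(x)}{P_{1,2}'(x)}\right)'\ge 0;$$ $$\frac{\alpha_2(1+\sigma_2)}{1-\sigma_2}\ge 0,\qquad \frac{\beta_2(1+\sigma_2)}{1-\sigma_2}P_{2,1}(t)P_{2,2}(t)\le 0,$$ $$\frac{\beta_2(1+\sigma_2)}{2(1-\sigma_2)}\cdot\frac{P_{2,1}(0)}{P_{2,2}'(0)}\le 0,\qquad \frac{\beta_2(1+\sigma_2)}{2(1-\sigma_2)}\cdot\left(\frac{P_{2,1}(t)}{P_{2,2}'(t)}\right)'\le 0;$$ $$\frac{\alpha_3(\sigma_3-1)}{\sigma_3+1}\le 0,\qquad \frac{\beta_3(\sigma_3-1)}{\sigma_3+1}P_{3,1}(t)P_{3,2}(t)\ge 0,$$ $$\frac{\beta_3(\sigma_3-1)}{2(\sigma_3+1)}\cdot\frac{P_{3,1}(0)}{P_{3,2}'(0)}\ge 0,\qquad \frac{\beta_3(\sigma_3-1)}{2(\sigma_3+1)}\left(\frac{P_{3,1}(t)}{P_{3,2}'(t)}\right)'\ge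 0.$$ If there exists a solution of Problem S, then it is unique.
   Context: **Caputo derivative.** Let $0<\lambda\le 1$. For a function $g$ of $t$, ${}_CD_{0t}^{\lambda}g(t)=\frac{1}{\Gamma(1-\lambda)}\int_0^t\frac{g'(z)}{(t-z)^{\lambda}}\,dz$ if $0<\lambda<1$, and ${}_CD_{0t}^{\lambda}g(t)=g'(t)$ if $\lambda=1$. For $u(x,t)$ it is applied in the variable $t$. **Domain.** Let $A=(0,0)$, $B=(1,0)$, $C=(1,1)$, $D=(0,1)$ in the $(x,t)$-plane and $\Omega_0=(0,1)\times(0,1)$. Let $\gamma_1,\gamma_2,\gamma_3:[0,1]\to\mathbb R$ be twice differentiable functions with $\gamma_i(0)=\gamma_i(1)=0$ and such that $s+\gamma_i(s)$ and $s-\gamma_i(s)$ are monotonically increasing on $[0,1]$. They define three smooth curves, also denoted $\gamma_i$: $\gamma_1:\ t=-\gamma_1(x)$; $\gamma_2:\ x=-\gamma_2(t)$; $\gamma_3:\ x=1-\gamma_3(t)$. Apart from their endpoints these curves lie strictly inside the characteristic triangles of the wave equation adjacent to the square from outside: $\gamma_1$ in the triangle with vertices $(0,0),(1,0),(1/2,-1/2)$; $\gamma_2$ in the triangle with vertices $(0,0),(0,1),(-1/2,1/2)$; $\gamma_3$ in the triangle with vertices $(1,0),(1,1),(3/2,1/2)$. $\Omega_1$ is the domain bounded by segment $AB$ and curve $\gamma_1$ (where $t<0$); $\Omega_2$ is bounded by segment $AD$ and curve $\gamma_2$ (where $x<0$); $\Omega_3$ is bounded by segment $BC$ and curve $\gamma_3$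 (where $x>1$). With $AB,BC,AD$ the open segments, $\Omega=\Omega_0\cup\Omega_1\cup\Omega_2\cup\Omega_3\cup AB\cup BC\cup AD$. **Equation.** $Lu=f(x,t)$ with a given function $f$, where $Lu=u_{xx}-{}_CD_{0t}^{\lambda}u$ in $\Omega_0$ and $Lu=u_{xx}-u_{tt}$ in $\Omega_i$, $i=1,2,3$. **Data.** $\sigma_i,\alpha_i,\beta_i$ ($i=1,2,3$) are given real numbers with $\alpha_i^2+\beta_i^2\ne0$ and $|\sigma_i|\neq1$; $P_i$ are given functions on $[0,1]\times[0,1]$. In factorizations $P_i(t,s)=P_{i,1}(t)P_{i,2}(s)$ the factors are real functions on $[0,1]$ for which the derivatives and quotients that are written make sense (a prime denotes the derivative in the single argument). **Points on the curves.** For $0<s<1$: $\theta_1(s),\theta_2(s),\theta_3(s)$ are the intersection points of the curves $\gamma_1,\gamma_2,\gamma_3$ with the characteristics $x-t=s$, $t-x=s$, $x+t=1+s$, respectively; $\theta_1^*(s),\theta_2^*(s),\theta_3^*(s)$ are the intersection points of the curves $\gamma_1,\gamma_2,\gamma_3$ with the characteristics $x+t=s$, $x+t=s$, $x-t=1-s$, respectively. **Problem S.** Find a solution $u$ of $Lu=f$ in the class $W=\{u: u\in C(\overline\Omega),\ u_{xx},\,{}_CD_{0t}^{\lambda}u\in C(\Omega_0),\ u\in C^2(\Omega_i),\ i=1,2,3\}$, whose first derivatives are continuous up to the boundaries of $\Omega_0$ and of $\Omega_i$ ($i=1,2,3$), satisfying the following. Non-local conditions, for $0<s<1$ (one-sided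 boundary values taken from inside $\Omega_1,\Omega_2,\Omega_3$, respectively): $$[u_x-u_t](\theta_1(s))=\sigma_1[u_x+u_t](\theta_1^*(s)),$$ $$[u_x-u_t](\theta_2(s))=\sigma_2[u_x+u_t](\theta_2^*(s)),$$ $$[u_x+u_t](\theta_3(s))=\sigma_3[u_x-u_t](\theta_3^*(s)).$$ Point conditions: $u(A)=u(B)=0$. Transmitting conditions ($0<x<1$, $0<t<1$): $$\lim_{t\to+0}{}_CD_{0t}^{\lambda}u(x,t)=\alpha_1u_t(x,-0)+\beta_1\int_x^1u_t(s,-0)P_1(x,s)\,ds,$$ $$u_x(+0,t)=\alpha_2u_x(-0,t)+\beta_2\int_t^1u_x(-0,s)P_2(t,s)\,ds,$$ $$u_x(1-0,t)=\alpha_3u_x(1+0,t)+\beta_3\int_t^1u_x(1+0,s)P_3(t,s)\,ds,$$ where $\pm0$ and $1\pm0$ denote one-sided limits in the corresponding variable. *)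

(* Defs.v *)
(* Stdlib reals with Coquelicot. *)
From Stdlib Require Import Reals.
From Coquelicot Require Import Coquelicot.
Open Scope R_scope.

(* Points of the plane are pairs (x, t). *)
Definition point : Type := (R * R)%type.

Definition unit_interval (s : R) : Prop := 0 <= s <= 1.

(* f' is the derivative of f on [0, 1], one-sided at the endpoints. *)
Definition deriv01 (f f' : R -> R) : Prop :=
  forall s, unit_interval s -> D_in f f' unit_interval s.

Definition monotone01 (f : R -> R) : Prop :=
  forall s r, 0 <= s -> s <= r -> r <= 1 -> f s <= f r.

Definition Gamma (z : R) : R :=
  RInt_gen (fun t => Rpower t (z - 1) * exp (- t))
    (at_right 0) (Rbar_locally p_infty).

Definition caputo_kernel (lam : R) (g : R -> R) (t z : R) : R :=
  Derive g z / Rpower (t - z) lam.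

(* The integral is improper at both ends: g is not assumed differentiable
   at 0, and the kernel is singular at z = t. *)
Definition caputo (lam : R) (g : R -> R) (t : R) : R :=
  if Req_EM_T lam 1 then Derive g t
  else / Gamma (1 - lam)
       * RInt_gen (caputo_kernel lam g t) (at_right 0) (at_left t).

(* [caputo] is total; this says that its value is meaningful. *)
Definition ex_caputo (lam : R) (g : R -> R) (t : R) : Prop :=
  if Req_EM_T lam 1 then ex_derive g t
  else (forall z, 0 < z < t -> ex_derive g z) /\
       ex_RInt_gen (caputo_kernel lam g t) (at_right 0) (at_left t).

Definition dx (u : point -> R) (p : point) : R :=
  Derive (fun x => u (x, snd p)) (fst p).
Definition dt (u : point -> R) (p : point) : R :=
  Derive (fun t => u (fst p, t)) (snd p).
Definition ex_dx (u : point -> R) (p : point) : Prop :=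
  ex_derive (fun x => u (x, snd p)) (fst p).
Definition ex_dt (u : point -> R) (p : point) : Prop :=
  ex_derive (fun t => u (fst p, t)) (snd p).
Definition caputo_t (lam : R) (u : point -> R) (p : point) : R :=
  caputo lam (fun t => u (fst p, t)) (snd p).
Definition ex_caputo_t (lam : R) (u : point -> R) (p : point) : Prop :=
  ex_caputo lam (fun t => u (fst p, t)) (snd p).

Definition closure (D : point -> Prop) (p : point) : Prop :=
  forall eps : posreal, exists q, ball p eps q /\ D q.

(* The limit of v at p along D; p is typically a boundary point of D. *)
Definition limit_within (D : point -> Prop) (v : point -> R)
    (p : point) (l : R) : Prop :=
  filterlim v (within D (locally p)) (locally l).

Definition extends_continuously (D : point -> Prop) (v : point -> R) : Prop :=
  exists w : point -> R,
    continuous_on (closure D) w /\ (forall p, D p -> w p = v p).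

Definition C1_up_to_boundary (D : point -> Prop) (u : point -> R) : Prop :=
  (forall p, D p -> ex_dx u p /\ ex_dt u p) /\
  extends_continuously D (dx u) /\ extends_continuously D (dt u).

Definition C1 (D : point -> Prop) (u : point -> R) : Prop :=
  (forall p, D p -> ex_dx u p /\ ex_dt u p) /\
  continuous_on D u /\ continuous_on D (dx u) /\ continuous_on D (dt u).
Definition C2 (D : point -> Prop) (u : point -> R) : Prop :=
  C1 D u /\ C1 D (dx u) /\ C1 D (dt u).

Record data := Data {
  lam : R;
  gamma1 : R -> R; gamma2 : R -> R; gamma3 : R -> R;
  sigma1 : R; sigma2 : R; sigma3 : R;
  alpha1 : R; alpha2 : R; alpha3 : R;
  beta1 : R; beta2 : R; beta3 : R;
  P1 : R -> R -> R; P2 : R -> R -> R; P3 : R -> R -> R;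
  rhs : point -> R
}.

(* Open characteristic triangles adjacent to AB, AD and BC. *)
Definition triangle1 (p : point) : Prop :=
  snd p < 0 /\ 0 < fst p + snd p /\ fst p - snd p < 1.
Definition triangle2 (p : point) : Prop :=
  fst p < 0 /\ 0 < fst p + snd p /\ snd p - fst p < 1.
Definition triangle3 (p : point) : Prop :=
  1 < fst p /\ 0 < 1 - fst p + snd p /\ fst p + snd p < 2.

Definition on_gamma1 (d : data) (p : point) : Prop :=
  unit_interval (fst p) /\ snd p = - gamma1 d (fst p).
Definition on_gamma2 (d : data) (p : point) : Prop :=
  unit_interval (snd p) /\ fst p = - gamma2 d (snd p).
Definition on_gamma3 (d : data) (p : point) : Prop :=
  unit_interval (snd p) /\ fst p = 1 - gamma3 d (snd p).

Definition curve_function (g : R -> R) : Prop :=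
  (exists g' g'' : R -> R, deriv01 g g' /\ deriv01 g' g'') /\
  g 0 = 0 /\ g 1 = 0 /\
  monotone01 (fun s => s + g s) /\ monotone01 (fun s => s - g s).

(* By triangle3, gamma3 is negative on (0, 1), whereas gamma1 and gamma2
   are positive there. *)
Definition admissible (d : data) : Prop :=
  0 < lam d <= 1 /\
  curve_function (gamma1 d) /\ curve_function (gamma2 d) /\
  curve_function (gamma3 d) /\
  (forall s, 0 < s < 1 ->
     triangle1 (s, - gamma1 d s) /\
     triangle2 (- gamma2 d s, s) /\
     triangle3 (1 - gamma3 d s, s)) /\
  alpha1 d ^ 2 + beta1 d ^ 2 <> 0 /\
  alpha2 d ^ 2 + beta2 d ^ 2 <> 0 /\
  alpha3 d ^ 2 + beta3 d ^ 2 <> 0 /\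
  Rabs (sigma1 d) <> 1 /\ Rabs (sigma2 d) <> 1 /\ Rabs (sigma3 d) <> 1.

Definition Omega0 (p : point) : Prop := 0 < fst p < 1 /\ 0 < snd p < 1.
Definition Omega1 (d : data) (p : point) : Prop :=
  0 < fst p < 1 /\ - gamma1 d (fst p) < snd p < 0.
Definition Omega2 (d : data) (p : point) : Prop :=
  0 < snd p < 1 /\ - gamma2 d (snd p) < fst p < 0.
Definition Omega3 (d : data) (p : point) : Prop :=
  0 < snd p < 1 /\ 1 < fst p < 1 - gamma3 d (snd p).
Definition segAB (p : point) : Prop := 0 < fst p < 1 /\ snd p = 0.
Definition segAD (p : point) : Prop := fst p = 0 /\ 0 < snd p < 1.
Definition segBC (p : point) : Prop := fst p = 1 /\ 0 < snd p < 1.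
Definition Omega (d : data) (p : point) : Prop :=
  Omega0 p \/ Omega1 d p \/ Omega2 d p \/ Omega3 d p \/
  segAB p \/ segBC p \/ segAD p.

(* [thetaI d s p]: p is an intersection point of the I-th curve with the
   characteristic of parameter s (it is unique when s + gammaI s and
   s - gammaI s are strictly increasing); [thetaI_star] likewise. *)
Definition theta1 (d : data) (s : R) (p : point) : Prop :=
  on_gamma1 d p /\ fst p - snd p = s.
Definition theta2 (d : data) (s : R) (p : point) : Prop :=
  on_gamma2 d p /\ snd p - fst p = s.
Definition theta3 (d : data) (s : R) (p : point) : Prop :=
  on_gamma3 d p /\ fst p + snd p = 1 + s.
Definition theta1_star (d : data) (s : R) (p : point) : Prop :=
  on_gamma1 d p /\ fst p + snd p = s.
Definition theta2_star (d : data) (s : R) (p : point) : Prop :=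
  on_gamma2 d p /\ fst p + snd p = s.
Definition theta3_star (d : data) (s : R) (p : point) : Prop :=
  on_gamma3 d p /\ fst p - snd p = 1 - s.

Definition dplus (u : point -> R) (p : point) : R := dx u p + dt u p.
Definition dminus (u : point -> R) (p : point) : R := dx u p - dt u p.

Definition classW (d : data) (u : point -> R) : Prop :=
  continuous_on (closure (Omega d)) u /\
  (forall p, Omega0 p ->
     ex_dx u p /\ ex_dx (dx u) p /\ ex_caputo_t (lam d) u p) /\
  continuous_on Omega0 (dx (dx u)) /\
  continuous_on Omega0 (caputo_t (lam d) u) /\
  C2 (Omega1 d) u /\ C2 (Omega2 d) u /\ C2 (Omega3 d) u.

Definition equation (d : data) (u : point -> R) : Prop :=
  (forall p, Omega0 p -> dx (dx u) p - caputo_t (lam d) u p = rhs d p) /\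
  (forall p, Omega1 d p \/ Omega2 d p \/ Omega3 d p ->
     dx (dx u) p - dt (dt u) p = rhs d p).

Definition nonlocal_conditions (d : data) (u : point -> R) : Prop :=
  (forall s p q, 0 < s < 1 -> theta1 d s p -> theta1_star d s q ->
     exists a b, limit_within (Omega1 d) (dminus u) p a /\
       limit_within (Omega1 d) (dplus u) q b /\ a = sigma1 d * b) /\
  (forall s p q, 0 < s < 1 -> theta2 d s p -> theta2_star d s q ->
     exists a b, limit_within (Omega2 d) (dminus u) p a /\
       limit_within (Omega2 d) (dplus u) q b /\ a = sigma2 d * b) /\
  (forall s p q, 0 < s < 1 -> theta3 d s p -> theta3_star d s q ->
     exists a b, limit_within (Omega3 d) (dplus u) p a /\
       limit_within (Omega3 d) (dminus u) q b /\ a = sigma3 d * b).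

(* nu1 x, nu2 t and nu3 t stand for u_t(x, -0), u_x(-0, t) and
   u_x(1 + 0, t). *)
Definition transmitting_condition1 (d : data) (u : point -> R) : Prop :=
  exists nu1 : R -> R, forall x, 0 < x < 1 ->
    filterlim (fun t => dt u (x, t)) (at_left 0) (locally (nu1 x)) /\
    ex_RInt (fun s => nu1 s * P1 d x s) x 1 /\
    filterlim (fun t => caputo_t (lam d) u (x, t)) (at_right 0)
      (locally (alpha1 d * nu1 x +
                beta1 d * RInt (fun s => nu1 s * P1 d x s) x 1)).
Definition transmitting_condition2 (d : data) (u : point -> R) : Prop :=
  exists nu2 : R -> R, forall t, 0 < t < 1 ->
    filterlim (fun x => dx u (x, t)) (at_left 0) (locally (nu2 t)) /\
    ex_RInt (fun s => nu2 s * P2 d t s) t 1 /\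
    filterlim (fun x => dx u (x, t)) (at_right 0)
      (locally (alpha2 d * nu2 t +
                beta2 d * RInt (fun s => nu2 s * P2 d t s) t 1)).
Definition transmitting_condition3 (d : data) (u : point -> R) : Prop :=
  exists nu3 : R -> R, forall t, 0 < t < 1 ->
    filterlim (fun x => dx u (x, t)) (at_right 1) (locally (nu3 t)) /\
    ex_RInt (fun s => nu3 s * P3 d t s) t 1 /\
    filterlim (fun x => dx u (x, t)) (at_left 1)
      (locally (alpha3 d * nu3 t +
                beta3 d * RInt (fun s => nu3 s * P3 d t s) t 1)).

Definition solves_problem_S (d : data) (u : point -> R) : Prop :=
  classW d u /\
  C1_up_to_boundary Omega0 u /\ C1_up_to_boundary (Omega1 d) u /\
  C1_up_to_boundary (Omega2 d) u /\ C1_up_to_boundary (Omega3 d) u /\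
  equation d u /\
  nonlocal_conditions d u /\
  u (0, 0) = 0 /\ u (1, 0) = 0 /\
  transmitting_condition1 d u /\ transmitting_condition2 d u /\
  transmitting_condition3 d u.

(* P(t, s) = Pa(t) Pb(s) on the unit square, where b is the derivative of Pb,
   the quotient Pa / b is defined on [0, 1], and q is its derivative. *)
Definition factorization (P : R -> R -> R) (Pa Pb b q : R -> R) : Prop :=
  (forall t s, unit_interval t -> unit_interval s -> P t s = Pa t * Pb s) /\
  deriv01 Pb b /\
  (forall s, unit_interval s -> b s <> 0) /\
  deriv01 (fun s => Pa s / b s) q.

(* Main.v *)
Require Import Defs.
From Stdlib Require Import Reals Lra Classical.
From Coquelicot Require Import Coquelicot.
Open Scope R_scope.

(** The difference [w] of two solutions solves the same problem with a zero
    right-hand side ([difference_solves]), so it is enough to show that such a [w]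
    vanishes, first on the square and then in the three hyperbolic domains.

    In a hyperbolic domain w_x - w_t and w_x + w_t are constant along the two
    families of characteristics. Both characteristics from a point of the straight
    side reach the curve, where the nonlocal condition ties the two constants
    together; hence on each side the normal derivative taken from that domain is a
    multiple of the derivative along the side ([characteristic_traces]). Inserted in the
    transmission conditions, this leaves a problem on the square alone.

    The sign conditions on P_2 and P_3 leave no room for the integral terms: as
    P_{j,2}(1) = 0 and the derivative of P_{j,2} has constant sign, they force
    beta_j P_j = 0 ([nonlocal_term_vanishes]). The lateral conditions become
    w_x = k2 w_t at x = 0 and w_x = k3 w_t at x = 1, with k3 <= 0 <= k2.

    The initial trace w(x, 0) is zero. For lam < 1 the boundedness of w_t makes the
    fractional derivative, hence w_xx, tend to zero uniformly as t tends to 0, so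
    the trace is affine with zero end values ([fractional_initial_slope]). For
    lam = 1 the slope h of the trace solves
        h' = a h - c P_{1,1}(x) H(x),   H(x) = int_x^1 h P_{1,2},   c >= 0,
    and the lateral conditions give h(0) = k2 h'(0) and h(1) = k3 h'(1) at the
    corners. The energy identity of this equation contains a boundary term with the
    sign of P_{1,1}(0) / P_{1,2}'(0), which the hypotheses leave open. A sign
    argument replaces it: with these corner values h cannot change sign
    ([ms_positive]), but its integral is zero ([memory_trace_slope_zero]).

    Finally a maximum principle applies. Where w(x, .) is largest over its past and
    positive, the time derivative is bounded below by a positive multiple of w: for
    lam < 1 by integration by parts ([caputo_integral_at_running_max]), for lam = 1
    after multiplication by exp(-t). This contradicts w_xx <= 0 at an interior
    maximum, and a barrier x (1 - x) handles the lateral conditions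
    ([parabolic_maximum_principle]). So w <= 0 and, exchanging the two solutions,
    w = 0 on the square. Then the traces and the constants along characteristics
    are zero as well ([Omega_vanishing]). *)

(** * Calculus on the real line *)

Lemma mvt_open (f df : R -> R) (a b : R) :
  a < b ->
  (forall x, a < x < b -> is_derive f x (df x)) ->
  (forall x, a <= x <= b -> continuous f x) ->
  exists c, a < c < b /\ f b - f a = df c * (b - a).
Proof.
intros Hab Hd Hc.
assert (pr1 : forall c, a < c < b -> derivable_pt f c).
{ intros c Hx. exists (df c). apply is_derive_Reals. now apply Hd. }
assert (pr2 : forall c, a < c < b -> derivable_pt id c).
{ intros c _. apply derivable_pt_id. }
destruct (MVT f id a b pr1 pr2 Hab) as [c [P E]].
- intros x Hx. apply continuity_pt_filterlim. now apply Hc.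
- intros x _. apply derivable_continuous_pt, derivable_pt_id.
- exists c. split; [exact P|].
  rewrite (derive_pt_eq_0 f c (df c) (pr1 c P)) in E
    by (apply is_derive_Reals; now apply Hd).
  rewrite (derive_pt_eq_0 id c 1 (pr2 c P)) in E by apply derivable_pt_lim_id.
  unfold id in E. lra.
Qed.

Lemma nondecreasing_of_derive (f df : R -> R) (a b : R) :
  a <= b ->
  (forall x, a < x < b -> is_derive f x (df x)) ->
  (forall x, a <= x <= b -> continuous f x) ->
  (forall x, a < x < b -> 0 <= df x) ->
  f a <= f b.
Proof.
intros [Hab | ->] Hd Hc Hp; [|lra].
destruct (mvt_open f df a b Hab Hd Hc) as [c [P E]].
assert (0 <= df c * (b - a)); [|lra].
apply Rmult_le_pos; [now apply Hp | lra].
Qed.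

Lemma increasing_of_derive (f df : R -> R) (a b : R) :
  a < b ->
  (forall x, a < x < b -> is_derive f x (df x)) ->
  (forall x, a <= x <= b -> continuous f x) ->
  (forall x, a < x < b -> 0 < df x) ->
  f a < f b.
Proof.
intros Hab Hd Hc Hp.
destruct (mvt_open f df a b Hab Hd Hc) as [c [P E]].
assert (0 < df c * (b - a)); [|lra].
apply Rmult_lt_0_compat; [now apply Hp | lra].
Qed.

Lemma constant_of_derive (f : R -> R) (a b : R) :
  a <= b ->
  (forall x, a < x < b -> is_derive f x 0) ->
  (forall x, a <= x <= b -> continuous f x) ->
  f a = f b.
Proof.
intros [Hab | ->] Hd Hc; [|lra].
destruct (mvt_open f (fun _ => 0) a b Hab Hd Hc) as [c [P E]]. lra.
Qed.

(** [r] ends the largest initial interval on which [phi] is positive. *)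
Lemma first_zero (phi : R -> R) (l : R) :
  0 <= l ->
  (forall x, 0 <= x <= l -> continuous phi x) ->
  0 < phi 0 ->
  (forall x, 0 <= x <= l -> 0 < phi x) \/
  exists r, 0 < r <= l /\ phi r = 0 /\ forall x, 0 <= x < r -> 0 < phi x.
Proof.
intros Hl Hc H0.
set (E := fun r => 0 <= r <= l /\ forall x, 0 <= x <= r -> 0 < phi x).
destruct (completeness E) as [m [Hub Hlub]].
- exists l. intros r [Hr _]. lra.
- exists 0. split; [lra|]. intros x Hx. now replace x with 0 by lra.
- assert (Hm0 : 0 <= m).
  { apply Hub. split; [lra|]. intros x Hx. now replace x with 0 by lra. }
  assert (Hml : m <= l) by (apply Hlub; intros r [Hr _]; lra).
  assert (Hbefore : forall x, 0 <= x < m -> 0 < phi x).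
  { intros x Hx. destruct (Rlt_le_dec 0 (phi x)) as [|Hn]; [easy|].
    exfalso. assert (m <= x); [|lra].
    apply Hlub. intros r [Hr Hp]. destruct (Rle_dec r x); [easy|].
    specialize (Hp x ltac:(lra)). lra. }
  destruct (Rlt_le_dec 0 (phi m)) as [Hpos | Hneg].
  + left.
    destruct (Req_dec m l) as [-> | Hne].
    * intros x Hx. destruct (Req_dec x l) as [-> | ]; [easy|].
      apply Hbefore; lra.
    * exfalso.
      destruct (proj1 (filterlim_locally _ _) (Hc m (conj Hm0 Hml)) (mkposreal _ Hpos))
        as [e He].
      pose proof (cond_pos e) as Hep.
      set (r := Rmin l (m + e / 2)).
      assert (Hr : m < r /\ r <= l /\ r <= m + e / 2).
      { unfold r. repeat split; [apply Rmin_glb_lt; lra | apply Rmin_l | apply Rmin_r]. }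
      assert (r <= m); [|lra].
      apply Hub. split; [lra|]. intros x Hx.
      destruct (Rlt_le_dec x m) as [Hxm|Hxm]; [apply Hbefore; lra|].
      assert (Hb : ball m e x).
      { change (Rabs (x - m) < e). rewrite Rabs_right; lra. }
      specialize (He x Hb). change (Rabs (phi x - phi m) < phi m) in He.
      apply Rabs_def2 in He. lra.
  + right. exists m.
    assert (Hz : phi m = 0).
    { apply Rle_antisym; [easy|].
      destruct (Req_dec m 0) as [-> | Hne]; [lra|].
      destruct (Rle_lt_dec 0 (phi m)) as [|Hlt]; [easy|exfalso].
      assert (Hopp : 0 < - phi m) by lra.
      destruct (proj1 (filterlim_locally _ _) (Hc m (conj Hm0 Hml)) (mkposreal _ Hopp))
        as [e He].
      pose proof (cond_pos e) as Hep.
      set (x := Rmax 0 (m - e / 2)).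
      assert (Hx : 0 <= x < m /\ m - e / 2 <= x).
      { unfold x. repeat split; [apply Rmax_l | apply Rmax_lub_lt; lra | apply Rmax_r]. }
      assert (Hb : ball m e x).
      { change (Rabs (x - m) < e). rewrite Rabs_left; lra. }
      specialize (He x Hb). change (Rabs (phi x - phi m) < - phi m) in He.
      apply Rabs_def2 in He. specialize (Hbefore x ltac:(lra)). lra. }
    repeat split; try easy.
    destruct Hm0 as [|E0]; [easy|]. subst m. lra.
Qed.

Lemma filterlim_Rplus {T : Type} (F : (T -> Prop) -> Prop) {FF : Filter F}
    (f g : T -> R) (a b : R) :
  filterlim f F (locally a) -> filterlim g F (locally b) ->
  filterlim (fun t => f t + g t) F (locally (a + b)).
Proof.
intros Hf Hg.
eapply filterlim_comp_2; [exact Hf | exact Hg | apply (filterlim_plus (V := R_NormedModule))].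
Qed.

Lemma filterlim_Rminus {T : Type} (F : (T -> Prop) -> Prop) {FF : Filter F}
    (f g : T -> R) (a b : R) :
  filterlim f F (locally a) -> filterlim g F (locally b) ->
  filterlim (fun t => f t - g t) F (locally (a - b)).
Proof.
intros Hf Hg. apply (filterlim_Rplus F f (fun t => - g t)); [easy|].
eapply filterlim_comp; [exact Hg | apply (filterlim_opp (V := R_NormedModule) b)].
Qed.

Lemma filterlim_Rmult {T : Type} (F : (T -> Prop) -> Prop) {FF : Filter F}
    (f g : T -> R) (a b : R) :
  filterlim f F (locally a) -> filterlim g F (locally b) ->
  filterlim (fun t => f t * g t) F (locally (a * b)).
Proof.
intros Hf Hg.
eapply filterlim_comp_2; [exact Hf | exact Hg | apply (filterlim_mult (K := R_AbsRing))].
Qed.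

Lemma continuous_of_is_derive (f : R -> R) (x l : R) :
  is_derive f x l -> continuous f x.
Proof.
intros H. apply (ex_derive_continuous (V := R_NormedModule)). now exists l.
Qed.

Lemma filterlim_le_const {T : Type} (F : (T -> Prop) -> Prop) {FF : ProperFilter F}
    (f : T -> R) (a b : R) :
  filterlim f F (locally a) -> F (fun t => f t <= b) -> a <= b.
Proof.
intros Hf Hb.
exact (filterlim_le (F := F) f (fun _ => b) a b Hb Hf (filterlim_const b)).
Qed.

Lemma filterlim_ge_const {T : Type} (F : (T -> Prop) -> Prop) {FF : ProperFilter F}
    (f : T -> R) (a b : R) :
  filterlim f F (locally a) -> F (fun t => b <= f t) -> b <= a.
Proof.
intros Hf Hb.
exact (filterlim_le (F := F) (fun _ => b) f b a Hb (filterlim_const b) Hf).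
Qed.

(** The derivative of a limit of functions, when the derivatives converge
    jointly: the mean value inequality on each function survives the limit. *)
Lemma is_derive_of_limit {T : Type} (F : (T -> Prop) -> Prop) {FF : ProperFilter F}
    (f f1 : R -> T -> R) (tau : R -> R) (x L : R) :
  (forall eps : posreal, exists del : posreal, F (fun t =>
     forall y, Rabs (y - x) < del ->
       is_derive (fun z => f z t) y (f1 y t) /\ Rabs (f1 y t - L) <= eps)) ->
  locally x (fun y => filterlim (f y) F (locally (tau y))) ->
  is_derive tau x L.
Proof.
intros Hd [d0 Hl].
apply is_derive_Reals. intros eps Heps.
assert (Heps2 : 0 < eps / 2) by lra.
destruct (Hd (mkposreal _ Heps2)) as [del Hdel].
assert (Hm : 0 < Rmin d0 del) by (apply Rmin_glb_lt; apply cond_pos).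
exists (mkposreal _ Hm). intros h Hh0 Hh. simpl in Hh.
assert (Hh1 : Rabs h < d0) by (eapply Rlt_le_trans; [exact Hh | apply Rmin_l]).
assert (Hh2 : Rabs h < del) by (eapply Rlt_le_trans; [exact Hh | apply Rmin_r]).
assert (Hbound : F (fun t =>
  Rabs (f (x + h) t - f x t - L * h) <= eps / 2 * Rabs h)).
{ revert Hdel. apply filter_imp. intros t Ht.
  destruct (MVT_gen (fun z => f z t) x (x + h) (fun z => f1 z t)) as [c [Hc E]].
  - intros z Hz. apply Ht.
    revert Hh2 Hz. unfold Rmin, Rmax, Rabs.
    repeat destruct Rle_dec; repeat destruct Rcase_abs; lra.
  - intros z Hz. apply continuity_pt_filterlim.
    apply continuous_of_is_derive with (f1 z t). apply Ht.
    revert Hh2 Hz. unfold Rmin, Rmax, Rabs.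
    repeat destruct Rle_dec; repeat destruct Rcase_abs; lra.
  - rewrite E. replace (f1 c t * (x + h - x) - L * h) with ((f1 c t - L) * h) by ring.
    rewrite Rabs_mult. apply Rmult_le_compat_r; [apply Rabs_pos|].
    apply Ht. revert Hh2 Hc. unfold Rmin, Rmax, Rabs.
    repeat destruct Rle_dec; repeat destruct Rcase_abs; lra. }
assert (Hlim : Rabs (tau (x + h) - tau x - L * h) <= eps / 2 * Rabs h).
{ apply (filterlim_le_const F (fun t => Rabs (f (x + h) t - f x t - L * h))); [|easy].
  eapply filterlim_comp; [|apply continuity_pt_filterlim, Rcontinuity_abs].
  apply (filterlim_Rminus F); [|apply filterlim_const].
  apply (filterlim_Rminus F); [|now apply Hl, ball_center].
  apply Hl. change (Rabs (x + h - x) < d0). now replace (x + h - x) with h by ring. }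
replace ((tau (x + h) - tau x) / h - L) with ((tau (x + h) - tau x - L * h) / h)
  by (field; easy).
unfold Rdiv at 1. rewrite Rabs_mult, Rabs_inv.
assert (Hhp : 0 < Rabs h) by now apply Rabs_pos_lt.
apply Rmult_lt_reg_r with (Rabs h); [easy|].
rewrite Rmult_assoc, Rinv_l by lra.
assert (0 < eps * Rabs h) by now apply Rmult_lt_0_compat.
lra.
Qed.

(** * Functions on the unit interval and the sign conditions *)

(** Composing with [clamp] makes a function on the closed unit interval total,
    so that one-sided continuity at the ends becomes ordinary continuity. *)
Definition clamp (r : R) : R := Rmax 0 (Rmin 1 r).

Lemma clamp_unit (r : R) : unit_interval (clamp r).
Proof.
unfold unit_interval, clamp, Rmax, Rmin. repeat destruct Rle_dec; lra.
Qed.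

Lemma clamp_id (r : R) : unit_interval r -> clamp r = r.
Proof.
unfold unit_interval, clamp, Rmax, Rmin. repeat destruct Rle_dec; lra.
Qed.

Lemma clamp_lipschitz (x y : R) : Rabs (clamp x - clamp y) <= Rabs (x - y).
Proof.
unfold clamp, Rmax, Rmin, Rabs.
repeat destruct Rle_dec; repeat destruct Rcase_abs; lra.
Qed.

Lemma locally_open_unit (s : R) : 0 < s < 1 -> locally s (fun x => 0 < x < 1).
Proof.
intros Hs. assert (He : 0 < Rmin s (1 - s)) by (apply Rmin_glb_lt; lra).
exists (mkposreal _ He). intros x Hx. change (Rabs (x - s) < Rmin s (1 - s)) in Hx.
assert (Rmin s (1 - s) <= s) by apply Rmin_l.
assert (Rmin s (1 - s) <= 1 - s) by apply Rmin_r.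
apply Rabs_def2 in Hx. lra.
Qed.

Lemma is_derive_clamp (f : R -> R) (s l : R) :
  0 < s < 1 -> is_derive f s l -> is_derive (fun x => f (clamp x)) s l.
Proof.
intros Hs H. apply (is_derive_ext_loc f); [|easy].
generalize (locally_open_unit s Hs). apply filter_imp. intros x Hx.
rewrite clamp_id; [easy | unfold unit_interval; lra].
Qed.

Lemma deriv01_interior (f f' : R -> R) (s : R) :
  deriv01 f f' -> 0 < s < 1 -> is_derive f s (f' s).
Proof.
intros Hf Hs. apply is_derive_Reals. intros eps Heps.
destruct (Hf s ltac:(unfold unit_interval; lra) eps Heps) as [alp [Ha HD]].
destruct (locally_open_unit s Hs) as [e He].
assert (Hm : 0 < Rmin alp e) by (apply Rmin_glb_lt; [lra | apply cond_pos]).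
exists (mkposreal _ Hm). intros h Hh0 Hh. simpl in Hh.
assert (Rabs h < alp) by (eapply Rlt_le_trans; [exact Hh | apply Rmin_l]).
assert (Hhe : Rabs h < e) by (eapply Rlt_le_trans; [exact Hh | apply Rmin_r]).
assert (Hx : 0 < s + h < 1).
{ apply He. change (Rabs (s + h - s) < e). now replace (s + h - s) with h by ring. }
replace h with (s + h - s) at 2 by ring.
apply (HD (s + h)). split.
- split; [unfold unit_interval; lra | lra].
- unfold dist. simpl. unfold Rdist. now replace (s + h - s) with h by ring.
Qed.

Lemma deriv01_continuous (f f' : R -> R) :
  deriv01 f f' -> forall x, continuous (fun y => f (clamp y)) x.
Proof.
intros Hf x. set (s := clamp x).
destruct (Hf s (clamp_unit x) 1 ltac:(lra)) as [alp [Ha HD]].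
apply filterlim_locally. intros eps.
set (K := Rabs (f' s) + 1).
assert (HK : 0 < K) by (unfold K; generalize (Rabs_pos (f' s)); lra).
assert (Hm : 0 < Rmin alp (eps / K)).
{ apply Rmin_glb_lt; [lra|]. apply Rdiv_lt_0_compat; [apply cond_pos | easy]. }
exists (mkposreal _ Hm). intros y Hy. change (Rabs (y - x) < Rmin alp (eps / K)) in Hy.
change (Rabs (f (clamp y) - f s) < eps).
assert (Hd : Rabs (clamp y - s) < Rmin alp (eps / K)).
{ eapply Rle_lt_trans; [apply clamp_lipschitz | exact Hy]. }
assert (Hd1 : Rabs (clamp y - s) < alp) by (eapply Rlt_le_trans; [exact Hd | apply Rmin_l]).
assert (Hd2 : Rabs (clamp y - s) < eps / K) by (eapply Rlt_le_trans; [exact Hd | apply Rmin_r]).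
destruct (Req_dec s (clamp y)) as [E | Hne].
- rewrite <- E. rewrite Rminus_diag, Rabs_R0. apply cond_pos.
- assert (HQ : Rabs ((f (clamp y) - f s) / (clamp y - s) - f' s) < 1).
  { apply (HD (clamp y)). split; [split; [apply clamp_unit | easy] | exact Hd1]. }
  assert (HQ2 : Rabs ((f (clamp y) - f s) / (clamp y - s)) <= K).
  { unfold K. replace ((f (clamp y) - f s) / (clamp y - s))
      with (((f (clamp y) - f s) / (clamp y - s) - f' s) + f' s) by ring.
    eapply Rle_trans; [apply Rabs_triang | lra]. }
  replace (f (clamp y) - f s)
    with ((f (clamp y) - f s) / (clamp y - s) * (clamp y - s)) by (field; lra).
  rewrite Rabs_mult.
  apply Rle_lt_trans with (K * Rabs (clamp y - s)).
  + apply Rmult_le_compat_r; [apply Rabs_pos | easy].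
  + apply Rlt_le_trans with (K * (eps / K)).
    * now apply Rmult_lt_compat_l.
    * right. field. lra.
Qed.

Lemma deriv01_opp (f f' : R -> R) :
  deriv01 f f' -> deriv01 (fun x => - f x) (fun x => - f' x).
Proof.
intros Hf s Hs eps Heps.
destruct (Hf s Hs eps Heps) as [alp [Ha HD]]. exists alp. split; [easy|].
intros x [[Hx Hne] Hd]. specialize (HD x (conj (conj Hx Hne) Hd)).
revert HD. unfold dist. simpl. unfold Rdist.
replace ((- f x - - f s) / (x - s) - - f' s) with (- ((f x - f s) / (x - s) - f' s))
  by (field; lra).
now rewrite Rabs_Ropp.
Qed.

(** A maximum of [f] between [x] and [y] would be interior, where [f'] does
    not vanish. *)
Lemma darboux_aux (f f' : R -> R) (x y : R) :
  deriv01 f f' -> (forall s, unit_interval s -> f' s <> 0) ->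
  0 <= x -> x < y -> y <= 1 -> 0 < f' x -> f' y < 0 -> False.
Proof.
intros Hf Hn Hx0 Hxy Hy1 Hpx Hny.
set (F := fun z => f (clamp z)).
assert (HF : forall z, unit_interval z -> F z = f z).
{ intros z Hz. unfold F. now rewrite clamp_id. }
destruct (continuity_ab_maj F x y) as [m [Hmax Hm]]; [lra| |].
{ intros c _. apply continuity_pt_filterlim. now apply (deriv01_continuous f f'). }
assert (Hum : unit_interval m) by (unfold unit_interval; lra).
destruct (Req_dec m x) as [-> | Hmx].
- destruct (Hf x Hum (f' x) Hpx) as [alp [Ha HD]].
  set (z := Rmin (x + alp / 2) y).
  assert (Hz : x < z /\ z <= x + alp / 2 /\ z <= y).
  { unfold z. repeat split; [apply Rmin_glb_lt; lra | apply Rmin_l | apply Rmin_r]. }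
  assert (HQ : Rabs ((f z - f x) / (z - x) - f' x) < f' x).
  { apply (HD z). split; [split; [unfold unit_interval; lra | lra]|].
    unfold dist; simpl; unfold Rdist. rewrite Rabs_right; lra. }
  apply Rabs_def2 in HQ.
  assert (0 < (f z - f x) / (z - x) * (z - x)) by (apply Rmult_lt_0_compat; lra).
  replace ((f z - f x) / (z - x) * (z - x)) with (f z - f x) in H by (field; lra).
  specialize (Hmax z ltac:(lra)). rewrite !HF in Hmax by (unfold unit_interval; lra). lra.
- destruct (Req_dec m y) as [-> | Hmy].
  + destruct (Hf y Hum (- f' y) ltac:(lra)) as [alp [Ha HD]].
    set (z := Rmax (y - alp / 2) x).
    assert (Hz : z < y /\ y - alp / 2 <= z /\ x <= z).
    { unfold z. repeat split; [apply Rmax_lub_lt; lra | apply Rmax_l | apply Rmax_r]. }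
    assert (HQ : Rabs ((f z - f y) / (z - y) - f' y) < - f' y).
    { apply (HD z). split; [split; [unfold unit_interval; lra | lra]|].
      unfold dist; simpl; unfold Rdist. rewrite Rabs_left; lra. }
    apply Rabs_def2 in HQ.
    assert (0 < - ((f z - f y) / (z - y)) * (y - z)) by (apply Rmult_lt_0_compat; lra).
    replace (- ((f z - f y) / (z - y)) * (y - z)) with (f z - f y) in H by (field; lra).
    specialize (Hmax z ltac:(lra)). rewrite !HF in Hmax by (unfold unit_interval; lra). lra.
  + assert (Hd : is_derive F m (f' m)).
    { apply is_derive_clamp; [lra|]. apply deriv01_interior; [easy | lra]. }
    apply is_derive_Reals in Hd.
    assert (pr : derivable_pt F m) by now exists (f' m).
    apply (Hn m Hum).
    rewrite <- (derive_pt_eq_0 F m (f' m) pr Hd).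
    apply (deriv_maximum F x y m pr); [lra | lra | intros z Hz1 Hz2; apply Hmax; lra].
Qed.

(** A derivative without zeros has constant sign even if it is discontinuous. *)
Lemma deriv01_constant_sign (f f' : R -> R) :
  deriv01 f f' -> (forall s, unit_interval s -> f' s <> 0) ->
  (forall s, unit_interval s -> 0 < f' s) \/
  (forall s, unit_interval s -> f' s < 0).
Proof.
intros Hf Hn.
assert (Hf2 := deriv01_opp f f' Hf).
assert (Hn2 : forall s, unit_interval s -> - f' s <> 0).
{ intros s Hs. specialize (Hn s Hs). lra. }
assert (H0 : unit_interval 0) by (unfold unit_interval; lra).
destruct (Rtotal_order (f' 0) 0) as [Hs | [Hs | Hs]].
- right. intros s Us. destruct (Rtotal_order (f' s) 0) as [H | [H | H]]; [easy | |].
  + now destruct (Hn s Us).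
  + exfalso. destruct (Req_dec s 0) as [-> |]; [lra|].
    unfold unit_interval in Us.
    apply (darboux_aux _ _ 0 s Hf2 Hn2); lra.
- now destruct (Hn 0 H0).
- left. intros s Us. destruct (Rtotal_order (f' s) 0) as [H | [H | H]]; [ | | easy].
  + exfalso. destruct (Req_dec s 0) as [-> |]; [lra|].
    unfold unit_interval in Us.
    apply (darboux_aux _ _ 0 s Hf Hn); lra.
  + now destruct (Hn s Us).
Qed.

Lemma deriv01_nondecreasing (f f' : R -> R) :
  deriv01 f f' -> (forall s, unit_interval s -> 0 <= f' s) -> monotone01 f.
Proof.
intros Hf Hp s r Hs Hsr Hr.
rewrite <- (clamp_id s), <- (clamp_id r) by (unfold unit_interval; lra).
apply (nondecreasing_of_derive (fun x => f (clamp x)) f'); [easy | | |].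
- intros x Hx. apply is_derive_clamp; [lra|]. apply deriv01_interior; [easy | lra].
- intros x _. now apply (deriv01_continuous f f').
- intros x Hx. apply Hp. unfold unit_interval; lra.
Qed.

Lemma deriv01_scal (k : R) (f f' : R -> R) :
  deriv01 f f' -> deriv01 (fun x => k * f x) (fun x => k * f' x).
Proof.
intros Hf s Hs eps Heps.
assert (HK : 0 < Rabs k + 1) by (generalize (Rabs_pos k); lra).
destruct (Hf s Hs (eps / (Rabs k + 1)) ltac:(now apply Rdiv_lt_0_compat)) as [alp [Ha HD]].
exists alp. split; [easy|].
intros x [[Hx Hne] Hd]. specialize (HD x (conj (conj Hx Hne) Hd)).
revert HD. unfold dist. simpl. unfold Rdist. intros HD.
replace ((k * f x - k * f s) / (x - s) - k * f' s)
  with (k * ((f x - f s) / (x - s) - f' s)) by (field; lra).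
rewrite Rabs_mult.
apply Rle_lt_trans with (Rabs k * (eps / (Rabs k + 1))).
- apply Rmult_le_compat_l; [apply Rabs_pos | lra].
- apply Rlt_le_trans with ((Rabs k + 1) * (eps / (Rabs k + 1))).
  + apply Rmult_lt_compat_r; [now apply Rdiv_lt_0_compat | lra].
  + right. field. lra.
Qed.

(** [Pb] vanishes at 1, so [Pb] and its derivative [b] have opposite signs before
    1. The bounds at 0 and on [q] make [C * (Pa / b)] nonpositive, hence
    [C * (Pa * Pb)] nonnegative, against its assumed sign: it must vanish. *)
Lemma nonlocal_term_vanishes (P : R -> R -> R) (Pa Pb b q : R -> R) (C : R) :
  factorization P Pa Pb b q ->
  Pb 1 = 0 ->
  (forall t, unit_interval t -> C * (Pa t * Pb t) <= 0) ->
  C * (Pa 0 / b 0) <= 0 ->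
  (forall t, unit_interval t -> C * q t <= 0) ->
  forall t, 0 < t < 1 -> C * Pa t = 0.
Proof.
intros (_ & Hb & Hn & Hq) H1 Hab H0 Hq0 t Ht.
assert (Ut : unit_interval t) by (unfold unit_interval; lra).
assert (Hr : C * (Pa t / b t) <= 0).
{ assert (M := deriv01_nondecreasing _ _ (deriv01_scal (- C) _ _ Hq)).
  specialize (M ltac:(intros s Hs; specialize (Hq0 s Hs); lra) 0 t ltac:(lra) ltac:(lra) ltac:(lra)).
  simpl in M. lra. }
assert (Hs : Pb t * b t < 0).
{ destruct (mvt_open (fun x => Pb (clamp x)) b t 1) as [xi [Hxi E]]; [lra | | |].
  - intros x Hx. apply is_derive_clamp; [lra|]. apply deriv01_interior; [easy | lra].
  - intros x _. now apply (deriv01_continuous Pb b).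
  - rewrite !clamp_id in E by (unfold unit_interval; lra). rewrite H1 in E.
    assert (Ux : unit_interval xi) by (unfold unit_interval; lra).
    assert (0 < b xi * b t).
    { destruct (deriv01_constant_sign Pb b Hb Hn) as [S | S];
        generalize (S xi Ux), (S t Ut); nra. }
    replace (Pb t) with (b xi * (t - 1)) by lra.
    replace (b xi * (t - 1) * b t) with (- (b xi * b t * (1 - t))) by ring.
    assert (0 < b xi * b t * (1 - t)) by (apply Rmult_lt_0_compat; lra). lra. }
assert (Hbt := Hn t Ut). specialize (Hab t Ut).
replace (C * (Pa t * Pb t)) with (C * (Pa t / b t) * (Pb t * b t)) in Hab by (field; easy).
replace (C * Pa t) with (C * (Pa t / b t) * b t) by (field; easy).
replace (C * (Pa t / b t)) with 0 by nra. ring.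
Qed.

(** * The memory equation for the initial slope *)

Lemma is_derive_Ropp (f : R -> R) (x l : R) :
  is_derive f x l -> is_derive (fun y => - f y) x (- l).
Proof. exact (is_derive_opp (V := R_NormedModule) f x l). Qed.

Lemma continuous_Ropp (f : R -> R) (x : R) :
  continuous f x -> continuous (fun y => - f y) x.
Proof. exact (continuous_opp (V := R_NormedModule) f x). Qed.

Lemma is_derive_exp_weight (L f : R -> R) (x dL df : R) :
  is_derive L x dL -> is_derive f x df ->
  is_derive (fun y => exp (L y) * f y) x (exp (L x) * (df + dL * f x)).
Proof.
intros HL Hf.
replace (exp (L x) * (df + dL * f x)) with (dL * exp (L x) * f x + exp (L x) * df) by ring.
apply (is_derive_mult (fun y => exp (L y)) f); [|exact Hf|intros; apply Rmult_comm].
apply (is_derive_comp exp L); [apply is_derive_exp | exact HL].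
Qed.

Lemma continuous_exp_weight (L f : R -> R) (x : R) :
  continuous L x -> continuous f x -> continuous (fun y => exp (L y) * f y) x.
Proof.
intros HL Hf.
apply (continuous_mult (K := R_AbsRing)); [|exact Hf].
apply (continuous_comp L exp); [exact HL | apply continuous_exp].
Qed.

(** The weight exp(-L) makes [E] nonincreasing and exp(L) makes it
    nondecreasing, so a zero spreads in both directions. *)
Lemma gronwall_zero (E e L dL : R -> R) (z : R) :
  (forall x, 0 <= x <= 1 -> continuous E x) ->
  (forall x, 0 <= x <= 1 -> continuous L x) ->
  (forall x, 0 < x < 1 -> is_derive E x (e x)) ->
  (forall x, 0 < x < 1 -> is_derive L x (dL x)) ->
  (forall x, 0 < x < 1 -> Rabs (e x) <= dL x * E x) ->
  (forall x, 0 <= x <= 1 -> 0 <= E x) ->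
  0 <= z <= 1 -> E z = 0 ->
  forall x, 0 <= x <= 1 -> E x = 0.
Proof.
intros CE CL DE DL Hb HE Hz Ez x Hx.
apply Rle_antisym; [|now apply HE].
destruct (Rle_dec z x) as [Hzx | Hxz].
- assert (M : - (exp (- L z) * E z) <= - (exp (- L x) * E x)).
  { apply (nondecreasing_of_derive (fun y => - (exp (- L y) * E y))
      (fun y => - (exp (- L y) * (e y + - dL y * E y)))); [easy | | |].
    - intros y Hy. apply (is_derive_Ropp (fun y => exp (- L y) * E y)).
      apply (is_derive_exp_weight (fun y => - L y)); [|apply DE; lra].
      apply (is_derive_Ropp L). apply DL. lra.
    - intros y Hy. apply (continuous_Ropp (fun y => exp (- L y) * E y)).
      apply (continuous_exp_weight (fun y => - L y)); [|apply CE; lra].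
      apply (continuous_Ropp L). apply CL. lra.
    - intros y Hy. specialize (Hb y ltac:(lra)). apply Rabs_le_between in Hb.
      generalize (exp_pos (- L y)). nra. }
  rewrite Ez in M. generalize (exp_pos (- L x)). nra.
- assert (M : exp (L x) * E x <= exp (L z) * E z).
  { apply (nondecreasing_of_derive (fun y => exp (L y) * E y)
      (fun y => exp (L y) * (e y + dL y * E y))); [lra | | |].
    - intros y Hy. apply is_derive_exp_weight; [apply DL; lra | apply DE; lra].
    - intros y Hy. apply continuous_exp_weight; [apply CL; lra | apply CE; lra].
    - intros y Hy. specialize (Hb y ltac:(lra)). apply Rabs_le_between in Hb.
      generalize (exp_pos (L y)). nra. }
  rewrite Ez in M. generalize (exp_pos (L x)). nra.
Qed.

(** [h] is the slope of the trace on AB and [H x] the integral of [h * p2] over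
    [x, 1]; in this form the memory equation is a linear differential system. The
    derivative [b] of [p2] may be unbounded, so the coefficient [p1] is kept as
    the product of [b] with a monotone function. *)
Record memory_system (h H p1 p2 b r : R -> R) (a c : R) : Prop := {
  ms_h_cont : forall x, 0 <= x <= 1 -> continuous h x;
  ms_H_cont : forall x, 0 <= x <= 1 -> continuous H x;
  ms_p2_cont : forall x, 0 <= x <= 1 -> continuous p2 x;
  ms_h_deriv : forall x, 0 < x < 1 -> is_derive h x (a * h x - c * (p1 x * H x));
  ms_H_deriv : forall x, 0 < x < 1 -> is_derive H x (- (h x * p2 x));
  ms_H_end : H 1 = 0;
  ms_p2_deriv : forall x, 0 < x < 1 -> is_derive p2 x (b x);
  ms_b_pos : forall x, 0 < x < 1 -> 0 < b x;
  ms_p1 : forall x, 0 < x < 1 -> p1 x = r x * b x;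
  ms_r_mono : monotone01 r;
  ms_sign : forall x, 0 < x < 1 -> 0 <= p1 x * p2 x;
  ms_c_pos : 0 <= c
}.

Arguments ms_h_cont {h H p1 p2 b r a c}.
Arguments ms_H_cont {h H p1 p2 b r a c}.
Arguments ms_p2_cont {h H p1 p2 b r a c}.
Arguments ms_h_deriv {h H p1 p2 b r a c}.
Arguments ms_H_deriv {h H p1 p2 b r a c}.
Arguments ms_H_end {h H p1 p2 b r a c}.
Arguments ms_p2_deriv {h H p1 p2 b r a c}.
Arguments ms_b_pos {h H p1 p2 b r a c}.
Arguments ms_p1 {h H p1 p2 b r a c}.
Arguments ms_r_mono {h H p1 p2 b r a c}.
Arguments ms_sign {h H p1 p2 b r a c}.
Arguments ms_c_pos {h H p1 p2 b r a c}.

Section MemorySystem.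

Context {h H p1 p2 b r : R -> R} {a c : R}.
Context (MS : memory_system h H p1 p2 b r a c).

Lemma ms_p2_mono : monotone01 p2.
Proof.
intros s t Hs Hst Ht.
apply (nondecreasing_of_derive p2 b); [easy | | |].
- intros x Hx. apply (ms_p2_deriv MS). lra.
- intros x Hx. apply (ms_p2_cont MS). lra.
- intros x Hx. apply Rlt_le, (ms_b_pos MS). lra.
Qed.

Lemma ms_p2_nonneg_after (x y : R) :
  0 < x < 1 -> 0 < p1 x -> x <= y <= 1 -> 0 <= p2 y.
Proof.
intros Hx Hp Hy. generalize (ms_sign MS x Hx). intros Hs.
assert (0 <= p2 x) by nra.
generalize (ms_p2_mono x y ltac:(lra) ltac:(lra) ltac:(lra)). lra.
Qed.

Lemma ms_negative_before (x y : R) :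
  0 < x < 1 -> p1 x < 0 -> 0 < y <= x -> p1 y < 0 /\ p2 y <= 0.
Proof.
intros Hx Hp Hy. generalize (ms_sign MS x Hx). intros Hs.
assert (p2 x <= 0) by nra.
split; [|generalize (ms_p2_mono y x); lra].
rewrite (ms_p1 MS) in Hp |- * by lra.
generalize (ms_b_pos MS x Hx) (ms_b_pos MS y ltac:(lra)).
generalize (ms_r_mono MS y x ltac:(lra) ltac:(lra) ltac:(lra)). intros.
assert (r x < 0) by nra. nra.
Qed.

Lemma ms_r_bound (x : R) : 0 <= x <= 1 -> Rabs (r x) <= Rabs (r 0) + Rabs (r 1).
Proof.
intros Hx.
generalize (ms_r_mono MS 0 x ltac:(lra) ltac:(lra) ltac:(lra)).
generalize (ms_r_mono MS x 1 ltac:(lra) ltac:(lra) ltac:(lra)).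
unfold Rabs. repeat destruct Rcase_abs; lra.
Qed.

Lemma ms_p2_bound (x : R) : 0 <= x <= 1 -> Rabs (p2 x) <= Rabs (p2 0) + Rabs (p2 1).
Proof.
intros Hx.
generalize (ms_p2_mono 0 x ltac:(lra) ltac:(lra) ltac:(lra)).
generalize (ms_p2_mono x 1 ltac:(lra) ltac:(lra) ltac:(lra)).
unfold Rabs. repeat destruct Rcase_abs; lra.
Qed.

(** Gronwall for h^2 + H^2. The weight contains [p2] itself, whose derivative
    absorbs the possibly unbounded [b]. *)
Lemma ms_unique (z : R) :
  0 <= z <= 1 -> h z = 0 -> H z = 0 -> forall x, 0 <= x <= 1 -> h x = 0.
Proof.
intros Hz h0 H0 x Hx.
set (K := Rabs (r 0) + Rabs (r 1)).
set (Q := Rabs (p2 0) + Rabs (p2 1)).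
assert (E0 : h x * h x + H x * H x = 0).
{ apply (gronwall_zero (fun y => h y * h y + H y * H y)
   (fun y => 2 * h y * (a * h y - c * (p1 y * H y)) + 2 * H y * (- (h y * p2 y)))
   (fun y => (2 * Rabs a + Q) * y + c * K * p2 y)
   (fun y => (2 * Rabs a + Q) + c * K * b y) z).
  - intros y Hy. apply (continuous_plus (V := R_NormedModule));
      apply (continuous_mult (K := R_AbsRing));
      (apply (ms_h_cont MS) || apply (ms_H_cont MS)); easy.
  - intros y Hy. apply (continuous_plus (V := R_NormedModule)).
    + apply (continuous_scal_r (V := R_NormedModule)). apply continuous_id.
    + apply (continuous_scal_r (V := R_NormedModule)).
      now apply (ms_p2_cont MS).
  - intros y Hy.
    assert (Dh := ms_h_deriv MS y Hy).
    assert (DH := ms_H_deriv MS y Hy).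
    auto_derive.
    + repeat split; eexists; eassumption.
    + change (Derive (fun x : R => h x) y) with (Derive h y).
      change (Derive (fun x : R => H x) y) with (Derive H y).
      rewrite (is_derive_unique h y _ Dh), (is_derive_unique H y _ DH). ring.
  - intros y Hy.
    assert (Dp := ms_p2_deriv MS y Hy).
    auto_derive.
    + repeat split; eexists; eassumption.
    + change (Derive (fun x : R => p2 x) y) with (Derive p2 y).
      rewrite (is_derive_unique p2 y _ Dp). ring.
  - intros y Hy.
    assert (Hb := ms_b_pos MS y Hy).
    assert (Hc := ms_c_pos MS).
    assert (Hr := ms_r_bound y ltac:(lra)). fold K in Hr.
    assert (Hp := ms_p2_bound y ltac:(lra)). fold Q in Hp.
    rewrite (ms_p1 MS y Hy).
    set (u := h y) in *. set (v := H y) in *.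
    replace (2 * u * (a * u - c * (r y * b y * v)) + 2 * v * - (u * p2 y))
      with (2 * a * (u * u) - (c * b y * r y + p2 y) * (2 * (u * v))) by ring.
    assert (Huv : Rabs (2 * (u * v)) <= u * u + v * v).
    { apply Rabs_le. generalize (Rle_0_sqr (u - v)) (Rle_0_sqr (u + v)). unfold Rsqr.
      intros. split; lra. }
    assert (HA : Rabs (2 * a * (u * u)) <= 2 * Rabs a * (u * u + v * v)).
    { rewrite (Rabs_mult (2 * a)), (Rabs_mult 2), (Rabs_right 2), (Rabs_right (u * u)) by nra.
      generalize (Rabs_pos a). nra. }
    assert (HB : Rabs ((c * b y * r y + p2 y) * (2 * (u * v)))
        <= (c * b y * K + Q) * (u * u + v * v)).
    { rewrite Rabs_mult. apply Rmult_le_compat; try apply Rabs_pos; [|easy].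
      eapply Rle_trans; [apply Rabs_triang|]. apply Rplus_le_compat; [|easy].
      assert (0 <= c * b y) by nra.
      rewrite Rabs_mult, (Rabs_right (c * b y)) by lra. now apply Rmult_le_compat_l. }
    eapply Rle_trans; [apply Rabs_triang|]. rewrite Rabs_Ropp. lra.
  - intros y Hy. nra.
  - easy.
  - rewrite h0, H0. ring.
  - easy. }
nra.
Qed.

Lemma ms_H_antitone (x y : R) :
  0 <= x -> x <= y -> y <= 1 -> (forall s, x < s < y -> 0 <= h s * p2 s) -> H y <= H x.
Proof.
intros Hx Hxy Hy Hp. apply Ropp_le_cancel.
apply (nondecreasing_of_derive (fun s => - H s) (fun s => - - (h s * p2 s))); [easy | | |].
- intros s Hs. apply (is_derive_Ropp H), (ms_H_deriv MS). lra.
- intros s Hs. apply (continuous_Ropp H), (ms_H_cont MS). lra.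
- intros s Hs. rewrite Ropp_involutive. now apply Hp.
Qed.

(** The difference quotients of [p2] at 1 are bounded, hence so is [b] along some
    sequence tending to 1; there the memory term tends to zero, so a negative slope
    of [h] at 1 must come from the local term. *)
Lemma ms_damped (g : R -> R) (B : R) :
  (forall x, 0 < x < 1 -> p2 1 - p2 x <= B * (1 - x)) ->
  (forall x, 0 < x < 1 -> g x = a * h x - c * (p1 x * H x)) ->
  continuous g 1 -> 0 < h 1 -> g 1 < 0 -> a <= 0.
Proof.
intros HB Hg Cg Hh Hg1.
destruct (Rle_lt_dec a 0) as [|Ha]; [easy|exfalso].
assert (Hc := ms_c_pos MS).
set (K := Rabs (r 0) + Rabs (r 1)).
assert (HK : 0 <= K) by (unfold K; generalize (Rabs_pos (r 0)) (Rabs_pos (r 1)); lra).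
assert (HB0 : 0 <= B).
{ specialize (HB (1/2) ltac:(lra)). generalize (ms_p2_mono (1/2) 1 ltac:(lra) ltac:(lra) ltac:(lra)). lra. }
set (M := c * K * B + 1).
assert (HM : 0 < M). { unfold M. assert (0 <= c * K * B); [|lra]. apply Rmult_le_pos; [|easy]. now apply Rmult_le_pos. }
assert (Hd : 0 < - g 1 / 2) by lra.
assert (U1 : 0 <= 1 <= 1) by lra.
destruct (proj1 (filterlim_locally _ _) Cg (mkposreal _ Hd)) as [e1 He1].
destruct (proj1 (filterlim_locally _ _) (ms_h_cont MS 1 U1) (mkposreal _ Hh)) as [e2 He2].
assert (Hd3 : 0 < - g 1 / 2 / M) by now apply Rdiv_lt_0_compat.
destruct (proj1 (filterlim_locally _ _) (ms_H_cont MS 1 U1) (mkposreal _ Hd3)) as [e3 He3].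
set (e := Rmin e1 (Rmin e2 e3)).
assert (Hee : 0 < e /\ e <= e1 /\ e <= e2 /\ e <= e3).
{ unfold e. repeat split.
  - repeat apply Rmin_glb_lt; apply cond_pos.
  - apply Rmin_l.
  - eapply Rle_trans; [apply Rmin_r | apply Rmin_l].
  - eapply Rle_trans; [apply Rmin_r | apply Rmin_r]. }
set (x := Rmax (1/2) (1 - e / 2)).
assert (Hx : 1/2 <= x /\ x < 1 /\ 1 - e / 2 <= x).
{ unfold x. repeat split; [apply Rmax_l | apply Rmax_lub_lt; lra | apply Rmax_r]. }
destruct (mvt_open p2 b x 1) as [xi [Hxi E]]; [lra | | |].
- intros y Hy. apply (ms_p2_deriv MS). lra.
- intros y Hy. apply (ms_p2_cont MS). lra.
- assert (Hbx : b xi <= B).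
  { specialize (HB x ltac:(lra)). rewrite E in HB. apply Rmult_le_reg_r with (1 - x); lra. }
  assert (Hbp := ms_b_pos MS xi ltac:(lra)).
  assert (Hball : Rabs (xi - 1) < e) by (rewrite Rabs_left; lra).
  specialize (He1 xi ltac:(change (Rabs (xi - 1) < e1); lra)).
  specialize (He2 xi ltac:(change (Rabs (xi - 1) < e2); lra)).
  specialize (He3 xi ltac:(change (Rabs (xi - 1) < e3); lra)).
  change (Rabs (g xi - g 1) < - g 1 / 2) in He1.
  change (Rabs (h xi - h 1) < h 1) in He2.
  change (Rabs (H xi - H 1) < - g 1 / 2 / M) in He3.
  rewrite (ms_H_end MS), Rminus_0_r in He3.
  apply Rabs_def2 in He1. apply Rabs_def2 in He2.
  rewrite Hg in He1 by lra.
  assert (Hr := ms_r_bound xi ltac:(lra)). fold K in Hr.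
  assert (Hmem : Rabs (c * (p1 xi * H xi)) <= - g 1 / 2).
  { rewrite (ms_p1 MS) by lra.
    replace (c * (r xi * b xi * H xi)) with (c * b xi * r xi * H xi) by ring.
    rewrite Rabs_mult.
    apply Rle_trans with (M * (- g 1 / 2 / M)); [|right; field; lra].
    apply Rmult_le_compat; try apply Rabs_pos; [|lra].
    assert (0 <= c * b xi) by nra.
    rewrite Rabs_mult, (Rabs_right (c * b xi)) by lra. unfold M.
    apply Rle_trans with (c * B * K); [|nra].
    apply Rmult_le_compat; [easy | apply Rabs_pos | | easy].
    apply Rmult_le_compat_l; lra. }
  apply Rabs_le_between in Hmem.
  assert (0 < a * h xi) by (apply Rmult_lt_0_compat; lra).
  lra.
Qed.

(** If [x0] is the last zero of the slope, the memory term must raise it from 0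
    somewhere to the right of [x0], which forces [p1 < 0] and [p2 <= 0] at that point
    and everywhere before it. To the left of [x0], [H] then keeps growing and [h]
    stays negative down to 0, where h(0) = k2 g(0) fails because g(0) is nonnegative.
    This supposes H(x0) > 0: H(x0) = 0 would make [h] vanish identically, and
    H(x0) < 0 would keep [h] from rising. *)
Lemma ms_positive (g : R -> R) (k2 : R) :
  (forall x, 0 < x < 1 -> g x = a * h x - c * (p1 x * H x)) ->
  continuous g 0 -> h 0 = k2 * g 0 -> 0 <= k2 -> a <= 0 -> 0 < h 1 ->
  forall x, 0 < x < 1 -> 0 < h x.
Proof.
intros Hg Cg Hcorner Hk2 Ha Hh1.
assert (Hc := ms_c_pos MS).
assert (Ch := ms_h_cont MS).
assert (CH := ms_H_cont MS).
set (w := fun y => exp (- a * y) * h y).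
set (dw := fun y => exp (- a * y) * (- (c * (p1 y * H y)))).
assert (Cw : forall y, 0 <= y <= 1 -> continuous w y).
{ intros y Hy. apply (continuous_exp_weight (fun y => - a * y)); [|now apply Ch].
  apply (continuous_scal_r (V := R_NormedModule)). apply continuous_id. }
assert (Dw : forall y, 0 < y < 1 -> is_derive w y (dw y)).
{ intros y Hy. unfold w, dw.
  replace (exp (- a * y) * - (c * (p1 y * H y)))
    with (exp (- a * y) * ((a * h y - c * (p1 y * H y)) + - a * h y)) by ring.
  apply (is_derive_exp_weight (fun y => - a * y)).
  - auto_derive; [easy | ring].
  - now apply (ms_h_deriv MS). }
assert (Crev : forall (f : R -> R) s l, (forall x, 0 <= x <= 1 -> continuous f x) ->
  0 <= s <= 1 -> l <= s -> forall y, 0 <= y <= l -> continuous (fun y => f (s - y)) y).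
{ intros f s l Cf Hs Hl y Hy. apply (continuous_comp (fun y => s - y) f).
  - apply (continuous_minus (V := R_NormedModule)); [apply continuous_const | apply continuous_id].
  - apply Cf. lra. }
destruct (first_zero (fun y => h (1 - y)) 1) as [Hpos | (r0 & Hr0 & Hz & Hpos)]; [lra | | | |].
{ apply (Crev h); [exact Ch | lra | lra]. }
{ now rewrite Rminus_0_r. }
{ intros x Hx. replace x with (1 - (1 - x)) by ring. apply Hpos. lra. }
set (x0 := 1 - r0) in *.
assert (Hright : forall x, x0 < x <= 1 -> 0 < h x).
{ intros x Hx. replace x with (1 - (1 - x)) by ring. apply Hpos. unfold x0 in Hx. lra. }
destruct (Req_dec x0 0) as [E0 | Hne].
{ intros x Hx. apply Hright. lra. }
exfalso.
assert (Hx0 : 0 < x0 < 1) by (unfold x0 in *; lra).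
assert (Hdown : exists xi, x0 < xi < 1 /\ 0 < c /\ p1 xi < 0).
{ destruct (mvt_open w dw x0 1) as [xi [Hxi E]]; [lra | | |].
  - intros y Hy. apply Dw. lra.
  - intros y Hy. apply Cw. lra.
  - exists xi. unfold w, dw in E. rewrite Hz, Rmult_0_r in E.
    assert (0 < exp (- a * 1) * h 1) by (apply Rmult_lt_0_compat; [apply exp_pos | easy]).
    assert (Hneg : c * (p1 xi * H xi) < 0).
    { assert (0 < exp (- a * xi) * - (c * (p1 xi * H xi))).
      { apply Rmult_lt_reg_r with (1 - x0); lra. }
      generalize (exp_pos (- a * xi)). nra. }
    split; [lra|].
    assert (Hc' : 0 < c).
    { destruct Hc as [|E0]; [easy|]. rewrite <- E0, Rmult_0_l in Hneg. lra. }
    split; [easy|].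
    destruct (Rlt_le_dec (p1 xi) 0) as [|Hp]; [easy|exfalso].
    assert (Hp' : 0 < p1 xi).
    { destruct Hp as [|E0]; [easy|]. rewrite <- E0 in Hneg. lra. }
    assert (HH : H 1 <= H xi).
    { apply ms_H_antitone; [lra | lra | lra |]. intros y Hy. apply Rmult_le_pos.
      - apply Rlt_le, Hright. lra.
      - apply (ms_p2_nonneg_after xi); lra. }
    rewrite (ms_H_end MS) in HH.
    assert (0 <= c * (p1 xi * H xi)) by (repeat apply Rmult_le_pos; lra). lra. }
destruct Hdown as (xi & Hxi & Hc' & Hp).
assert (Hneg : forall y, 0 < y <= xi -> p1 y < 0 /\ p2 y <= 0).
{ intros y Hy. apply (ms_negative_before xi); lra. }
destruct (Rtotal_order (H x0) 0) as [HH | [HH | HH]].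
- destruct (first_zero (fun y => - H (x0 + y)) (1 - x0)) as [Hp2 | (s & Hs & Hzs & Hns)]; [lra | | | |].
  + intros y Hy. apply (continuous_Ropp (fun y => H (x0 + y))).
    apply (continuous_comp (fun y => x0 + y) H); [|apply CH; lra].
    apply (continuous_plus (V := R_NormedModule)); [apply continuous_const | apply continuous_id].
  + rewrite Rplus_0_r. lra.
  + specialize (Hp2 (1 - x0) ltac:(lra)). simpl in Hp2.
    replace (x0 + (1 - x0)) with 1 in Hp2 by ring.
    rewrite (ms_H_end MS) in Hp2. lra.
  + (* Where [H < 0], [p1] is not positive: otherwise [p2 >= 0] further right and [H >= 0]. *)
    assert (HHn : forall y, x0 <= y < x0 + s -> H y < 0).
    { intros y Hy. specialize (Hns (y - x0) ltac:(lra)). simpl in Hns.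
      replace (x0 + (y - x0)) with y in Hns by ring. lra. }
    assert (Hw : - w x0 <= - w (x0 + s)).
    { apply (nondecreasing_of_derive (fun y => - w y) (fun y => - dw y)); [lra | | |].
      - intros y Hy. apply (is_derive_Ropp w). apply Dw. lra.
      - intros y Hy. apply (continuous_Ropp w). apply Cw. lra.
      - intros y Hy. unfold dw.
        assert (Hp1 : p1 y <= 0).
        { destruct (Rle_lt_dec (p1 y) 0) as [|Hp1]; [easy|exfalso].
          assert (HH1 : H 1 <= H y).
          { apply ms_H_antitone; [lra | lra | lra |]. intros t Ht. apply Rmult_le_pos.
            - apply Rlt_le, Hright. lra.
            - apply (ms_p2_nonneg_after y); lra. }
          rewrite (ms_H_end MS) in HH1. specialize (HHn y ltac:(lra)). lra. }
        specialize (HHn y ltac:(lra)).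
        assert (0 <= p1 y * H y) by nra.
        assert (0 <= c * (p1 y * H y)) by (apply Rmult_le_pos; lra).
        generalize (exp_pos (- a * y)). nra. }
    unfold w in Hw. rewrite Hz, Rmult_0_r in Hw.
    assert (0 < h (x0 + s)) by (apply Hright; lra).
    generalize (exp_pos (- a * (x0 + s))). nra.
- assert (h 1 = 0); [|lra]. apply (ms_unique x0); [lra | exact Hz | exact HH | lra].
- (* As long as [H] stays positive to the left of [x0], [h] is negative there. *)
  assert (Hbelow : forall s, 0 < s <= x0 -> (forall y, 0 <= y < s -> 0 < H (x0 - y)) ->
     forall y, x0 - s <= y < x0 -> h y < 0).
  { intros s Hs HHp y Hy.
    assert (Hw : w y < w x0).
    { apply (increasing_of_derive w dw); [lra | | |].
      - intros z Hz'. apply Dw. lra.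
      - intros z Hz'. apply Cw. lra.
      - intros z Hz'. unfold dw. apply Rmult_lt_0_compat; [apply exp_pos|].
        specialize (HHp (x0 - z) ltac:(lra)). replace (x0 - (x0 - z)) with z in HHp by ring.
        destruct (Hneg z ltac:(lra)) as [Hn1 _].
        assert (0 < - p1 z * H z) by (apply Rmult_lt_0_compat; lra).
        assert (0 < c * (- p1 z * H z)) by now apply Rmult_lt_0_compat.
        lra. }
    unfold w in Hw. rewrite Hz, Rmult_0_r in Hw. generalize (exp_pos (- a * y)). nra. }
  assert (HHall : forall y, 0 <= y <= x0 -> 0 < H (x0 - y)).
  { destruct (first_zero (fun y => H (x0 - y)) x0) as [|(s & Hs & Hzs & Hps)]; [lra | | | easy |].
    - apply (Crev H); [exact CH | lra | lra].
    - now rewrite Rminus_0_r.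
    - exfalso.
      assert (HHm : H x0 <= H (x0 - s)).
      { apply ms_H_antitone; [lra | lra | lra |]. intros t Ht.
        generalize (Hbelow s Hs Hps t ltac:(lra)) (proj2 (Hneg t ltac:(lra))). nra. }
      lra. }
  assert (h0 : h 0 < 0).
  { apply (Hbelow x0); [lra | intros y Hy; apply HHall; lra | lra]. }
  assert (Hg0 : 0 <= g 0).
  { apply Rle_trans with (a * h 0); [nra|].
    assert (Hlim : filterlim (fun y => g y - a * h y) (at_right 0) (locally (g 0 - a * h 0))).
    { apply (filterlim_Rminus _).
      - eapply filterlim_filter_le_1; [|exact Cg]. intros P HP. now apply filter_le_within.
      - apply (filterlim_Rmult _); [apply filterlim_const|].
        eapply filterlim_filter_le_1; [|exact (Ch 0 ltac:(lra))].
        intros P HP. now apply filter_le_within. }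
    assert (0 <= g 0 - a * h 0); [|lra].
    apply (filterlim_ge_const _ _ _ _ Hlim).
    exists (mkposreal _ (proj1 Hx0)). intros y Hy Hy0.
    change (Rabs (y - 0) < x0) in Hy. rewrite Rminus_0_r, Rabs_right in Hy by lra.
    rewrite Hg by lra.
    destruct (Hneg y ltac:(lra)) as [Hn1 _].
    specialize (HHall (x0 - y) ltac:(lra)).
    rewrite (Rminus_def x0 (x0 - y)), Ropp_minus_distr, Rplus_minus in HHall.
    assert (0 <= - p1 y * H y) by (apply Rmult_le_pos; lra).
    assert (0 <= c * (- p1 y * H y)) by now apply Rmult_le_pos.
    lra. }
  assert (0 <= k2 * g 0) by now apply Rmult_le_pos. lra.
Qed.

End MemorySystem.

Lemma deriv01_bound_at_1 (f f' : R -> R) :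
  deriv01 f f' -> monotone01 f ->
  exists B, forall x, 0 < x < 1 -> f 1 - f x <= B * (1 - x).
Proof.
intros Hf Hm.
assert (U1 : unit_interval 1) by (unfold unit_interval; lra).
destruct (Hf 1 U1 1 ltac:(lra)) as [alp [Ha HD]].
set (B1 := Rabs (f' 1) + 1). set (B2 := (f 1 - f 0) / alp).
assert (HB1 : 0 < B1) by (unfold B1; generalize (Rabs_pos (f' 1)); lra).
assert (Hf01 := Hm 0 1 ltac:(lra) ltac:(lra) ltac:(lra)).
assert (HB2 : 0 <= B2) by (apply Rle_div_r; lra).
exists (B1 + B2). intros x Hx.
destruct (Rlt_le_dec (1 - x) alp) as [Hn | Hf'].
- assert (HQ : Rabs ((f x - f 1) / (x - 1) - f' 1) < 1).
  { apply (HD x). split; [split; [unfold unit_interval; lra | lra]|].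
    unfold dist; simpl; unfold Rdist. rewrite Rabs_left; lra. }
  apply Rabs_def2 in HQ. assert (Hle := Rle_abs (f' 1)).
  replace (f 1 - f x) with ((f x - f 1) / (x - 1) * (1 - x)) by (field; lra).
  apply Rmult_le_compat_r; unfold B1; lra.
- apply Rle_trans with (B2 * alp).
  + unfold B2. replace ((f 1 - f 0) / alp * alp) with (f 1 - f 0) by (field; lra).
    generalize (Hm 0 x ltac:(lra) ltac:(lra) ltac:(lra)). lra.
  + apply Rle_trans with (B2 * (1 - x)); [now apply Rmult_le_compat_l | nra].
Qed.

(** The corner conditions are what the transmission conditions on the sides leave
    at A and B; with them the slope keeps one sign, which is incompatible with
    zero boundary values. *)
Lemma memory_trace_slope_zero (h g tau : R -> R) (P : R -> R -> R) (Pa Pb b q : R -> R)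
    (a c k2 k3 : R) :
  (forall x, continuous h x) -> (forall x, continuous g x) ->
  (forall x, continuous tau x) ->
  (forall x, 0 < x < 1 -> is_derive h x (g x)) ->
  (forall x, 0 < x < 1 -> is_derive tau x (h x)) ->
  tau 0 = 0 -> tau 1 = 0 ->
  factorization P Pa Pb b q ->
  (forall x, unit_interval x -> 0 <= Pa x * Pb x) ->
  (forall x, unit_interval x -> 0 <= q x) ->
  0 <= c ->
  (forall x, 0 < x < 1 -> g x = a * h x - c * RInt (fun s => h s * P x s) x 1) ->
  h 0 = k2 * g 0 -> 0 <= k2 -> h 1 = k3 * g 1 -> k3 <= 0 ->
  forall x, 0 <= x <= 1 -> h x = 0.
Proof.
intros Ch Cg Ctau Dh Dtau tau0 tau1 (HP & Hb & Hn & Hq) Hsign Hq0 Hc Hg Hc0 Hk2 Hc1 Hk3.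
(* Changing the sign of both factors of [P] makes the second one increasing. *)
assert (Heps : exists eps, eps * eps = 1 /\ forall s, unit_interval s -> 0 < eps * b s).
{ destruct (deriv01_constant_sign Pb b Hb Hn) as [S | S].
  - exists 1. split; [ring|]. intros s Us. specialize (S s Us). lra.
  - exists (-1). split; [ring|]. intros s Us. specialize (S s Us). lra. }
destruct Heps as (eps & Heps2 & Hbpos).
set (p2 := fun x => eps * Pb (clamp x)).
set (p1 := fun x => eps * Pa x).
assert (Cp2 : forall x, continuous p2 x).
{ intros x. apply (continuous_scal_r (V := R_NormedModule)).
  now apply (deriv01_continuous Pb b). }
set (r := fun x => Pa x / b x).
assert (Hr : monotone01 r) by now apply (deriv01_nondecreasing _ q).
assert (Hmain : forall hh gg : R -> R,
  (forall x, continuous hh x) -> (forall x, continuous gg x) ->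
  (forall x, 0 < x < 1 -> is_derive hh x (gg x)) ->
  (forall x, 0 < x < 1 -> gg x = a * hh x - c * RInt (fun s => hh s * P x s) x 1) ->
  hh 0 = k2 * gg 0 -> hh 1 = k3 * gg 1 -> 0 <= hh 1 ->
  (forall x, 0 < x < 1 -> 0 < hh x) \/ (forall x, 0 <= x <= 1 -> hh x = 0)).
{ clear h g Ch Cg Dh Dtau Hg Hc0 Hc1. intros h g Ch Cg Dh Hg Hc0 Hc1 Hh1.
  set (f := fun x => h x * p2 x).
  assert (Cf : forall x, continuous f x).
  { intros x. now apply (continuous_mult (K := R_AbsRing)). }
  assert (If : forall x y, ex_RInt f x y).
  { intros x y. apply (ex_RInt_continuous (V := R_CompleteNormedModule)).
    intros z _. apply Cf. }
  set (H := fun x => RInt f x 1).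
  assert (DH : forall x, is_derive H x (- (h x * p2 x))).
  { intros x. apply (is_derive_RInt' (V := R_NormedModule) f H x 1); [|apply Cf].
    apply filter_forall. intros y. apply (RInt_correct (V := R_CompleteNormedModule)), If. }
  assert (Hmem : forall x, 0 < x < 1 ->
     p1 x * H x = RInt (fun s => h s * P x s) x 1).
  { intros x Hx.
    change (p1 x * H x) with (scal (eps * Pa x) (RInt f x 1)).
    rewrite <- (RInt_scal (V := R_CompleteNormedModule) f x 1 (eps * Pa x)) by apply If.
    apply (RInt_ext (V := R_CompleteNormedModule)).
    intros s Hs. rewrite Rmin_left, Rmax_right in Hs by lra.
    rewrite HP by (unfold unit_interval; lra).
    unfold f, p2. rewrite clamp_id by (unfold unit_interval; lra).
    change (eps * Pa x * (h s * (eps * Pb s)) = h s * (Pa x * Pb s)).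
    replace (eps * Pa x * (h s * (eps * Pb s)))
      with (eps * eps * (h s * (Pa x * Pb s))) by ring.
    rewrite Heps2. ring. }
  assert (Hg' : forall x, 0 < x < 1 -> g x = a * h x - c * (p1 x * H x)).
  { intros x Hx. now rewrite Hmem, <- Hg. }
  assert (MS : memory_system h H p1 p2 (fun x => eps * b x) r a c).
  { split; try easy.
    - intros x _. eapply continuous_of_is_derive, DH.
    - intros x Hx. rewrite <- Hg' by easy. now apply Dh.
    - apply (RInt_point (V := R_CompleteNormedModule)).
    - intros x Hx. apply (is_derive_scal (fun y => Pb (clamp y))).
      apply is_derive_clamp; [easy|]. now apply deriv01_interior.
    - intros x Hx. apply Hbpos. unfold unit_interval; lra.
    - intros x Hx. unfold p1, r. field. apply Hn. unfold unit_interval; lra.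
    - intros x Hx. unfold p1, p2. rewrite clamp_id by (unfold unit_interval; lra).
      replace (eps * Pa x * (eps * Pb x)) with (eps * eps * (Pa x * Pb x)) by ring.
      rewrite Heps2, Rmult_1_l. apply Hsign. unfold unit_interval; lra. }
  destruct Hh1 as [Hh1 | Hh1].
  - left.
    destruct (deriv01_bound_at_1 (fun x => eps * Pb x) (fun x => eps * b x)) as [B HB].
    + now apply deriv01_scal.
    + apply deriv01_nondecreasing with (fun x => eps * b x); [now apply deriv01_scal|].
      intros s Us. now apply Rlt_le, Hbpos.
    + apply (ms_positive MS g k2); try easy.
      apply (ms_damped MS g B); try easy.
      * intros x Hx. unfold p2. rewrite !clamp_id by (unfold unit_interval; lra).
        now apply HB.
      * destruct (Rlt_le_dec (g 1) 0) as [|Hg1]; [easy|exfalso].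
        assert (0 <= - k3 * g 1) by (apply Rmult_le_pos; lra). lra.
  - right. apply (ms_unique MS 1); [lra | easy |].
    apply (RInt_point (V := R_CompleteNormedModule)). }
destruct (Rle_lt_dec 0 (h 1)) as [Hh1 | Hh1].
- destruct (Hmain h g Ch Cg Dh Hg Hc0 Hc1 Hh1) as [Hp | Hz]; [exfalso | exact Hz].
  assert (tau 0 < tau 1); [|lra].
  apply (increasing_of_derive tau h); [lra | intros x Hx; now apply Dtau | easy | easy].
- destruct (Hmain (fun x => - h x) (fun x => - g x)) as [Hp | Hz].
  + intros x. now apply continuous_Ropp.
  + intros x. now apply continuous_Ropp.
  + intros x Hx. now apply is_derive_Ropp, Dh.
  + intros x Hx. rewrite Hg by easy.
    rewrite (RInt_ext (V := R_CompleteNormedModule) (fun s => - h s * P x s)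
      (fun s => opp (h s * P x s))).
    2: { intros s _. change (- h s * P x s = - (h s * P x s)). ring. }
    rewrite (RInt_opp (V := R_CompleteNormedModule)).
    * change (opp (RInt (fun s : R => h s * P x s) x 1)) with
        (- RInt (fun s : R => h s * P x s) x 1). ring.
    * apply (ex_RInt_ext (V := R_NormedModule) (fun s => Pa x * (h s * Pb (clamp s)))).
      { intros s Hs. rewrite Rmin_left, Rmax_right in Hs by lra.
        rewrite HP, clamp_id by (unfold unit_interval; lra). change (Pa x * (h s * Pb s) = h s * (Pa x * Pb s)). ring. }
      apply (ex_RInt_continuous (V := R_CompleteNormedModule)). intros s _.
      apply (continuous_scal_r (V := R_NormedModule)).
      apply (continuous_mult (K := R_AbsRing)); [easy|].
      now apply (deriv01_continuous Pb b).
  + lra.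
  + lra.
  + lra.
  + exfalso. assert (- tau 0 < - tau 1); [|lra].
    apply (increasing_of_derive (fun x => - tau x) (fun x => - h x)); [lra | | | easy].
    * intros x Hx. now apply is_derive_Ropp, Dtau.
    * intros x Hx. now apply continuous_Ropp.
  + intros x Hx. specialize (Hz x Hx). lra.
Qed.

(** * The Gamma function and the Caputo integral *)

Lemma RInt_le_antiderivative (f F dF : R -> R) (a b : R) :
  a <= b ->
  (forall x, a <= x <= b -> continuous f x) ->
  (forall x, a <= x <= b -> is_derive F x (dF x)) ->
  (forall x, a <= x <= b -> continuous dF x) ->
  (forall x, a <= x <= b -> f x <= dF x) ->
  RInt f a b <= F b - F a.
Proof.
intros Hab Cf DF CdF Hle.
assert (HI : is_RInt dF a b (F b - F a)).
{ apply (is_RInt_derive (V := R_CompleteNormedModule) F dF);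
    intros x Hx; rewrite Rmin_left, Rmax_right in Hx by easy; auto. }
rewrite <- (is_RInt_unique (V := R_CompleteNormedModule) _ _ _ _ HI).
apply RInt_le; [easy | | now exists (F b - F a) |].
- apply (ex_RInt_continuous (V := R_CompleteNormedModule)).
  intros x Hx. rewrite Rmin_left, Rmax_right in Hx by easy. auto.
- intros x Hx. apply Hle. lra.
Qed.

Lemma antiderivative_le_RInt (f F dF : R -> R) (a b : R) :
  a <= b ->
  (forall x, a <= x <= b -> continuous f x) ->
  (forall x, a <= x <= b -> is_derive F x (dF x)) ->
  (forall x, a <= x <= b -> continuous dF x) ->
  (forall x, a <= x <= b -> dF x <= f x) ->
  F b - F a <= RInt f a b.
Proof.
intros Hab Cf DF CdF Hle.
assert (HI : is_RInt dF a b (F b - F a)).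
{ apply (is_RInt_derive (V := R_CompleteNormedModule) F dF);
    intros x Hx; rewrite Rmin_left, Rmax_right in Hx by easy; auto. }
rewrite <- (is_RInt_unique (V := R_CompleteNormedModule) _ _ _ _ HI).
apply RInt_le; [easy | now exists (F b - F a) | |].
- apply (ex_RInt_continuous (V := R_CompleteNormedModule)).
  intros x Hx. rewrite Rmin_left, Rmax_right in Hx by easy. auto.
- intros x Hx. apply Hle. lra.
Qed.

Lemma is_RInt_gen_ge (f : R -> R) (Fa Fb : (R -> Prop) -> Prop)
    {FFa : ProperFilter Fa} {FFb : ProperFilter Fb} (l C : R) :
  is_RInt_gen f Fa Fb l ->
  (forall eps : posreal, filter_prod Fa Fb (fun ab =>
     forall I, is_RInt f (fst ab) (snd ab) I -> C - eps <= I)) ->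
  C <= l.
Proof.
intros Hl Hb.
destruct (Rle_lt_dec C l) as [|Hlt]; [easy|exfalso].
assert (He : 0 < (C - l) / 2) by lra.
assert (H1 : filter_prod Fa Fb (fun ab => exists I,
   is_RInt f (fst ab) (snd ab) I /\ ball l (mkposreal _ He) I)).
{ apply (Hl (ball l (mkposreal _ He))). apply locally_ball. }
destruct (filter_ex _ (filter_and _ _ H1 (Hb (mkposreal _ He)))) as [ab [[I [HI HB]] HC]].
specialize (HC I HI). simpl in HC. change (Rabs (I - l) < (C - l) / 2) in HB.
apply Rabs_def2 in HB. lra.
Qed.

Lemma is_RInt_gen_le (f : R -> R) (Fa Fb : (R -> Prop) -> Prop)
    {FFa : ProperFilter Fa} {FFb : ProperFilter Fb} (l C : R) :
  is_RInt_gen f Fa Fb l ->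
  filter_prod Fa Fb (fun ab =>
     forall I, is_RInt f (fst ab) (snd ab) I -> I <= C) ->
  l <= C.
Proof.
intros Hl Hb.
destruct (Rle_lt_dec l C) as [|Hlt]; [easy|exfalso].
assert (He : 0 < (l - C) / 2) by lra.
assert (H1 : filter_prod Fa Fb (fun ab => exists I,
   is_RInt f (fst ab) (snd ab) I /\ ball l (mkposreal _ He) I)).
{ apply (Hl (ball l (mkposreal _ He))). apply locally_ball. }
destruct (filter_ex _ (filter_and _ _ H1 Hb)) as [ab [[I [HI HB]] HC]].
specialize (HC I HI). change (Rabs (I - l) < (l - C) / 2) in HB.
apply Rabs_def2 in HB. lra.
Qed.

Lemma is_derive_Rpower (y x : R) :
  0 < x -> is_derive (fun z => Rpower z y) x (y * Rpower x (y - 1)).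
Proof. intros Hx. apply is_derive_Reals. now apply derivable_pt_lim_power. Qed.

Lemma at_right_interval (a b : R) : a < b -> at_right a (fun x => a < x < b).
Proof.
intros Hab. assert (He : 0 < b - a) by lra. exists (mkposreal _ He).
intros x Hx Hax. change (Rabs (x - a) < b - a) in Hx. apply Rabs_def2 in Hx. lra.
Qed.

Lemma at_left_interval (a b : R) : a < b -> at_left b (fun x => a < x < b).
Proof.
intros Hab. assert (He : 0 < b - a) by lra. exists (mkposreal _ He).
intros x Hx Hax. change (Rabs (x - b) < b - a) in Hx. apply Rabs_def2 in Hx. lra.
Qed.

(** A nonnegative integrand with bounded integrals has an improper integral, the
    supremum of its integrals over compact intervals. *)
Lemma RInt_gen_nonneg (f : R -> R) (M : R) :
  (forall x, 0 < x -> continuous f x) ->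
  (forall x, 0 < x -> 0 <= f x) ->
  (forall a b, 0 < a <= 1 -> 1 <= b -> RInt f a b <= M) ->
  forall b, 1 <= b ->
  RInt f 1 b <= RInt_gen f (at_right 0) (Rbar_locally p_infty).
Proof.
intros Cf Hf HM b1 Hb1.
assert (If : forall a b, 0 < a -> 0 < b -> ex_RInt f a b).
{ intros a b Ha Hb. apply (ex_RInt_continuous (V := R_CompleteNormedModule)).
  intros x Hx. apply Cf. eapply Rlt_le_trans; [|apply Hx]. now apply Rmin_glb_lt. }
assert (Hmono : forall a b a' b', 0 < a' <= a -> a <= b -> b <= b' -> RInt f a b <= RInt f a' b').
{ intros a b a' b' Ha Hab Hb.
  rewrite <- (RInt_Chasles (V := R_CompleteNormedModule) f a' a b') by (apply If; lra).
  rewrite <- (RInt_Chasles (V := R_CompleteNormedModule) f a b b') by (apply If; lra).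
  change (RInt f a b <= RInt f a' a + (RInt f a b + RInt f b b')).
  assert (0 <= RInt f a' a).
  { apply RInt_ge_0; [lra | apply If; lra | intros x Hx; apply Hf; lra]. }
  assert (0 <= RInt f b b').
  { apply RInt_ge_0; [lra | apply If; lra | intros x Hx; apply Hf; lra]. }
  lra. }
set (E := fun v => exists a b, 0 < a <= 1 /\ 1 <= b /\ v = RInt f a b).
destruct (completeness E) as [L [Hub Hlub]].
- exists M. intros v (a & b & Ha & Hb & ->). now apply HM.
- exists (RInt f 1 1), 1, 1. repeat split; lra.
- assert (HL : is_RInt_gen f (at_right 0) (Rbar_locally p_infty) L).
  { intros P [eps HP].
    assert (Hex : exists a b, 0 < a <= 1 /\ 1 <= b /\ L - eps < RInt f a b).
    { destruct (classic (exists a b, 0 < a <= 1 /\ 1 <= b /\ L - eps < RInt f a b))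
        as [|Hno]; [easy|exfalso].
      assert (L <= L - eps).
      { apply Hlub. intros v (a & b & Ha & Hb & ->).
        destruct (Rle_lt_dec (RInt f a b) (L - eps)) as [|Hlt]; [easy|].
        destruct Hno. now exists a, b. }
      generalize (cond_pos eps). lra. }
    destruct Hex as (a0 & b0 & Ha0 & Hb0 & Hlow).
    apply (Filter_prod _ _ _ (fun a => 0 < a < a0) (fun b => b0 < b)).
    - now apply at_right_interval.
    - exists b0. easy.
    - intros a b Ha Hb. simpl. exists (RInt f a b). split.
      + apply (RInt_correct (V := R_CompleteNormedModule)), If; lra.
      + apply HP. change (Rabs (RInt f a b - L) < eps).
        assert (RInt f a b <= L) by (apply Hub; exists a, b; repeat split; lra).
        assert (RInt f a0 b0 <= RInt f a b) by (apply Hmono; lra).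
        apply Rabs_def1; generalize (cond_pos eps); lra. }
  rewrite (is_RInt_gen_unique (V := R_CompleteNormedModule) f L HL).
  apply Hub. exists 1, b1. repeat split; lra.
Qed.

(** The maximum principle for the fractional equation depends on the sign of the
    constant 1 / Gamma(1 - lam). The bound splits the integral at 1 and drops one
    of the two factors on each side. *)
Lemma Gamma_pos (z : R) : 0 < z < 1 -> 0 < Gamma z.
Proof.
intros Hz. unfold Gamma.
set (f := fun t => Rpower t (z - 1) * exp (- t)).
assert (Cf : forall x, 0 < x -> continuous f x).
{ intros x Hx. apply (continuous_mult (K := R_AbsRing)).
  - eapply continuous_of_is_derive. now apply is_derive_Rpower.
  - apply (continuous_comp Ropp exp); [|apply continuous_exp].
    apply (continuous_Ropp (fun x => x)), continuous_id. }
assert (Hpos : forall x, 0 < f x).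
{ intros x. apply Rmult_lt_0_compat; apply exp_pos. }
apply Rlt_le_trans with (RInt f 1 2).
- apply RInt_gt_0; [lra | intros x _; apply Hpos | intros x Hx; apply Cf; lra].
- apply (RInt_gen_nonneg f (/ z + 1)); [easy | intros x _; apply Rlt_le, Hpos | | lra].
  intros a b Ha Hb.
  rewrite <- (RInt_Chasles (V := R_CompleteNormedModule) f a 1 b).
  2, 3: apply (ex_RInt_continuous (V := R_CompleteNormedModule)); intros x Hx;
    rewrite Rmin_left, Rmax_right in Hx by lra; apply Cf; lra.
  apply Rplus_le_compat.
  + apply Rle_trans with (Rpower 1 z / z - Rpower a z / z).
    * apply (RInt_le_antiderivative f (fun t => Rpower t z / z) (fun t => Rpower t (z - 1)));
        [lra | intros x Hx; apply Cf; lra | | |].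
      -- intros x Hx.
         replace (Rpower x (z - 1)) with (z * Rpower x (z - 1) * / z) by (field; lra).
         apply (is_derive_scal_l (V := R_NormedModule) (fun t => Rpower t z)).
         apply is_derive_Rpower. lra.
      -- intros x Hx. eapply continuous_of_is_derive. apply is_derive_Rpower. lra.
      -- intros x Hx. unfold f. rewrite <- (Rmult_1_r (Rpower x (z - 1))) at 2.
         apply Rmult_le_compat_l; [apply Rlt_le, exp_pos|].
         rewrite <- exp_0. destruct (Req_dec x 0); [lra|].
         apply Rlt_le, exp_increasing. lra.
    * replace (Rpower 1 z) with 1 by (unfold Rpower; now rewrite ln_1, Rmult_0_r, exp_0).
      assert (0 < Rpower a z / z) by (apply Rdiv_lt_0_compat; [apply exp_pos | lra]).
      unfold Rdiv at 1. lra.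
  + apply Rle_trans with (- exp (- b) - - exp (- 1)).
    * apply (RInt_le_antiderivative f (fun t => - exp (- t)) (fun t => exp (- t)));
        [lra | intros x Hx; apply Cf; lra | | |].
      -- intros x Hx. auto_derive; [easy | ring].
      -- intros x Hx. apply (continuous_comp Ropp exp); [|apply continuous_exp].
         apply (continuous_Ropp (fun x => x)), continuous_id.
      -- intros x Hx. unfold f. rewrite <- (Rmult_1_l (exp (- x))) at 2.
         apply Rmult_le_compat_r; [apply Rlt_le, exp_pos|].
         apply Rle_trans with (Rpower x 0); [apply Rle_Rpower; lra | rewrite Rpower_O; lra].
    * generalize (exp_pos (- b)). intros.
      assert (exp (- 1) < exp 0) by (apply exp_increasing; lra). rewrite exp_0 in H0. lra.
Qed.

Section CaputoBounds.

Context (lam : R) (t : R) (g G dG : R -> R) (M : R).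
Hypothesis (Hlam : 0 < lam < 1) (Ht : 0 < t).
Hypothesis (Hg : forall z, 0 < z < t -> Derive g z = dG z).
Hypothesis (HdG : forall z, 0 < z < t -> is_derive G z (dG z)).
Hypothesis (CdG : forall z, 0 < z < t -> continuous dG z).
Hypothesis (HM : forall z, 0 < z < t -> Rabs (dG z) <= M).

Let K (z : R) : R := Rpower (t - z) (- lam).

Lemma kernel_split (z : R) : 0 < z < t -> caputo_kernel lam g t z = dG z * K z.
Proof.
intros Hz. unfold caputo_kernel, K. now rewrite Hg, Rpower_Ropp.
Qed.

Lemma is_derive_shifted_power (y z : R) :
  z < t -> is_derive (fun z => Rpower (t - z) y) z (- (y * Rpower (t - z) (y - 1))).
Proof.
intros Hz.
replace (- (y * Rpower (t - z) (y - 1))) with (-1 * (y * Rpower (t - z) (y - 1))) by ring.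
apply (is_derive_comp (fun x => Rpower x y) (fun z => t - z)).
- apply is_derive_Rpower. lra.
- auto_derive; [easy | ring].
Qed.

Lemma shifted_power_continuous (y z : R) :
  z < t -> continuous (fun z => Rpower (t - z) y) z.
Proof. intros Hz. eapply continuous_of_is_derive. now apply is_derive_shifted_power. Qed.

Lemma kernel_is_RInt (a b I : R) :
  0 < a -> a <= b -> b < t ->
  is_RInt (caputo_kernel lam g t) a b I -> I = RInt (fun z => dG z * K z) a b.
Proof.
intros Ha Hab Hb HI.
rewrite <- (is_RInt_unique (V := R_CompleteNormedModule) _ _ _ _ HI).
apply (RInt_ext (V := R_CompleteNormedModule)). intros z Hz.
rewrite Rmin_left, Rmax_right in Hz by easy. apply kernel_split. lra.
Qed.

Lemma kernel_continuous (z : R) : 0 < z < t -> continuous (fun z => dG z * K z) z.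
Proof.
intros Hz. apply (continuous_mult (K := R_AbsRing)); [now apply CdG|].
apply shifted_power_continuous. lra.
Qed.

Lemma caputo_integral_bound (l : R) :
  is_RInt_gen (caputo_kernel lam g t) (at_right 0) (at_left t) l ->
  Rabs l <= M * Rpower t (1 - lam) / (1 - lam).
Proof.
intros Hl.
assert (HM0 : 0 <= M) by (apply Rle_trans with (Rabs (dG (t / 2))); [apply Rabs_pos | apply HM; lra]).
set (J := fun z => - (M / (1 - lam)) * Rpower (t - z) (1 - lam)).
assert (DJ : forall z, z < t -> is_derive J z (M * K z)).
{ intros z Hz.
  replace (M * K z) with (- (M / (1 - lam)) * (- ((1 - lam) * Rpower (t - z) (1 - lam - 1)))).
  - apply (is_derive_scal (fun z => Rpower (t - z) (1 - lam))). now apply is_derive_shifted_power.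
  - unfold K. replace (1 - lam - 1) with (- lam) by ring. field. lra. }
assert (CJ : forall z, z < t -> continuous (fun z => M * K z) z).
{ intros z Hz. apply (continuous_scal_r (V := R_NormedModule)).
  now apply shifted_power_continuous. }
assert (HJ : forall a b, 0 < a -> a <= b -> b < t ->
   J b - J a <= M * Rpower t (1 - lam) / (1 - lam)).
{ intros a b Ha Hab Hb. unfold J.
  assert (H1 : Rpower (t - a) (1 - lam) <= Rpower t (1 - lam)) by (apply Rle_Rpower_l; lra).
  assert (H2 : 0 < Rpower (t - b) (1 - lam)) by apply exp_pos.
  assert (H3 : 0 <= M / (1 - lam)) by (apply Rle_div_r; lra).
  replace (M * Rpower t (1 - lam) / (1 - lam)) with (M / (1 - lam) * Rpower t (1 - lam))
    by (field; lra).
  nra. }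
assert (HK : forall z, 0 < K z) by (intros z; apply exp_pos).
assert (Hev : forall P : R * R -> Prop,
  (forall a b, 0 < a -> a <= b -> b < t -> P (a, b)) ->
  filter_prod (at_right 0) (at_left t) P).
{ intros P HP. apply (Filter_prod _ _ _ (fun a => 0 < a < t / 2) (fun b => t / 2 < b < t)).
  - apply at_right_interval. lra.
  - apply at_left_interval. lra.
  - intros a b Ha Hb. apply HP; lra. }
assert (Hbd : forall z, 0 < z < t -> - (M * K z) <= dG z * K z <= M * K z).
{ intros z Hz. specialize (HM z Hz). apply Rabs_le_between in HM. specialize (HK z). nra. }
apply Rabs_le. split.
- apply (is_RInt_gen_ge (caputo_kernel lam g t) (at_right 0) (at_left t) l _ Hl).
  intros eps. apply Hev. intros a b Ha Hab Hb I HI. simpl in HI.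
  rewrite (kernel_is_RInt a b I Ha Hab Hb HI).
  apply Rle_trans with ((fun z => - J z) b - (fun z => - J z) a).
  + specialize (HJ a b Ha Hab Hb). generalize (cond_pos eps). simpl. lra.
  + apply (antiderivative_le_RInt _ (fun z => - J z) (fun z => - (M * K z))); [easy | | | |].
    * intros z Hz. apply kernel_continuous. lra.
    * intros z Hz. apply is_derive_Ropp, DJ. lra.
    * intros z Hz. apply continuous_Ropp, CJ. lra.
    * intros z Hz. apply Hbd. lra.
- apply (is_RInt_gen_le (caputo_kernel lam g t) (at_right 0) (at_left t) l _ Hl).
  apply Hev. intros a b Ha Hab Hb I HI. simpl in HI.
  rewrite (kernel_is_RInt a b I Ha Hab Hb HI).
  apply Rle_trans with (J b - J a); [|now apply HJ].
  apply (RInt_le_antiderivative _ J (fun z => M * K z)); [easy | | | |].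
  + intros z Hz. apply kernel_continuous. lra.
  + intros z Hz. apply DJ. lra.
  + intros z Hz. apply CJ. lra.
  + intros z Hz. apply Hbd. lra.
Qed.

(** Integration by parts against the deficit G(t) - G(z), which is nonnegative
    and O(t - z): the boundary term at [t] disappears, and the remaining
    integral is nonnegative because the kernel increases. *)
Lemma caputo_integral_at_running_max (l : R) :
  (forall z, continuous G z) ->
  (forall z, 0 < z < t -> G z <= G t) ->
  is_RInt_gen (caputo_kernel lam g t) (at_right 0) (at_left t) l ->
  (G t - G 0) * Rpower t (- lam) <= l.
Proof.
intros CG Hmax Hl.
assert (HM0 : 0 <= M) by (apply Rle_trans with (Rabs (dG (t / 2))); [apply Rabs_pos | apply HM; lra]).
set (F := fun z => - ((G t - G z) * K z)).
set (dF := fun z => dG z * K z - (G t - G z) * (lam * Rpower (t - z) (- lam - 1))).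
assert (DF : forall z, 0 < z < t -> is_derive F z (dF z)).
{ intros z Hz. unfold F, dF.
  replace (dG z * K z - (G t - G z) * (lam * Rpower (t - z) (- lam - 1)))
    with (- ((- dG z) * K z + (G t - G z) * - (- lam * Rpower (t - z) (- lam - 1)))) by ring.
  apply is_derive_Ropp.
  apply (is_derive_mult (fun z => G t - G z) K); [| |intros; apply Rmult_comm].
  - replace (- dG z) with (0 - dG z) by ring.
    apply (is_derive_minus (V := R_NormedModule) (fun _ => G t) G).
    + apply (is_derive_const (V := R_NormedModule)).
    + now apply HdG.
  - apply is_derive_shifted_power. lra. }
assert (CdF : forall z, 0 < z < t -> continuous dF z).
{ intros z Hz. apply (continuous_minus (V := R_NormedModule)); [now apply kernel_continuous|].
  apply (continuous_mult (K := R_AbsRing)).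
  - apply (continuous_minus (V := R_NormedModule)); [apply continuous_const | apply CG].
  - apply (continuous_scal_r (V := R_NormedModule)).
    apply shifted_power_continuous. lra. }
assert (Hdef : forall b, 0 < b < t -> (G t - G b) * K b <= M * Rpower (t - b) (1 - lam)).
{ intros b Hb. destruct (mvt_open G dG b t) as [c [Hc E]]; [lra | | |].
  - intros z Hz. apply HdG. lra.
  - intros z _. apply CG.
  - rewrite E. replace (1 - lam) with (1 + - lam) by ring.
    rewrite Rpower_plus, Rpower_1 by lra. fold (K b).
    rewrite Rmult_assoc. apply Rmult_le_compat_r.
    + apply Rmult_le_pos; [lra | apply Rlt_le, exp_pos].
    + apply Rle_trans with (Rabs (dG c)); [apply Rle_abs | apply HM; lra]. }
apply (is_RInt_gen_ge (caputo_kernel lam g t) (at_right 0) (at_left t) l _ Hl).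
intros eps.
assert (Heps := cond_pos eps).
assert (H0 : at_right 0 (fun a => (G t - G 0) * K 0 - eps / 2 <= (G t - G a) * K a)).
{ assert (CFa : continuous (fun a => (G t - G a) * K a) 0).
  { apply (continuous_mult (K := R_AbsRing)).
    - apply (continuous_minus (V := R_NormedModule)); [apply continuous_const | apply CG].
    - apply shifted_power_continuous. lra. }
  assert (He2 : 0 < eps / 2) by lra.
  apply filter_le_within.
  generalize (proj1 (filterlim_locally _ _) CFa (mkposreal _ He2)).
  apply filter_imp. intros a Ha.
  change (Rabs ((G t - G a) * K a - (G t - G 0) * K 0) < eps / 2) in Ha.
  apply Rabs_def2 in Ha. lra. }
(* (M + 1) * del^(1 - lam) = eps / 2 *)
set (del := Rpower (eps / (2 * (M + 1))) (/ (1 - lam))).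
assert (Hdel : 0 < del) by apply exp_pos.
assert (Hq : 0 < eps / (2 * (M + 1))) by (apply Rdiv_lt_0_compat; lra).
assert (Hsmall : forall b, t - del < b < t -> M * Rpower (t - b) (1 - lam) <= eps / 2).
{ intros b Hb.
  apply Rle_trans with (M * Rpower del (1 - lam)).
  - apply Rmult_le_compat_l; [easy|]. apply Rle_Rpower_l; lra.
  - unfold del. rewrite Rpower_mult, Rinv_l, Rpower_1 by lra.
    apply Rle_trans with ((M + 1) * (eps / (2 * (M + 1)))).
    + apply Rmult_le_compat_r; lra.
    + right. field. lra. }
apply (Filter_prod _ _ _
  (fun a => 0 < a < t / 2 /\ (G t - G 0) * K 0 - eps / 2 <= (G t - G a) * K a)
  (fun b => t / 2 < b < t /\ t - del < b < t)).
- apply filter_and; [apply at_right_interval; lra | exact H0].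
- apply filter_and; apply at_left_interval; lra.
- intros a b [Ha Ha2] [Hb Hb2] I HI. simpl in HI.
  rewrite (kernel_is_RInt a b I) by (easy || lra).
  apply Rle_trans with (F b - F a).
  + unfold F. specialize (Hdef b ltac:(lra)). specialize (Hsmall b Hb2).
    unfold K in Ha2 at 1. rewrite Rminus_0_r in Ha2. lra.
  + apply (antiderivative_le_RInt _ F dF); [lra | | | |].
    * intros z Hz. apply kernel_continuous. lra.
    * intros z Hz. apply DF. lra.
    * intros z Hz. apply CdF. lra.
    * intros z Hz. unfold dF.
      assert (0 <= (G t - G z) * (lam * Rpower (t - z) (- lam - 1))); [|lra].
      apply Rmult_le_pos; [specialize (Hmax z ltac:(lra)); lra|].
      apply Rmult_le_pos; [lra | apply Rlt_le, exp_pos].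
Qed.

End CaputoBounds.

(** * Characteristics of the wave equation *)

Lemma filterlim_point {T : Type} (F : (T -> Prop) -> Prop) {FF : Filter F}
    (f g : T -> R) (a b : R) :
  filterlim f F (locally a) -> filterlim g F (locally b) ->
  filterlim (fun r => ((f r, g r) : point)) F (locally ((a, b) : point)).
Proof.
intros Hf Hg. apply filterlim_locally. intros eps.
generalize (filter_and _ _ (proj1 (filterlim_locally _ _) Hf eps)
  (proj1 (filterlim_locally _ _) Hg eps)).
apply filter_imp. intros r [H1 H2]. now split.
Qed.

Lemma filterlim_within {T U : Type} (F : (T -> Prop) -> Prop) {FF : Filter F}
    (G : (U -> Prop) -> Prop) (c : T -> U) (D : U -> Prop) :
  filterlim c F G -> F (fun r => D (c r)) -> filterlim c F (within D G).
Proof.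
intros Hc HD P HP. generalize (filter_and _ _ (Hc _ HP) HD).
apply filter_imp. intros r [H1 H2]. now apply H1.
Qed.

(** The limit of [v] at [p] computed along a path that stays in [D]. *)
Lemma limit_along_path (D : point -> Prop) (v : point -> R) (a b l : R)
    {T : Type} (F : (T -> Prop) -> Prop) {FF : Filter F} (f g : T -> R) :
  limit_within D v (a, b) l ->
  filterlim f F (locally a) -> filterlim g F (locally b) ->
  F (fun r => D (f r, g r)) ->
  filterlim (fun r => v (f r, g r)) F (locally l).
Proof.
intros Hv Hf Hg HD.
apply (filterlim_comp _ _ _ (fun r => ((f r, g r) : point)) v F
  (within D (locally ((a, b) : point)))); [|exact Hv].
apply (filterlim_within _); [now apply (filterlim_point _) | easy].
Qed.

Lemma limit_within_comp (D D' : point -> Prop) (T : point -> point) (v : point -> R)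
    (p : point) (l : R) :
  continuous T p -> (forall q, D q -> D' (T q)) ->
  limit_within D' v (T p) l -> limit_within D (fun q => v (T q)) p l.
Proof.
intros HT HD Hv.
apply (filterlim_comp _ _ _ T v (within D (locally p)) (within D' (locally (T p))));
  [|exact Hv].
apply (filterlim_within _).
- eapply filterlim_filter_le_1; [|exact HT]. intros P HP. now apply filter_le_within.
- unfold within. apply filter_forall. exact HD.
Qed.

Lemma limit_within_plus (D : point -> Prop) (v1 v2 : point -> R) (p : point) (l1 l2 : R) :
  limit_within D v1 p l1 -> limit_within D v2 p l2 ->
  limit_within D (fun q => v1 q + v2 q) p (l1 + l2).
Proof. intros H1 H2. now apply (filterlim_Rplus _). Qed.

Lemma limit_within_minus (D : point -> Prop) (v1 v2 : point -> R) (p : point) (l1 l2 : R) :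
  limit_within D v1 p l1 -> limit_within D v2 p l2 ->
  limit_within D (fun q => v1 q - v2 q) p (l1 - l2).
Proof. intros H1 H2. now apply (filterlim_Rminus _). Qed.

Lemma extends_limit (D : point -> Prop) (v : point -> R) (p : point) :
  extends_continuously D v -> closure D p -> exists l, limit_within D v p l.
Proof.
intros (w & Cw & Ew) Hp. exists (w p).
apply (filterlim_ext_loc w).
- unfold within. apply filter_forall. exact Ew.
- eapply filterlim_filter_le_1; [|exact (Cw p Hp)].
  intros P HP. unfold within in *. revert HP. apply filter_imp.
  intros q Hq HD. apply Hq. intros eps. exists q. split; [apply ball_center | exact HD].
Qed.

Lemma continuous_on_open (D : point -> Prop) (v : point -> R) (p : point) :
  open D -> continuous_on D v -> D p -> continuous v p.
Proof.
intros HO Hv Hp P HP.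
assert (H : locally p (fun q => D q -> P (v q))) by exact (Hv p Hp P HP).
change (locally p (fun q => P (v q))).
generalize (filter_and _ _ H (HO p Hp)). apply filter_imp. intros q [H1 H2]. now apply H1.
Qed.

Lemma C1_differentiable (D : point -> Prop) (v : point -> R) (x t : R) :
  open D -> Defs.C1 D v -> D (x, t) ->
  differentiable_pt_lim (fun a b => v (a, b)) x t (dx v (x, t)) (dt v (x, t)).
Proof.
intros HO (Hex & _ & Cx & _) Hp.
apply filterdiff_differentiable_pt_lim.
apply (is_derive_filterdiff (fun a b => v (a, b)) x t (fun a b => dx v (a, b)) (dt v (x, t))).
- generalize (HO _ Hp). apply filter_imp. intros [a b] Hab. simpl.
  apply Derive_correct. exact (proj1 (Hex _ Hab)).
- apply Derive_correct. exact (proj2 (Hex _ Hp)).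
- apply (continuous_ext (dx v)); [now intros [a b]|].
  now apply (continuous_on_open D).
Qed.

Lemma directional_derivative (D : point -> Prop) (v : point -> R) (x t m n : R) :
  open D -> Defs.C1 D v -> D (x, t) ->
  is_derive (fun r => v (x + m * r, t + n * r)) 0 (dx v (x, t) * m + dt v (x, t) * n).
Proof.
intros HO Hv Hp. apply is_derive_Reals.
apply (derivable_pt_lim_comp_2d (fun a b => v (a, b)) (fun r => x + m * r) (fun r => t + n * r)).
- rewrite !Rmult_0_r, !Rplus_0_r. now apply (C1_differentiable D).
- apply is_derive_Reals. auto_derive; [easy | ring].
- apply is_derive_Reals. auto_derive; [easy | ring].
Qed.

Lemma mixed_derivatives (D : point -> Prop) (w : point -> R) (x t : R) :
  open D -> C2 D w -> D (x, t) -> dx (dt w) (x, t) = dt (dx w) (x, t).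
Proof.
intros HO (Hw & Hx & Ht) Hp.
apply (Schwarz (fun a b => w (a, b)) x t).
- apply locally_2d_locally. generalize (HO _ Hp). apply filter_imp.
  intros [a b] Hab. simpl. repeat split.
  + exact (proj1 (proj1 Hw _ Hab)).
  + exact (proj2 (proj1 Hw _ Hab)).
  + exact (proj1 (proj1 Ht _ Hab)).
  + exact (proj2 (proj1 Hx _ Hab)).
- apply continuity_2d_pt_filterlim.
  assert (C := continuous_on_open D _ _ HO (proj1 (proj2 (proj2 Ht))) Hp).
  exact (continuous_ext (dx (dt w)) (fun z => dx (dt w) (fst z, snd z)) (x, t)
    (fun z => f_equal _ (surjective_pairing z)) C).
- apply continuity_2d_pt_filterlim.
  assert (C := continuous_on_open D _ _ HO (proj2 (proj2 (proj2 Hx))) Hp).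
  exact (continuous_ext (dt (dx w)) (fun z => dt (dx w) (fst z, snd z)) (x, t)
    (fun z => f_equal _ (surjective_pairing z)) C).
Qed.

(** Along (1, 1) the derivative of w_x - w_t is w_xx - w_tt, by the symmetry of
    the mixed derivatives. *)
Lemma dminus_constant (D : point -> Prop) (w : point -> R) (x t m : R) :
  open D -> C2 D w -> dx (dx w) (x, t) = dt (dt w) (x, t) -> D (x, t) ->
  is_derive (fun r => dminus w (x + m * r, t + m * r)) 0 0.
Proof.
intros HO HC He Hp.
assert (Hm := mixed_derivatives D w x t HO HC Hp).
destruct HC as (Hw & Hx & Ht).
assert (D1 := directional_derivative D (dx w) x t m m HO Hx Hp).
assert (D2 := directional_derivative D (dt w) x t m m HO Ht Hp).
assert (D3 := is_derive_minus (V := R_NormedModule) _ _ _ _ _ D1 D2).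
replace 0 with (minus (dx (dx w) (x, t) * m + dt (dx w) (x, t) * m)
  (dx (dt w) (x, t) * m + dt (dt w) (x, t) * m)) at 2; [exact D3|].
rewrite He, Hm.
change (dt (dt w) (x, t) * m + dt (dx w) (x, t) * m -
  (dt (dx w) (x, t) * m + dt (dt w) (x, t) * m) = 0). ring.
Qed.

Lemma dplus_constant (D : point -> Prop) (w : point -> R) (x t m : R) :
  open D -> C2 D w -> dx (dx w) (x, t) = dt (dt w) (x, t) -> D (x, t) ->
  is_derive (fun r => dplus w (x + m * r, t + - m * r)) 0 0.
Proof.
intros HO HC He Hp.
assert (Hm := mixed_derivatives D w x t HO HC Hp).
destruct HC as (Hw & Hx & Ht).
assert (D1 := directional_derivative D (dx w) x t m (- m) HO Hx Hp).
assert (D2 := directional_derivative D (dt w) x t m (- m) HO Ht Hp).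
assert (D3 := is_derive_plus (V := R_NormedModule) _ _ _ _ _ D1 D2).
replace 0 with (plus (dx (dx w) (x, t) * m + dt (dx w) (x, t) * - m)
  (dx (dt w) (x, t) * m + dt (dt w) (x, t) * - m)) at 2; [exact D3|].
rewrite He, Hm.
change (dt (dt w) (x, t) * m + dt (dx w) (x, t) * - m +
  (dt (dx w) (x, t) * m + dt (dt w) (x, t) * - m) = 0). ring.
Qed.

(** The region between the unit segment of the first axis and a curve below it:
    the common normal form of the three hyperbolic domains. *)
Definition region (g : R -> R) (p : point) : Prop :=
  0 < fst p < 1 /\ - g (fst p) < snd p < 0.

Definition on_curve (g : R -> R) (p : point) : Prop :=
  unit_interval (fst p) /\ snd p = - g (fst p).

Definition positive_curve (g : R -> R) : Prop :=
  curve_function g /\ forall s, 0 < s < 1 -> 0 < g s.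

Lemma curve_continuous (g : R -> R) :
  curve_function g -> forall x, continuous (fun y => g (clamp y)) x.
Proof. intros ((g' & _ & Hg & _) & _). now apply (deriv01_continuous g g'). Qed.

Lemma curve_continuous_inside (g : R -> R) (x : R) :
  curve_function g -> 0 < x < 1 -> continuous g x.
Proof.
intros Hg Hx. apply (continuous_ext_loc _ (fun y => g (clamp y))).
- generalize (locally_open_unit x Hx). apply filter_imp. intros y Hy.
  rewrite clamp_id; [easy | unfold unit_interval; lra].
- now apply curve_continuous.
Qed.

Lemma region_open (g : R -> R) : curve_function g -> open (region g).
Proof.
intros Hg [x t] [Hx Ht]. simpl in Hx, Ht.
assert (He : 0 < Rmin (- t) (t + g x) / 2).
{ assert (0 < Rmin (- t) (t + g x)) by (apply Rmin_glb_lt; lra). lra. }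
assert (Rmin (- t) (t + g x) <= - t) by apply Rmin_l.
assert (Rmin (- t) (t + g x) <= t + g x) by apply Rmin_r.
destruct (proj1 (filterlim_locally _ _) (curve_continuous_inside g x Hg Hx)
  (mkposreal _ He)) as [d1 H1].
destruct (locally_open_unit x Hx) as [d2 H2].
assert (Hd : 0 < Rmin (Rmin d1 d2) (Rmin (- t) (t + g x) / 2)).
{ repeat apply Rmin_glb_lt; try apply cond_pos; easy. }
exists (mkposreal _ Hd). intros [y s] [Hy Hs]. simpl in Hy, Hs.
assert (Hy1 : ball x d1 y).
{ eapply ball_le; [|exact Hy]. eapply Rle_trans; [apply Rmin_l | apply Rmin_l]. }
assert (Hy2 : ball x d2 y).
{ eapply ball_le; [|exact Hy]. eapply Rle_trans; [apply Rmin_l | apply Rmin_r]. }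
assert (Hs1 : Rabs (s - t) < Rmin (- t) (t + g x) / 2).
{ eapply Rlt_le_trans; [exact Hs | apply Rmin_r]. }
specialize (H1 y Hy1). specialize (H2 y Hy2).
change (Rabs (g y - g x) < Rmin (- t) (t + g x) / 2) in H1.
apply Rabs_def2 in H1. apply Rabs_def2 in Hs1.
split; simpl; lra.
Qed.

Lemma region_box (g : R -> R) (s : R) :
  positive_curve g -> 0 < s < 1 ->
  exists del : posreal, forall y t, Rabs (y - s) < del -> - del < t < 0 -> region g (y, t).
Proof.
intros [Hg Hpos] Hs.
assert (He : 0 < g s / 2) by (specialize (Hpos s Hs); lra).
destruct (proj1 (filterlim_locally _ _) (curve_continuous_inside g s Hg Hs)
  (mkposreal _ He)) as [d1 H1].
destruct (locally_open_unit s Hs) as [d2 H2].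
assert (Hd : 0 < Rmin (Rmin d1 d2) (g s / 2)).
{ repeat apply Rmin_glb_lt; try apply cond_pos; easy. }
exists (mkposreal _ Hd). simpl. intros y t Hy Ht.
assert (Rmin (Rmin d1 d2) (g s / 2) <= g s / 2) by apply Rmin_r.
assert (Hy1 : Rabs (y - s) < d1).
{ eapply Rlt_le_trans; [exact Hy|]. eapply Rle_trans; [apply Rmin_l | apply Rmin_l]. }
assert (Hy2 : Rabs (y - s) < d2).
{ eapply Rlt_le_trans; [exact Hy|]. eapply Rle_trans; [apply Rmin_l | apply Rmin_r]. }
specialize (H1 y Hy1). specialize (H2 y Hy2).
change (Rabs (g y - g s) < g s / 2) in H1. apply Rabs_def2 in H1.
split; simpl; lra.
Qed.

Lemma region_closure (g : R -> R) (s : R) :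
  positive_curve g -> 0 < s < 1 -> closure (region g) (s, 0).
Proof.
intros Hg Hs eps. destruct (region_box g s Hg Hs) as [del Hdel].
assert (Hm : 0 < Rmin del eps / 2).
{ assert (0 < Rmin del eps) by (apply Rmin_glb_lt; apply cond_pos). lra. }
assert (Rmin del eps <= del) by apply Rmin_l.
assert (Rmin del eps <= eps) by apply Rmin_r.
exists (s, - (Rmin del eps / 2)). split.
- split; simpl.
  + apply ball_center.
  + change (Rabs (- (Rmin del eps / 2) - 0) < eps). rewrite Rabs_left; lra.
- apply Hdel; [rewrite Rminus_diag, Rabs_R0; apply cond_pos | lra].
Qed.

Lemma constant_limits (phi : R -> R) (r1 l0 l1 : R) :
  0 < r1 -> (forall r, 0 < r < r1 -> is_derive phi r 0) ->
  filterlim phi (at_right 0) (locally l0) ->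
  filterlim phi (at_left r1) (locally l1) -> l0 = l1.
Proof.
intros Hr Hd H0 H1.
assert (Hc : forall r, 0 < r < r1 -> phi r = phi (r1 / 2)).
{ assert (Hle : forall a b, 0 < a -> a <= b -> b < r1 -> phi a = phi b).
  { intros a b Ha Hab Hb. apply constant_of_derive; [easy | |].
    - intros x Hx. apply Hd. lra.
    - intros x Hx. apply continuous_of_is_derive with 0, Hd. lra. }
  intros r Hr'. destruct (Rle_lt_dec r (r1 / 2)).
  - apply Hle; lra.
  - symmetry. apply Hle; lra. }
transitivity (phi (r1 / 2)).
- apply (filterlim_locally_unique phi (F := at_right 0)); [exact H0|].
  apply (filterlim_ext_loc (fun _ => phi (r1 / 2))); [|apply filterlim_const].
  generalize (at_right_interval 0 r1 Hr). apply filter_imp. intros r Hr'. symmetry. now apply Hc.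
- apply (filterlim_locally_unique phi (F := at_left r1)); [|exact H1].
  apply (filterlim_ext_loc (fun _ => phi (r1 / 2))); [|apply filterlim_const].
  generalize (at_left_interval 0 r1 Hr). apply filter_imp. intros r Hr'. symmetry. now apply Hc.
Qed.

Lemma is_derive_shift (phi : R -> R) (r l : R) :
  is_derive (fun h => phi (r + h)) 0 l -> is_derive phi r l.
Proof.
intros H. apply is_derive_Reals in H. apply is_derive_Reals.
intros eps Heps. destruct (H eps Heps) as [del Hdel]. exists del. intros h Hh0 Hh.
specialize (Hdel h Hh0 Hh). now rewrite Rplus_0_l, Rplus_0_r in Hdel.
Qed.

Lemma affine_limit (m n r l : R) (F : (R -> Prop) -> Prop) :
  filter_le F (locally r) -> m + n * r = l ->
  filterlim (fun r => m + n * r) F (locally l).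
Proof.
intros HF <-. eapply filterlim_filter_le_1; [exact HF|].
apply (continuous_plus (V := R_NormedModule)); [apply continuous_const|].
apply (continuous_scal_r (V := R_NormedModule)), continuous_id.
Qed.

(** [V] is constant along the direction (e, -1); its limits at the two ends of the
    open segment from (s, 0) down to the first point of the curve agree. *)
Lemma characteristic_limits (g : R -> R) (V : point -> R) (s e l l1 r1 : R) :
  0 < r1 -> (forall r, 0 < r < r1 -> region g (s + e * r, - r)) ->
  (forall x t, region g (x, t) -> is_derive (fun r => V (x + e * r, t + -1 * r)) 0 0) ->
  limit_within (region g) V (s, 0) l ->
  limit_within (region g) V (s + e * r1, - r1) l1 -> l = l1.
Proof.
intros Hr1 Hin HV Hl Hl1.
assert (E : forall r, - r = 0 + -1 * r) by (intros; ring).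
apply (constant_limits (fun r => V (s + e * r, 0 + -1 * r)) r1); [easy | | |].
- intros r Hr. apply is_derive_shift.
  apply (is_derive_ext (fun h => V ((s + e * r) + e * h, - r + -1 * h))).
  + intros h. apply f_equal. f_equal; ring.
  + apply HV, Hin, Hr.
- apply (limit_along_path (region g) V s 0 l _ _ _ Hl).
  + apply (affine_limit s e 0); [apply filter_le_within | ring].
  + apply (affine_limit 0 (-1) 0); [apply filter_le_within | ring].
  + generalize (at_right_interval 0 r1 Hr1). apply filter_imp. intros r Hr.
    rewrite <- E. now apply Hin.
- apply (limit_along_path (region g) V _ _ l1 _ _ _ Hl1).
  + apply (affine_limit s e r1); [apply filter_le_within | ring].
  + apply (affine_limit 0 (-1) r1); [apply filter_le_within | ring].
  + generalize (at_left_interval 0 r1 Hr1). apply filter_imp. intros r Hr.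
    rewrite <- E. now apply Hin.
Qed.

(** The two characteristics from (s, 0) carry the boundary values of [V] and [U]
    to the curve, where the nonlocal condition relates them. *)
Lemma characteristic_traces (g : R -> R) (U V : point -> R) (sigma s lu lv : R) :
  positive_curve g -> 0 < s < 1 ->
  (forall x t, region g (x, t) -> is_derive (fun r => V (x + -1 * r, t + -1 * r)) 0 0) ->
  (forall x t, region g (x, t) -> is_derive (fun r => U (x + 1 * r, t + -1 * r)) 0 0) ->
  (forall p q, on_curve g p -> fst p - snd p = s -> on_curve g q -> fst q + snd q = s ->
     exists a b, limit_within (region g) V p a /\ limit_within (region g) U q b /\
       a = sigma * b) ->
  limit_within (region g) U (s, 0) lu -> limit_within (region g) V (s, 0) lv ->
  lv = sigma * lu.
Proof.
intros [Hg Hpos] Hs HV HU Hnl Hlu Hlv.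
assert (Cg := curve_continuous g Hg). destruct Hg as (_ & g0 & g1 & _ & _).
assert (Cphi : forall e x, continuous (fun r => g (clamp (s + e * r)) - r) x).
{ intros e x. apply (continuous_minus (V := R_NormedModule)); [|apply continuous_id].
  apply (continuous_comp (fun r => s + e * r) (fun y => g (clamp y))); [|apply Cg].
  apply (affine_limit s e x); [intros P HP; exact HP | ring]. }
assert (Hstart : forall e, 0 < g (clamp (s + e * 0)) - 0).
{ intros e. rewrite Rmult_0_r, Rplus_0_r, Rminus_0_r, clamp_id by (unfold unit_interval; lra).
  now apply Hpos. }
destruct (first_zero _ s ltac:(lra) (fun x _ => Cphi (-1) x) (Hstart (-1)))
  as [Hall | (r1 & Hr1 & Hz1 & Hp1)].
{ specialize (Hall s ltac:(lra)). simpl in Hall.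
  replace (s + -1 * s) with 0 in Hall by ring.
  rewrite clamp_id, g0 in Hall by (unfold unit_interval; lra). lra. }
destruct (first_zero _ (1 - s) ltac:(lra) (fun x _ => Cphi 1 x) (Hstart 1))
  as [Hall | (r2 & Hr2 & Hz2 & Hp2)].
{ specialize (Hall (1 - s) ltac:(lra)). simpl in Hall.
  replace (s + 1 * (1 - s)) with 1 in Hall by ring.
  rewrite clamp_id, g1 in Hall by (unfold unit_interval; lra). lra. }
rewrite clamp_id in Hz1, Hz2 by (unfold unit_interval; lra).
destruct (Hnl (s + -1 * r1, - r1) (s + 1 * r2, - r2)) as (a & b & Ha & Hb & E).
- split; simpl; [unfold unit_interval; lra | lra].
- simpl. ring.
- split; simpl; [unfold unit_interval; lra | lra].
- simpl. ring.
- rewrite (characteristic_limits g V s (-1) lv a r1), (characteristic_limits g U s 1 lu b r2);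
    try easy; try lra.
  + intros r Hr. specialize (Hp2 r ltac:(lra)). simpl in Hp2.
    rewrite clamp_id in Hp2 by (unfold unit_interval; lra). split; simpl; lra.
  + intros r Hr. specialize (Hp1 r ltac:(lra)). simpl in Hp1.
    rewrite clamp_id in Hp1 by (unfold unit_interval; lra). split; simpl; lra.
Qed.

(** The monotonicity of s + g(s) and s - g(s) keeps a characteristic inside the
    region until it reaches the segment. *)
Lemma characteristic_zero (g : R -> R) (V : point -> R) (e x t : R) :
  positive_curve g -> e = 1 \/ e = -1 ->
  (forall x t, region g (x, t) -> is_derive (fun r => V (x + e * r, t + 1 * r)) 0 0) ->
  (forall s, 0 < s < 1 -> limit_within (region g) V (s, 0) 0) ->
  region g (x, t) -> V (x, t) = 0.
Proof.
intros [Hg Hpos] He HV Hl Hxt.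
destruct Hg as (_ & g0 & g1 & Mp & Mm). unfold monotone01 in Mp, Mm.
assert (Hin : forall r, 0 <= r < - t -> region g (x + e * r, t + 1 * r)).
{ intros r Hr. destruct Hxt as [Hx Ht]. simpl in Hx, Ht.
  assert (Hx1 := Mp x 1 ltac:(lra) ltac:(lra) ltac:(lra)).
  assert (Hx0 := Mm 0 x ltac:(lra) ltac:(lra) ltac:(lra)).
  destruct He as [-> | ->]; split; simpl; try lra.
  - assert (H := Mp x (x + 1 * r) ltac:(lra) ltac:(lra) ltac:(lra)). lra.
  - assert (H := Mm (x + -1 * r) x ltac:(lra) ltac:(lra) ltac:(lra)). lra. }
assert (Hs : 0 < x + e * - t < 1).
{ destruct Hxt as [Hx Ht]. simpl in Hx, Ht.
  assert (Hx1 := Mp x 1 ltac:(lra) ltac:(lra) ltac:(lra)).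
  assert (Hx0 := Mm 0 x ltac:(lra) ltac:(lra) ltac:(lra)).
  destruct He as [-> | ->]; lra. }
assert (Ht : 0 < - t) by (destruct Hxt as [_ Ht]; simpl in Ht; lra).
set (phi := fun r => V (x + e * r, t + 1 * r)).
assert (Dphi : forall r, 0 <= r < - t -> is_derive phi r 0).
{ intros r Hr. apply is_derive_shift.
  apply (is_derive_ext (fun h => V ((x + e * r) + e * h, (t + 1 * r) + 1 * h))).
  - intros h. unfold phi. apply f_equal. f_equal; ring.
  - apply HV, Hin, Hr. }
assert (Hc : forall r, 0 <= r < - t -> phi r = phi 0).
{ intros r Hr. symmetry. apply constant_of_derive; [lra | |].
  - intros y Hy. apply Dphi. lra.
  - intros y Hy. apply continuous_of_is_derive with 0, Dphi. lra. }
assert (Hlim : filterlim phi (at_left (- t)) (locally 0)).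
{ apply (limit_along_path (region g) V (x + e * - t) 0 0 _ _ _ (Hl _ Hs)).
  - apply (affine_limit x e (- t)); [apply filter_le_within | ring].
  - apply (affine_limit t 1 (- t)); [apply filter_le_within | ring].
  - generalize (at_left_interval 0 (- t) Ht). apply filter_imp. intros r Hr. apply Hin. lra. }
replace (V (x, t)) with (phi 0).
2: { unfold phi. apply f_equal. f_equal; ring. }
symmetry. apply (filterlim_locally_unique phi (F := at_left (- t))); [exact Hlim|].
apply (filterlim_ext_loc (fun _ => phi 0)); [|apply filterlim_const].
generalize (at_left_interval 0 (- t) Ht). apply filter_imp. intros r Hr. symmetry. apply Hc. lra.
Qed.

(** This identifies the limit of the tangential derivative, taken from inside a
    hyperbolic region, with a derivative that the square shares. *)
Lemma tangential_derivative (g : R -> R) (W V : point -> R) (tau : R -> R) (s l : R) :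
  positive_curve g -> 0 < s < 1 ->
  (forall x t, region g (x, t) -> is_derive (fun y => W (y, t)) x (V (x, t))) ->
  (forall x, 0 < x < 1 -> filterlim (fun t => W (x, t)) (at_left 0) (locally (tau x))) ->
  limit_within (region g) V (s, 0) l ->
  is_derive tau s l.
Proof.
intros Hg Hs HW Htau Hl.
apply (is_derive_of_limit (at_left 0) (fun x t => W (x, t)) (fun x t => V (x, t))).
- intros eps.
  destruct (proj1 (filterlim_locally _ _) Hl eps) as [d1 H1].
  destruct (region_box g s Hg Hs) as [d2 H2].
  assert (Hd : 0 < Rmin d1 d2) by (apply Rmin_glb_lt; apply cond_pos).
  exists (mkposreal _ Hd).
  assert (Hint := at_left_interval (- Rmin d1 d2) 0 ltac:(lra)).
  revert Hint. apply filter_imp. intros t Ht y Hy. simpl in Hy.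
  assert (Rmin d1 d2 <= d1) by apply Rmin_l.
  assert (Rmin d1 d2 <= d2) by apply Rmin_r.
  assert (Hin : region g (y, t)) by (apply H2; lra).
  split; [now apply HW|].
  apply Rlt_le, (H1 (y, t)); [|exact Hin].
  split; simpl.
  + change (Rabs (y - s) < d1). lra.
  + change (Rabs (t - 0) < d1). rewrite Rabs_left; lra.
- generalize (locally_open_unit s Hs). apply filter_imp. exact Htau.
Qed.

(** * A parabolic maximum principle *)

Lemma continuous_section_x (f : point -> R) (x t : R) :
  continuous f (x, t) -> continuous (fun y => f (y, t)) x.
Proof.
intros Hf. apply (filterlim_comp _ _ _ (fun y => ((y, t) : point)) f _ (locally ((x, t) : point)));
  [|exact Hf].
apply (filterlim_point _); [apply filterlim_id | apply filterlim_const].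
Qed.

Lemma continuous_section_t (f : point -> R) (x t : R) :
  continuous f (x, t) -> continuous (fun y => f (x, y)) t.
Proof.
intros Hf. apply (filterlim_comp _ _ _ (fun y => ((x, y) : point)) f _ (locally ((x, t) : point)));
  [|exact Hf].
apply (filterlim_point _); [apply filterlim_const | apply filterlim_id].
Qed.

(** The maximum of the row maxima, which depend continuously on [t]. *)
Lemma rectangle_maximum (f : point -> R) (T : R) :
  0 <= T -> (forall p, continuous f p) ->
  exists x0 t0, 0 <= x0 <= 1 /\ 0 <= t0 <= T /\
    forall x t, 0 <= x <= 1 -> 0 <= t <= T -> f (x, t) <= f (x0, t0).
Proof.
intros HT Cf.
assert (Hrow : forall t, exists x0, (forall x, 0 <= x <= 1 -> f (x, t) <= f (x0, t)) /\ 0 <= x0 <= 1).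
{ intros t. apply (continuity_ab_maj (fun x => f (x, t)) 0 1); [lra|].
  intros x _. apply continuity_pt_filterlim, continuous_section_x, Cf. }
assert (HM : forall t, {m | is_lub (fun y => exists x, 0 <= x <= 1 /\ y = f (x, t)) m}).
{ intros t. apply completeness.
  - destruct (Hrow t) as (x0 & Hx0 & _). exists (f (x0, t)).
    intros y (x & Hx & ->). now apply Hx0.
  - exists (f (0, t)), 0. split; [lra | easy]. }
set (M := fun t => proj1_sig (HM t)).
assert (Hub : forall x t, 0 <= x <= 1 -> f (x, t) <= M t).
{ intros x t Hx. apply (proj2_sig (HM t)). now exists x. }
assert (Hlub : forall t b, (forall x, 0 <= x <= 1 -> f (x, t) <= b) -> M t <= b).
{ intros t b Hb. apply (proj2_sig (HM t)). intros y (x & Hx & ->). now apply Hb. }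
destruct (continuity_ab_maj M 0 T HT) as (t0 & Hmax & Ht0).
{ intros t Ht. apply continuity_pt_filterlim, filterlim_locally. intros eps.
  assert (He : 0 < eps / 2) by (generalize (cond_pos eps); lra).
  destruct (uniform_continuity_2d (fun x t => f (x, t)) 0 1 (-1) (T + 1)) with (eps := mkposreal _ He)
    as [del Hdel].
  { intros x s _ _. apply continuity_2d_pt_filterlim.
    apply (continuous_ext f (fun z => f (fst z, snd z))); [now intros [a b] | apply Cf]. }
  assert (Hm : 0 < Rmin del 1) by (apply Rmin_glb_lt; [apply cond_pos | lra]).
  exists (mkposreal _ Hm). intros s Hs. change R in s. change (Rabs (s - t) < Rmin del 1) in Hs.
  assert (Rmin del 1 <= del) by apply Rmin_l. assert (Rmin del 1 <= 1) by apply Rmin_r.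
  assert (Hs' := Rabs_def2 _ _ Hs).
  assert (Hd : forall x, 0 <= x <= 1 -> Rabs (f (x, s) - f (x, t)) < eps / 2).
  { intros x Hx. apply Hdel; try lra. rewrite Rminus_diag, Rabs_R0. apply cond_pos. }
  assert (M s <= M t + eps / 2).
  { apply Hlub. intros x Hx. assert (H1 := Rabs_def2 _ _ (Hd x Hx)).
    assert (H2 := Hub x t Hx). lra. }
  assert (M t <= M s + eps / 2).
  { apply Hlub. intros x Hx. assert (H2 := Rabs_def2 _ _ (Hd x Hx)).
    assert (H3 := Hub x s Hx). lra. }
  change (Rabs (M s - M t) < eps). generalize (cond_pos eps). intros.
  apply Rabs_def1; lra. }
destruct (Hrow t0) as (x0 & Hx0 & Hx).
exists x0, t0. repeat split; try easy.
intros x t Hx' Ht. apply Rle_trans with (M t); [now apply Hub|].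
apply Rle_trans with (M t0); [now apply Hmax | now apply Hlub].
Qed.

Lemma interior_max_second_derivative (f f1 : R -> R) (x0 L : R) :
  0 < x0 < 1 ->
  (forall x, 0 < x < 1 -> is_derive f x (f1 x)) ->
  is_derive f1 x0 L ->
  (forall x, 0 < x < 1 -> f x <= f x0) ->
  L <= 0.
Proof.
intros Hx0 Df D1 Hmax.
destruct (Rle_lt_dec L 0) as [|HL]; [easy|exfalso].
assert (H0 : f1 x0 = 0).
{ assert (Hd := proj1 (is_derive_Reals _ _ _) (Df x0 Hx0)).
  assert (pr : derivable_pt f x0) by now exists (f1 x0).
  rewrite <- (derive_pt_eq_0 f x0 (f1 x0) pr Hd).
  apply (deriv_maximum f 0 1 x0 pr); [lra | lra | intros z Hz1 Hz2; apply Hmax; lra]. }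
apply is_derive_Reals in D1. destruct (D1 L HL) as [del Hdel].
set (e := Rmin (del / 2) ((1 - x0) / 2)).
assert (He : 0 < e /\ e <= del / 2 /\ e <= (1 - x0) / 2).
{ unfold e. repeat split; [|apply Rmin_l | apply Rmin_r].
  apply Rmin_glb_lt; [generalize (cond_pos del); lra | lra]. }
assert (f x0 < f (x0 + e)).
{ apply (increasing_of_derive f f1); [lra | | |].
  - intros x Hx. apply Df. lra.
  - intros x Hx. apply continuous_of_is_derive with (f1 x), Df. lra.
  - intros x Hx. specialize (Hdel (x - x0) ltac:(lra)).
    rewrite Rabs_right in Hdel by lra. specialize (Hdel ltac:(generalize (cond_pos del); lra)).
    replace (x0 + (x - x0)) with x in Hdel by ring. rewrite H0 in Hdel.
    apply Rabs_def2 in Hdel.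
    replace (f1 x) with ((f1 x - 0) / (x - x0) * (x - x0)) by (field; lra).
    apply Rmult_lt_0_compat; lra. }
specialize (Hmax (x0 + e) ltac:(lra)). lra.
Qed.

(** The barrier [eta * x * (1 - x)] excludes maxima on the sides, where its normal
    derivative has the wrong sign; at an interior maximum it costs only [2 * eta]
    in the second derivative, less than the zero-order lower bound. *)
Lemma parabolic_maximum_principle (z zx zxx : point -> R) (T c : R) :
  0 < T -> 0 < c ->
  (forall p, continuous z p) -> (forall p, continuous zx p) ->
  (forall x, 0 <= x <= 1 -> z (x, 0) = 0) ->
  (forall x t, 0 < x < 1 -> 0 < t <= T ->
     is_derive (fun y => z (y, t)) x (zx (x, t)) /\
     is_derive (fun y => zx (y, t)) x (zxx (x, t))) ->
  (forall x t, 0 < x < 1 -> 0 < t <= T ->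
     (forall s, 0 <= s <= t -> z (x, s) <= z (x, t)) -> 0 <= z (x, t) ->
     c * z (x, t) <= zxx (x, t)) ->
  (forall t, 0 < t <= T -> (forall s, 0 <= s <= t -> z (0, s) <= z (0, t)) ->
     0 <= z (0, t) -> 0 <= zx (0, t)) ->
  (forall t, 0 < t <= T -> (forall s, 0 <= s <= t -> z (1, s) <= z (1, t)) ->
     0 <= z (1, t) -> zx (1, t) <= 0) ->
  forall x t, 0 <= x <= 1 -> 0 <= t <= T -> z (x, t) <= 0.
Proof.
intros HT Hc Cz Czx Hinit Hder Hint Hleft Hright x1 t1 Hx1 Ht1.
destruct (Rle_lt_dec (z (x1, t1)) 0) as [|Hm]; [easy|exfalso].
set (m := z (x1, t1)) in *.
assert (Hcm : 0 < c * m) by now apply Rmult_lt_0_compat.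
(* [eta <= m] keeps [z >= m / 2] at the maximum of [y]; the other bound makes
   2 * eta smaller than c * m / 2. *)
set (eta := Rmin m (c * m / 8)).
assert (Heta : 0 < eta /\ eta <= m /\ eta <= c * m / 8).
{ unfold eta. repeat split; [apply Rmin_glb_lt; lra | apply Rmin_l | apply Rmin_r]. }
set (y := fun p : point => z p + eta * (fst p * (1 - fst p))).
assert (Cy : forall p, continuous y p).
{ intros p. apply (continuous_plus (V := R_NormedModule)); [apply Cz|].
  apply (continuous_scal_r (V := R_NormedModule)).
  apply (continuous_mult (K := R_AbsRing)); [apply continuous_fst|].
  apply (continuous_minus (V := R_NormedModule)); [apply continuous_const | apply continuous_fst]. }
destruct (rectangle_maximum y T ltac:(lra) Cy) as (x0 & t0 & Hx0 & Ht0 & Hmax).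
assert (Hy0 : m <= z (x0, t0) + eta * (x0 * (1 - x0))).
{ apply Rle_trans with (y (x1, t1)); [|now apply (Hmax x1 t1)].
  unfold y. simpl. fold m. assert (0 <= eta * (x1 * (1 - x1))); [|lra].
  repeat apply Rmult_le_pos; lra. }
assert (Hq : x0 * (1 - x0) <= 1 / 4) by (generalize (Rle_0_sqr (x0 - 1 / 2)); unfold Rsqr; lra).
assert (Hz0 : m / 2 <= z (x0, t0)).
{ assert (eta * (x0 * (1 - x0)) <= eta * (1 / 4)) by (apply Rmult_le_compat_l; lra). lra. }
assert (Ht0' : 0 < t0 <= T).
{ destruct (Req_dec t0 0) as [E | ]; [|lra]. rewrite E, Hinit in Hz0 by easy. lra. }
assert (Hrun : forall s, 0 <= s <= t0 -> z (x0, s) <= z (x0, t0)).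
{ intros s Hs. assert (H := Hmax x0 s Hx0 ltac:(lra)). unfold y in H. simpl in H. lra. }
set (f := fun x => y (x, t0)). set (f1 := fun x => zx (x, t0) + eta * (1 - 2 * x)).
assert (Df : forall x, 0 < x < 1 -> is_derive f x (f1 x)).
{ intros x Hx. apply (is_derive_plus (V := R_NormedModule) (fun x => z (x, t0))).
  - now apply Hder.
  - simpl. auto_derive; [easy | ring]. }
assert (Cf : forall x, continuous f x) by (intros; apply continuous_section_x, Cy).
assert (Cf1 : forall x, continuous f1 x).
{ intros x. apply (continuous_plus (V := R_NormedModule)).
  - apply continuous_section_x, Czx.
  - apply (continuous_scal_r (V := R_NormedModule)).
    apply (continuous_minus (V := R_NormedModule)); [apply continuous_const|].
    apply (continuous_scal_r (V := R_NormedModule)), continuous_id. }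
assert (Hfmax : forall x, 0 <= x <= 1 -> f x <= f x0) by (intros x Hx; now apply Hmax).
destruct (Req_dec x0 0) as [E0 | Hne0]; [|destruct (Req_dec x0 1) as [E1 | Hne1]].
- rewrite E0 in Hrun, Hz0, Hfmax.
  assert (Hpos : 0 < f1 0).
  { unfold f1. specialize (Hleft t0 Ht0' Hrun ltac:(lra)). lra. }
  destruct (proj1 (filterlim_locally _ _) (Cf1 0) (mkposreal _ Hpos)) as [e He].
  set (x := Rmin (e / 2) (1 / 2)).
  assert (Hx : 0 < x /\ x <= e / 2 /\ x <= 1 / 2).
  { unfold x. repeat split; [|apply Rmin_l | apply Rmin_r].
    apply Rmin_glb_lt; [generalize (cond_pos e); lra | lra]. }
  assert (f 0 < f x).
  { apply (increasing_of_derive f f1); [lra | intros r Hr; apply Df; lra | easy |].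
    intros r Hr. specialize (He r ltac:(change (Rabs (r - 0) < e); rewrite Rabs_right; lra)).
    change (Rabs (f1 r - f1 0) < f1 0) in He. apply Rabs_def2 in He. lra. }
  specialize (Hfmax x ltac:(lra)). lra.
- rewrite E1 in Hrun, Hz0, Hfmax.
  assert (Hneg : 0 < - f1 1).
  { unfold f1. specialize (Hright t0 Ht0' Hrun ltac:(lra)). lra. }
  destruct (proj1 (filterlim_locally _ _) (Cf1 1) (mkposreal _ Hneg)) as [e He].
  set (x := Rmax (1 - e / 2) (1 / 2)).
  assert (Hx : x < 1 /\ 1 - e / 2 <= x /\ 1 / 2 <= x).
  { unfold x. repeat split; [|apply Rmax_l | apply Rmax_r].
    apply Rmax_lub_lt; [generalize (cond_pos e); lra | lra]. }
  assert (- f x < - f 1).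
  { apply (increasing_of_derive (fun x => - f x) (fun x => - f1 x)); [lra | | |].
    - intros r Hr. apply is_derive_Ropp, Df. lra.
    - intros r _. apply continuous_Ropp, Cf.
    - intros r Hr. specialize (He r ltac:(change (Rabs (r - 1) < e); rewrite Rabs_left; lra)).
      change (Rabs (f1 r - f1 1) < - f1 1) in He. apply Rabs_def2 in He. lra. }
  specialize (Hfmax x ltac:(lra)). lra.
- assert (HL : zxx (x0, t0) + eta * -2 <= 0).
  { apply (interior_max_second_derivative f f1 x0); [lra | exact Df | |].
    - apply (is_derive_plus (V := R_NormedModule) (fun x => zx (x, t0))).
      + apply Hder; lra.
      + auto_derive; [easy | ring].
    - intros x Hx. apply Hfmax. lra. }
  specialize (Hint x0 t0 ltac:(lra) Ht0' Hrun ltac:(lra)).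
  assert (c * (m / 2) <= c * z (x0, t0)) by (apply Rmult_le_compat_l; lra).
  lra.
Qed.

(** * The difference of two solutions *)

Lemma open_section_x (D : point -> Prop) (x t : R) :
  open D -> D (x, t) -> locally x (fun y => D (y, t)).
Proof.
intros HO Hp. destruct (HO _ Hp) as [e He]. exists e. intros y Hy.
apply He. split; [exact Hy | apply ball_center].
Qed.

Lemma open_section_t (D : point -> Prop) (x t : R) :
  open D -> D (x, t) -> locally t (fun s => D (x, s)).
Proof.
intros HO Hp. destruct (HO _ Hp) as [e He]. exists e. intros s Hs.
apply He. split; [apply ball_center | exact Hs].
Qed.

Lemma open_preimage (T : point -> point) (D : point -> Prop) :
  (forall p, continuous T p) -> open D -> open (fun p => D (T p)).
Proof. intros HT HO p Hp. exact (HT p _ (HO _ Hp)). Qed.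

(** [swap] and [turn] carry the normal form [region] to the domains left and right
    of the square; [swap] preserves the two families of characteristics and [turn] exchanges
    them. *)
Definition swap (p : point) : point := (snd p, fst p).

Definition turn (p : point) : point := (1 - snd p, fst p).

Lemma continuous_swap (p : point) : continuous swap p.
Proof.
destruct p as [x t]. apply (filterlim_point (locally (x, t)) snd fst);
  [apply continuous_snd | apply continuous_fst].
Qed.

Lemma continuous_turn (p : point) : continuous turn p.
Proof.
destruct p as [x t]. apply (filterlim_point (locally (x, t)) (fun q => 1 - snd q) fst);
  [|apply continuous_fst].
apply (filterlim_Rminus _); [apply filterlim_const | apply continuous_snd].
Qed.

Lemma curve_function_opp (g : R -> R) : curve_function g -> curve_function (fun s => - g s).
Proof.
intros ((g' & g'' & H1 & H2) & H0 & H1' & Mp & Mm). repeat split.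
- exists (fun s => - g' s), (fun s => - g'' s). split; now apply deriv01_opp.
- rewrite H0. ring.
- rewrite H1'. ring.
- exact Mm.
- intros s r Hs Hsr Hr. specialize (Mp s r Hs Hsr Hr). simpl in Mp. lra.
Qed.

Lemma open_Omega0 : open Omega0.
Proof.
intros [x t] [Hx Ht]. destruct (locally_open_unit x Hx) as [d1 H1].
destruct (locally_open_unit t Ht) as [d2 H2].
assert (Hd : 0 < Rmin d1 d2) by (apply Rmin_glb_lt; apply cond_pos).
exists (mkposreal _ Hd). intros [y s] [Hy Hs]. split; simpl.
- apply H1. eapply ball_le; [|exact Hy]. apply Rmin_l.
- apply H2. eapply ball_le; [|exact Hs]. apply Rmin_r.
Qed.

Section Difference.

Context (D : point -> Prop) (u v : point -> R).
Hypothesis HO : open D.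

Lemma dx_minus (p : point) : ex_dx u p -> ex_dx v p ->
  dx (fun q => u q - v q) p = dx u p - dx v p.
Proof. intros Hu Hv. now apply (Derive_minus (fun x => u (x, snd p)) (fun x => v (x, snd p))). Qed.

Lemma dt_minus (p : point) : ex_dt u p -> ex_dt v p ->
  dt (fun q => u q - v q) p = dt u p - dt v p.
Proof. intros Hu Hv. now apply (Derive_minus (fun t => u (fst p, t)) (fun t => v (fst p, t))). Qed.

Lemma ex_dx_minus (p : point) : ex_dx u p -> ex_dx v p -> ex_dx (fun q => u q - v q) p.
Proof. intros Hu Hv. exact (ex_derive_minus (V := R_NormedModule) _ _ _ Hu Hv). Qed.

Lemma ex_dt_minus (p : point) : ex_dt u p -> ex_dt v p -> ex_dt (fun q => u q - v q) p.
Proof. intros Hu Hv. exact (ex_derive_minus (V := R_NormedModule) _ _ _ Hu Hv). Qed.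

Lemma derivatives_local (p : point) : D p -> (forall q, D q -> u q = v q) ->
  (ex_dx u p -> ex_dx v p) /\ (ex_dt u p -> ex_dt v p) /\
  dx u p = dx v p /\ dt u p = dt v p.
Proof.
destruct p as [x t]. intros Hp He.
assert (Hx : locally x (fun y => u (y, t) = v (y, t))).
{ generalize (open_section_x D x t HO Hp). apply filter_imp. intros y Hy. now apply He. }
assert (Ht : locally t (fun s => u (x, s) = v (x, s))).
{ generalize (open_section_t D x t HO Hp). apply filter_imp. intros s Hs. now apply He. }
repeat split.
- intros H. exact (ex_derive_ext_loc _ _ _ Hx H).
- intros H. exact (ex_derive_ext_loc _ _ _ Ht H).
- exact (Derive_ext_loc _ _ _ Hx).
- exact (Derive_ext_loc _ _ _ Ht).
Qed.

Lemma continuous_on_minus_of (w : point -> R) :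
  continuous_on D u -> continuous_on D v -> (forall q, D q -> w q = u q - v q) ->
  continuous_on D w.
Proof.
intros Cu Cv He p Hp. rewrite He by easy.
apply (filterlim_ext_loc (fun q => u q - v q)).
- unfold within. apply filter_forall. intros q Hq. symmetry. now apply He.
- apply (filterlim_Rminus _); [now apply Cu | now apply Cv].
Qed.

End Difference.

Lemma C1_minus_of (D : point -> Prop) (u v w : point -> R) :
  open D -> Defs.C1 D u -> Defs.C1 D v -> (forall q, D q -> w q = u q - v q) -> Defs.C1 D w.
Proof.
intros HO (Eu & Cu & Cux & Cut) (Ev & Cv & Cvx & Cvt) He.
assert (He' : forall q, D q -> u q - v q = w q) by (intros; symmetry; now apply He).
assert (Hloc := fun p Hp => derivatives_local D (fun q => u q - v q) w HO p Hp He').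
split; [|split; [|split]].
- intros p Hp. destruct (Hloc p Hp) as (L1 & L2 & _). destruct (Eu p Hp), (Ev p Hp).
  split; [apply L1; now apply ex_dx_minus | apply L2; now apply ex_dt_minus].
- now apply (continuous_on_minus_of D u v).
- apply (continuous_on_minus_of D (dx u) (dx v)); [easy | easy |].
  intros p Hp. destruct (Hloc p Hp) as (_ & _ & <- & _). destruct (Eu p Hp), (Ev p Hp).
  now apply dx_minus.
- apply (continuous_on_minus_of D (dt u) (dt v)); [easy | easy |].
  intros p Hp. destruct (Hloc p Hp) as (_ & _ & _ & <-). destruct (Eu p Hp), (Ev p Hp).
  now apply dt_minus.
Qed.

Lemma C2_minus (D : point -> Prop) (u v : point -> R) :
  open D -> C2 D u -> C2 D v -> C2 D (fun q => u q - v q).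
Proof.
intros HO (Hu & Hux & Hut) (Hv & Hvx & Hvt). split; [|split].
- now apply (C1_minus_of D u v).
- apply (C1_minus_of D (dx u) (dx v)); try easy.
  intros p Hp. destruct (proj1 Hu p Hp), (proj1 Hv p Hp). now apply dx_minus.
- apply (C1_minus_of D (dt u) (dt v)); try easy.
  intros p Hp. destruct (proj1 Hu p Hp), (proj1 Hv p Hp). now apply dt_minus.
Qed.

Lemma second_derivatives_minus (D : point -> Prop) (u v : point -> R) (p : point) :
  open D -> C2 D u -> C2 D v -> D p ->
  dx (dx (fun q => u q - v q)) p = dx (dx u) p - dx (dx v) p /\
  dt (dt (fun q => u q - v q)) p = dt (dt u) p - dt (dt v) p.
Proof.
intros HO (Hu & Hux & Hut) (Hv & Hvx & Hvt) Hp. split.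
- rewrite <- dx_minus by (apply Hux || apply Hvx; easy).
  apply (derivatives_local D); [easy | easy |].
  intros q Hq. destruct (proj1 Hu q Hq), (proj1 Hv q Hq). now apply dx_minus.
- rewrite <- dt_minus by (apply Hut || apply Hvt; easy).
  apply (derivatives_local D); [easy | easy |].
  intros q Hq. destruct (proj1 Hu q Hq), (proj1 Hv q Hq). now apply dt_minus.
Qed.

Lemma extends_minus_of (D : point -> Prop) (u v w : point -> R) :
  extends_continuously D u -> extends_continuously D v ->
  (forall q, D q -> w q = u q - v q) -> extends_continuously D w.
Proof.
intros (u' & Cu & Eu) (v' & Cv & Ev) He. exists (fun q => u' q - v' q). split.
- now apply (continuous_on_minus_of (closure D) u' v').
- intros p Hp. now rewrite He, Eu, Ev.
Qed.

Lemma C1_up_to_boundary_minus (D : point -> Prop) (u v : point -> R) :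
  C1_up_to_boundary D u -> C1_up_to_boundary D v ->
  C1_up_to_boundary D (fun q => u q - v q).
Proof.
intros (Eu & Xu & Tu) (Ev & Xv & Tv). split; [|split].
- intros p Hp. destruct (Eu p Hp), (Ev p Hp).
  split; [now apply ex_dx_minus | now apply ex_dt_minus].
- apply (extends_minus_of D (dx u) (dx v)); [easy | easy |].
  intros p Hp. destruct (Eu p Hp), (Ev p Hp). now apply dx_minus.
- apply (extends_minus_of D (dt u) (dt v)); [easy | easy |].
  intros p Hp. destruct (Eu p Hp), (Ev p Hp). now apply dt_minus.
Qed.

Lemma caputo_minus (l : R) (g h : R -> R) (t : R) :
  0 < t -> ex_caputo l g t -> ex_caputo l h t ->
  ex_caputo l (fun s => g s - h s) t /\
  caputo l (fun s => g s - h s) t = caputo l g t - caputo l h t.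
Proof.
intros Ht. unfold ex_caputo, caputo. destruct (Req_EM_T l 1) as [_ | _].
- intros Hg Hh. split.
  + exact (ex_derive_minus (V := R_NormedModule) _ _ _ Hg Hh).
  + now apply Derive_minus.
- intros [Dg [lg Ig]] [Dh [lh Ih]].
  assert (I : is_RInt_gen (caputo_kernel l (fun s => g s - h s) t) (at_right 0) (at_left t)
     (minus lg lh)).
  { apply (is_RInt_gen_ext (V := R_NormedModule)
      (fun z => minus (caputo_kernel l g t z) (caputo_kernel l h t z))).
    - apply (Filter_prod _ _ _ (fun a => 0 < a < t / 2) (fun b => t / 2 < b < t)).
      + apply at_right_interval. lra.
      + apply at_left_interval. lra.
      + intros a b Ha Hb z Hz. simpl in Hz. rewrite Rmin_left, Rmax_right in Hz by lra.
        unfold caputo_kernel. rewrite Derive_minus by (apply Dg || apply Dh; lra).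
        change (Derive g z / Rpower (t - z) l - Derive h z / Rpower (t - z) l =
          (Derive g z - Derive h z) / Rpower (t - z) l). unfold Rdiv. ring.
    - now apply (is_RInt_gen_minus (V := R_NormedModule)). }
  split.
  + split; [|now exists (minus lg lh)].
    intros z Hz. exact (ex_derive_minus (V := R_NormedModule) _ _ _ (Dg z Hz) (Dh z Hz)).
  + rewrite (is_RInt_gen_unique (V := R_CompleteNormedModule) _ _ I).
    rewrite (is_RInt_gen_unique (V := R_CompleteNormedModule) _ _ Ig).
    rewrite (is_RInt_gen_unique (V := R_CompleteNormedModule) _ _ Ih).
    change (/ Gamma (1 - l) * (lg - lh) = / Gamma (1 - l) * lg - / Gamma (1 - l) * lh). ring.
Qed.

Lemma nonlocal_integral_minus (n1 n2 p : R -> R) (a b : R) :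
  ex_RInt (fun s => n1 s * p s) a b -> ex_RInt (fun s => n2 s * p s) a b ->
  ex_RInt (fun s => (n1 s - n2 s) * p s) a b /\
  RInt (fun s => (n1 s - n2 s) * p s) a b =
    RInt (fun s => n1 s * p s) a b - RInt (fun s => n2 s * p s) a b.
Proof.
intros H1 H2.
assert (E : forall s, minus (n1 s * p s) (n2 s * p s) = (n1 s - n2 s) * p s).
{ intros s. change (n1 s * p s - n2 s * p s = (n1 s - n2 s) * p s). ring. }
split.
- apply (ex_RInt_ext (V := R_NormedModule) (fun s => minus (n1 s * p s) (n2 s * p s))).
  + intros s _. apply E.
  + now apply (ex_RInt_minus (V := R_NormedModule)).
- rewrite <- (RInt_ext (V := R_CompleteNormedModule) (fun s => minus (n1 s * p s) (n2 s * p s)))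
    by (intros s _; apply E).
  now apply (RInt_minus (V := R_CompleteNormedModule)).
Qed.

Definition homogeneous (d : data) : data :=
  Data (lam d) (gamma1 d) (gamma2 d) (gamma3 d) (sigma1 d) (sigma2 d) (sigma3 d)
    (alpha1 d) (alpha2 d) (alpha3 d) (beta1 d) (beta2 d) (beta3 d)
    (P1 d) (P2 d) (P3 d) (fun _ => 0).

Lemma admissible_curves (d : data) :
  admissible d -> positive_curve (gamma1 d) /\ positive_curve (gamma2 d) /\
    positive_curve (fun s => - gamma3 d s).
Proof.
intros (_ & H1 & H2 & H3 & Ht & _). repeat split.
- apply H1.
- apply H1.
- apply H1.
- apply H1.
- apply H1.
- intros s Hs. destruct (Ht s Hs) as ((H & _) & _). simpl in H. lra.
- apply H2.
- apply H2.
- apply H2.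
- apply H2.
- apply H2.
- intros s Hs. destruct (Ht s Hs) as (_ & (H & _) & _). simpl in H. lra.
- apply (curve_function_opp _ H3).
- apply (curve_function_opp _ H3).
- apply (curve_function_opp _ H3).
- apply (curve_function_opp _ H3).
- apply (curve_function_opp _ H3).
- intros s Hs. destruct (Ht s Hs) as (_ & _ & (H & _)). simpl in H. lra.
Qed.

Lemma Omega3_turn (d : data) (p : point) :
  region (fun s => - gamma3 d s) p <-> Omega3 d (turn p).
Proof. unfold region, Omega3, turn. simpl. lra. Qed.

Lemma open_Omega1 (d : data) : admissible d -> open (Omega1 d).
Proof. intros hd. apply region_open, (admissible_curves d hd). Qed.

Lemma open_Omega2 (d : data) : admissible d -> open (Omega2 d).
Proof.
intros hd. apply (open_preimage swap (region (gamma2 d))); [apply continuous_swap|].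
apply region_open, (admissible_curves d hd).
Qed.

Lemma open_Omega3 (d : data) : admissible d -> open (Omega3 d).
Proof.
intros hd.
assert (H : open (fun p => region (fun s => - gamma3 d s) (snd p, 1 - fst p))).
{ apply (open_preimage (fun p => (snd p, 1 - fst p))).
  - intros [x t]. apply (filterlim_point (locally (x, t)) snd (fun q => 1 - fst q));
      [apply continuous_snd|].
    apply (filterlim_Rminus _); [apply filterlim_const | apply continuous_fst].
  - apply region_open, (admissible_curves d hd). }
intros p Hp. assert (Hp' : region (fun s => - gamma3 d s) (snd p, 1 - fst p)).
{ revert Hp. unfold region, Omega3. simpl. lra. }
generalize (H p Hp'). apply filter_imp. intros q.
unfold region, Omega3. simpl. lra.
Qed.

Lemma Omega1_below (d : data) (x : R) :
  admissible d -> 0 < x < 1 -> at_left 0 (fun t => Omega1 d (x, t)).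
Proof.
intros hd Hx. destruct (region_box (gamma1 d) x) as [e He];
  [apply (admissible_curves d hd) | easy |].
generalize (at_left_interval (- e) 0 ltac:(generalize (cond_pos e); lra)).
apply filter_imp. intros t Ht. apply He; [|easy].
rewrite Rminus_diag, Rabs_R0. apply cond_pos.
Qed.

Lemma Omega2_left (d : data) (t : R) :
  admissible d -> 0 < t < 1 -> at_left 0 (fun x => Omega2 d (x, t)).
Proof.
intros hd Ht. destruct (region_box (gamma2 d) t) as [e He];
  [apply (admissible_curves d hd) | easy |].
generalize (at_left_interval (- e) 0 ltac:(generalize (cond_pos e); lra)).
apply filter_imp. intros x Hx. apply (He t x); [|easy].
rewrite Rminus_diag, Rabs_R0. apply cond_pos.
Qed.

Lemma Omega3_right (d : data) (t : R) :
  admissible d -> 0 < t < 1 -> at_right 1 (fun x => Omega3 d (x, t)).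
Proof.
intros hd Ht. destruct (region_box (fun s => - gamma3 d s) t) as [e He];
  [apply (admissible_curves d hd) | easy |].
generalize (at_right_interval 1 (1 + e) ltac:(generalize (cond_pos e); lra)).
apply filter_imp. intros x Hx.
assert (H : region (fun s => - gamma3 d s) (t, 1 - x)).
{ apply He; [|lra]. rewrite Rminus_diag, Rabs_R0. apply cond_pos. }
apply Omega3_turn in H. unfold turn in H. simpl in H.
now replace (1 - (1 - x)) with x in H by ring.
Qed.

Lemma Omega0_above (x : R) : 0 < x < 1 -> at_right 0 (fun t => Omega0 (x, t)).
Proof.
intros Hx. generalize (at_right_interval 0 1 Rlt_0_1). apply filter_imp.
intros t Ht. now split.
Qed.

Lemma Omega0_right (t : R) : 0 < t < 1 -> at_right 0 (fun x => Omega0 (x, t)).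
Proof.
intros Ht. generalize (at_right_interval 0 1 Rlt_0_1). apply filter_imp.
intros x Hx. now split.
Qed.

Lemma Omega0_left (t : R) : 0 < t < 1 -> at_left 1 (fun x => Omega0 (x, t)).
Proof.
intros Ht. generalize (at_left_interval 0 1 Rlt_0_1). apply filter_imp.
intros x Hx. now split.
Qed.

Lemma limit_minus_of {T : Type} (F : (T -> Prop) -> Prop) {FF : Filter F}
    (f g h : T -> R) (a b c : R) :
  filterlim f F (locally a) -> filterlim g F (locally b) ->
  F (fun r => h r = f r - g r) -> c = a - b -> filterlim h F (locally c).
Proof.
intros Hf Hg Hh ->. apply (filterlim_ext_loc (fun r => f r - g r)).
- revert Hh. apply filter_imp. now intros r ->.
- now apply (filterlim_Rminus _).
Qed.

Lemma difference_solves (d : data) (u v : point -> R) :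
  admissible d -> solves_problem_S d u -> solves_problem_S d v ->
  solves_problem_S (homogeneous d) (fun p => u p - v p).
Proof.
intros hd
  ((uC & uS & uxx & uCap & u1 & u2 & u3) & uB0 & uB1 & uB2 & uB3 & (uE0 & uE) & (uN1 & uN2 & uN3) &
    uA & uB & (nu1 & uT1) & (nu2 & uT2) & (nu3 & uT3))
  ((vC & vS & vxx & vCap & v1 & v2 & v3) & vB0 & vB1 & vB2 & vB3 & (vE0 & vE) & (vN1 & vN2 & vN3) &
    vA & vB & (mu1 & vT1) & (mu2 & vT2) & (mu3 & vT3)).
assert (O1 := open_Omega1 d hd). assert (O2 := open_Omega2 d hd).
assert (O3 := open_Omega3 d hd). assert (O0 := open_Omega0).
set (w := fun p => u p - v p).
assert (Hdx : forall D, C1_up_to_boundary D u -> C1_up_to_boundary D v ->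
  forall p, D p -> dx w p = dx u p - dx v p /\ dt w p = dt u p - dt v p).
{ intros D (Hu & _) (Hv & _) p Hp. destruct (Hu p Hp), (Hv p Hp).
  split; [now apply dx_minus | now apply dt_minus]. }
assert (H0 := Hdx _ uB0 vB0). assert (H1 := Hdx _ uB1 vB1).
assert (H2 := Hdx _ uB2 vB2). assert (H3 := Hdx _ uB3 vB3).
assert (Hxx : forall p, Omega0 p -> ex_dx (dx w) p /\ dx (dx w) p = dx (dx u) p - dx (dx v) p).
{ intros p Hp. destruct (uS p Hp) as (_ & Eu & _). destruct (vS p Hp) as (_ & Ev & _).
  assert (L := derivatives_local Omega0 (fun q => dx u q - dx v q) (dx w) O0 p Hp
    (fun q Hq => eq_sym (proj1 (H0 q Hq)))).
  destruct L as (L1 & _ & L2 & _). rewrite <- L2. split.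
  - apply L1. now apply ex_dx_minus.
  - now apply dx_minus. }
assert (Hcap : forall p, Omega0 p -> ex_caputo_t (lam d) w p /\
   caputo_t (lam d) w p = caputo_t (lam d) u p - caputo_t (lam d) v p).
{ intros p Hp. apply caputo_minus; [apply Hp | now apply uS | now apply vS]. }
assert (Hpm : forall D, (forall p, D p -> dx w p = dx u p - dx v p /\ dt w p = dt u p - dt v p) ->
   forall p, D p -> dplus w p = dplus u p - dplus v p /\ dminus w p = dminus u p - dminus v p).
{ intros D HD p Hp. destruct (HD p Hp) as [E1 E2]. unfold dplus, dminus. rewrite E1, E2.
  split; ring. }
assert (Hlim : forall D (f g h : point -> R) p a b, limit_within D f p a -> limit_within D g p b ->
   (forall q, D q -> h q = f q - g q) -> limit_within D h p (a - b)).
{ intros D f g h p a b Hf Hg Hh. apply (limit_minus_of _ f g h a b); try easy.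
  unfold within. apply filter_forall. exact Hh. }
split; [|split; [|split; [|split; [|split; [|split; [|split; [|split; [|split; [|split; [|split]]]]]]]]]].
- split; [|split; [|split; [|split; [|split; [|split]]]]].
  + now apply (continuous_on_minus_of _ u v).
  + intros p Hp. split; [|split; [now apply Hxx | now apply Hcap]].
    apply ex_dx_minus; [now apply uS | now apply vS].
  + apply (continuous_on_minus_of _ (dx (dx u)) (dx (dx v))); [easy | easy |].
    intros p Hp. now apply Hxx.
  + apply (continuous_on_minus_of _ (caputo_t (lam d) u) (caputo_t (lam d) v)); [easy | easy |].
    intros p Hp. now apply Hcap.
  + now apply C2_minus.
  + now apply C2_minus.
  + now apply C2_minus.
- now apply C1_up_to_boundary_minus.
- now apply C1_up_to_boundary_minus.
- now apply C1_up_to_boundary_minus.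
- now apply C1_up_to_boundary_minus.
- split.
  + intros p Hp. change (dx (dx w) p - caputo_t (lam d) w p = 0).
    rewrite (proj2 (Hxx p Hp)), (proj2 (Hcap p Hp)).
    generalize (uE0 p Hp) (vE0 p Hp). lra.
  + intros p Hp. change (dx (dx w) p - dt (dt w) p = 0).
    generalize (uE p Hp) (vE p Hp). intros E1 E2.
    destruct Hp as [Hp | [Hp | Hp]].
    * destruct (second_derivatives_minus _ u v p O1 u1 v1 Hp) as [F1 F2].
      unfold w. rewrite F1, F2. lra.
    * destruct (second_derivatives_minus _ u v p O2 u2 v2 Hp) as [F1 F2].
      unfold w. rewrite F1, F2. lra.
    * destruct (second_derivatives_minus _ u v p O3 u3 v3 Hp) as [F1 F2].
      unfold w. rewrite F1, F2. lra.
- split; [|split].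
  + intros s p q Hs Hp Hq.
    destruct (uN1 s p q Hs Hp Hq) as (a & b & Ha & Hb & E).
    destruct (vN1 s p q Hs Hp Hq) as (a' & b' & Ha' & Hb' & E').
    exists (a - a'), (b - b'). split; [|split].
    * apply (Hlim _ _ _ _ _ _ _ Ha Ha'). intros r Hr. now apply (Hpm _ H1).
    * apply (Hlim _ _ _ _ _ _ _ Hb Hb'). intros r Hr. now apply (Hpm _ H1).
    * rewrite E, E'. simpl. ring.
  + intros s p q Hs Hp Hq.
    destruct (uN2 s p q Hs Hp Hq) as (a & b & Ha & Hb & E).
    destruct (vN2 s p q Hs Hp Hq) as (a' & b' & Ha' & Hb' & E').
    exists (a - a'), (b - b'). split; [|split].
    * apply (Hlim _ _ _ _ _ _ _ Ha Ha'). intros r Hr. now apply (Hpm _ H2).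
    * apply (Hlim _ _ _ _ _ _ _ Hb Hb'). intros r Hr. now apply (Hpm _ H2).
    * rewrite E, E'. simpl. ring.
  + intros s p q Hs Hp Hq.
    destruct (uN3 s p q Hs Hp Hq) as (a & b & Ha & Hb & E).
    destruct (vN3 s p q Hs Hp Hq) as (a' & b' & Ha' & Hb' & E').
    exists (a - a'), (b - b'). split; [|split].
    * apply (Hlim _ _ _ _ _ _ _ Ha Ha'). intros r Hr. now apply (Hpm _ H3).
    * apply (Hlim _ _ _ _ _ _ _ Hb Hb'). intros r Hr. now apply (Hpm _ H3).
    * rewrite E, E'. simpl. ring.
- unfold w. rewrite uA, vA. ring.
- unfold w. rewrite uB, vB. ring.
- exists (fun x => nu1 x - mu1 x). intros x Hx.
  destruct (uT1 x Hx) as (Ln & In & Lc). destruct (vT1 x Hx) as (Lm & Im & Lc').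
  destruct (nonlocal_integral_minus nu1 mu1 (P1 d x) x 1 In Im) as [I E].
  split; [|split; [exact I|]].
  + apply (limit_minus_of _ _ _ _ _ _ _ Ln Lm); [|easy].
    generalize (Omega1_below d x hd Hx). apply filter_imp. intros t Ht. now apply H1.
  + apply (limit_minus_of _ _ _ _ _ _ _ Lc Lc').
    * generalize (Omega0_above x Hx). apply filter_imp. intros t Ht. now apply Hcap.
    * simpl. rewrite E. ring.
- exists (fun x => nu2 x - mu2 x). intros t Ht.
  destruct (uT2 t Ht) as (Ln & In & Lc). destruct (vT2 t Ht) as (Lm & Im & Lc').
  destruct (nonlocal_integral_minus nu2 mu2 (P2 d t) t 1 In Im) as [I E].
  split; [|split; [exact I|]].
  + apply (limit_minus_of _ _ _ _ _ _ _ Ln Lm); [|easy].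
    generalize (Omega2_left d t hd Ht). apply filter_imp. intros x Hx. now apply H2.
  + apply (limit_minus_of _ _ _ _ _ _ _ Lc Lc').
    * generalize (Omega0_right t Ht). apply filter_imp. intros x Hx. now apply H0.
    * simpl. rewrite E. ring.
- exists (fun x => nu3 x - mu3 x). intros t Ht.
  destruct (uT3 t Ht) as (Ln & In & Lc). destruct (vT3 t Ht) as (Lm & Im & Lc').
  destruct (nonlocal_integral_minus nu3 mu3 (P3 d t) t 1 In Im) as [I E].
  split; [|split; [exact I|]].
  + apply (limit_minus_of _ _ _ _ _ _ _ Ln Lm); [|easy].
    generalize (Omega3_right d t hd Ht). apply filter_imp. intros x Hx. now apply H3.
  + apply (limit_minus_of _ _ _ _ _ _ _ Lc Lc').
    * generalize (Omega0_left t Ht). apply filter_imp. intros x Hx. now apply H0.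
    * simpl. rewrite E. ring.
Qed.

(** * Traces on the sides and the hyperbolic domains *)

Lemma closure_of (D : point -> Prop) (p : point) : D p -> closure D p.
Proof. intros Hp eps. exists p. split; [apply ball_center | exact Hp]. Qed.

Lemma closure_image (D D' : point -> Prop) (T : point -> point) (p : point) :
  continuous T p -> (forall q, D q -> D' (T q)) -> closure D p -> closure D' (T p).
Proof.
intros HT HD Hp eps.
destruct (proj1 (filterlim_locally _ _) HT eps) as [del Hdel].
destruct (Hp del) as (q & Hb & Hq). exists (T q). split; [now apply Hdel | now apply HD].
Qed.

Lemma region_zero (g : R -> R) (W : point -> R) :
  positive_curve g ->
  (forall x t, region g (x, t) -> is_derive (fun s => W (x, s)) t 0) ->
  (forall x, 0 < x < 1 -> filterlim (fun t => W (x, t)) (at_left 0) (locally 0)) ->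
  forall x t, region g (x, t) -> W (x, t) = 0.
Proof.
intros Hg HW Hl x t Hxt. assert (Hx := proj1 Hxt). assert (Ht := proj2 Hxt). simpl in Hx, Ht.
assert (Hc : forall b, t <= b < 0 -> W (x, b) = W (x, t)).
{ intros b Hb. symmetry. apply (constant_of_derive (fun s => W (x, s))); [lra | |].
  - intros y Hy. apply HW. split; simpl; lra.
  - intros y Hy. apply continuous_of_is_derive with 0, HW. split; simpl; lra. }
symmetry. apply (filterlim_locally_unique (fun s => W (x, s)) (F := at_left 0)); [now apply Hl|].
apply (filterlim_ext_loc (fun _ => W (x, t))); [|apply filterlim_const].
generalize (at_left_interval t 0 ltac:(lra)). apply filter_imp. intros b Hb.
symmetry. apply Hc. lra.
Qed.

Section Sides.

Context (d : data) (w : point -> R).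
Hypothesis hd : admissible d.
Hypothesis hw : solves_problem_S d w.
Hypothesis hrhs : forall p, rhs d p = 0.

Lemma wave_equation (p : point) :
  Omega1 d p \/ Omega2 d p \/ Omega3 d p -> dx (dx w) p = dt (dt w) p.
Proof.
intros Hp. destruct hw as (_ & _ & _ & _ & _ & (_ & He) & _).
specialize (He p Hp). rewrite hrhs in He. lra.
Qed.

Lemma limit_inside (a b : R) {T : Type} (F : (T -> Prop) -> Prop) {FF : Filter F}
    (f g : T -> R) :
  Omega d (a, b) -> filterlim f F (locally a) -> filterlim g F (locally b) ->
  F (fun r => Omega d (f r, g r)) ->
  filterlim (fun r => w (f r, g r)) F (locally (w (a, b))).
Proof.
intros Hp Hf Hg HF. destruct hw as ((Cw & _) & _).
apply (limit_along_path (closure (Omega d)) w a b _ F); try easy.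
- apply Cw. now apply closure_of.
- revert HF. apply filter_imp. intros r. apply closure_of.
Qed.

Lemma AB_value_limit (x : R) : 0 < x < 1 ->
  filterlim (fun t => w (x, t)) (at_left 0) (locally (w (x, 0))).
Proof.
intros Hx. apply (limit_inside x 0 (at_left 0) (fun _ => x) (fun t => t)).
- unfold Omega, segAB. simpl. tauto.
- apply filterlim_const.
- intros P HP. now apply filter_le_within.
- generalize (Omega1_below d x hd Hx). apply filter_imp. unfold Omega. tauto.
Qed.

Lemma AD_value_limit (t : R) : 0 < t < 1 ->
  filterlim (fun x => w (x, t)) (at_left 0) (locally (w (0, t))).
Proof.
intros Ht. apply (limit_inside 0 t (at_left 0) (fun x => x) (fun _ => t)).
- unfold Omega, segAD. simpl. tauto.
- intros P HP. now apply filter_le_within.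
- apply filterlim_const.
- generalize (Omega2_left d t hd Ht). apply filter_imp. unfold Omega. tauto.
Qed.

Lemma BC_value_limit (t : R) : 0 < t < 1 ->
  filterlim (fun x => w (1 - x, t)) (at_left 0) (locally (w (1, t))).
Proof.
intros Ht. apply (limit_inside 1 t (at_left 0) (fun x => 1 - x) (fun _ => t)).
- unfold Omega, segBC. simpl. tauto.
- apply (filterlim_ext (fun r => 1 + -1 * r)); [intros; ring|].
  apply (affine_limit 1 (-1) 0); [apply filter_le_within | ring].
- apply filterlim_const.
- destruct (region_box (fun s => - gamma3 d s) t) as [e He];
    [apply (admissible_curves d hd) | easy |].
  generalize (at_left_interval (- e) 0 ltac:(generalize (cond_pos e); lra)).
  apply filter_imp. intros x Hx.
  assert (H : region (fun s => - gamma3 d s) (t, x)).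
  { apply He; [|lra]. rewrite Rminus_diag, Rabs_R0. apply cond_pos. }
  apply Omega3_turn in H. unfold turn in H. simpl in H. unfold Omega. tauto.
Qed.

Lemma dminus1_constant (x t m : R) : Omega1 d (x, t) ->
  is_derive (fun r => dminus w (x + m * r, t + m * r)) 0 0.
Proof.
intros Hp. apply (dminus_constant (Omega1 d)); [now apply open_Omega1 | apply hw | | easy].
apply wave_equation. tauto.
Qed.

Lemma dplus1_constant (x t m n : R) : n = - m -> Omega1 d (x, t) ->
  is_derive (fun r => dplus w (x + m * r, t + n * r)) 0 0.
Proof.
intros -> Hp. apply (dplus_constant (Omega1 d)); [now apply open_Omega1 | apply hw | | easy].
apply wave_equation. tauto.
Qed.

Lemma dminus2_constant (x t m : R) : Omega2 d (x, t) ->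
  is_derive (fun r => dminus w (x + m * r, t + m * r)) 0 0.
Proof.
intros Hp. apply (dminus_constant (Omega2 d)); [now apply open_Omega2 | apply hw | | easy].
apply wave_equation. tauto.
Qed.

Lemma dplus2_constant (x t m n : R) : n = - m -> Omega2 d (x, t) ->
  is_derive (fun r => dplus w (x + m * r, t + n * r)) 0 0.
Proof.
intros -> Hp. apply (dplus_constant (Omega2 d)); [now apply open_Omega2 | apply hw | | easy].
apply wave_equation. tauto.
Qed.

Lemma dminus3_constant (x t m n : R) : n = - m -> Omega3 d (1 - t, x) ->
  is_derive (fun r => dminus w (1 - (t + n * r), x + m * r)) 0 0.
Proof.
intros -> Hp.
apply (is_derive_ext (fun r => dminus w ((1 - t) + m * r, x + m * r))).
- intros r. apply f_equal. f_equal; ring.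
- apply (dminus_constant (Omega3 d)); [now apply open_Omega3 | apply hw | | easy].
  apply wave_equation. tauto.
Qed.

Lemma dplus3_constant (x t m : R) : Omega3 d (1 - t, x) ->
  is_derive (fun r => dplus w (1 - (t + m * r), x + m * r)) 0 0.
Proof.
intros Hp.
apply (is_derive_ext (fun r => dplus w ((1 - t) + (- m) * r, x + - (- m) * r))).
- intros r. apply f_equal. f_equal; ring.
- apply (dplus_constant (Omega3 d)); [now apply open_Omega3 | apply hw | | easy].
  apply wave_equation. tauto.
Qed.

(** The characteristic relation on AB, in terms of the first derivatives seen from
    below; [lx] is also the slope of the common trace. *)
Lemma AB_traces (s : R) : 0 < s < 1 ->
  exists lx lt, limit_within (Omega1 d) (dx w) (s, 0) lx /\
    limit_within (Omega1 d) (dt w) (s, 0) lt /\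
    lx - lt = sigma1 d * (lx + lt) /\ is_derive (fun x => w (x, 0)) s lx.
Proof.
intros Hs. destruct (admissible_curves d hd) as (Hg & _).
assert (hw' := hw). destruct hw' as (_ & _ & (Hex & Xx & Xt) & _ & _ & _ & (HN & _) & _).
assert (Hcl : closure (Omega1 d) (s, 0)) by now apply (region_closure (gamma1 d)).
destruct (extends_limit _ _ _ Xx Hcl) as [lx Hlx].
destruct (extends_limit _ _ _ Xt Hcl) as [lt Hlt].
exists lx, lt. split; [easy | split; [easy | split]].
- apply (characteristic_traces (gamma1 d) (dplus w) (dminus w) (sigma1 d) s); try easy.
  + intros x t Hp. now apply dminus1_constant.
  + intros x t Hp. apply dplus1_constant; [ring | easy].
  + intros p q Hp Ep Hq Eq. now apply (HN s p q).
  + now apply limit_within_plus.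
  + now apply limit_within_minus.
- apply (tangential_derivative (gamma1 d) w (dx w)); try easy.
  + intros x t Hp. apply Derive_correct. exact (proj1 (Hex _ Hp)).
  + apply AB_value_limit.
Qed.

Lemma AD_traces (s : R) : 0 < s < 1 ->
  exists lx lt, limit_within (Omega2 d) (dx w) (0, s) lx /\
    limit_within (Omega2 d) (dt w) (0, s) lt /\
    lx - lt = sigma2 d * (lx + lt) /\ is_derive (fun t => w (0, t)) s lt.
Proof.
intros Hs. destruct (admissible_curves d hd) as (_ & Hg & _).
assert (hw' := hw). destruct hw' as (_ & _ & _ & (Hex & Xx & Xt) & _ & _ & (_ & HN & _) & _).
assert (Hcl : closure (Omega2 d) (0, s)).
{ apply (closure_image (region (gamma2 d)) (Omega2 d) swap (s, 0));
    [apply continuous_swap | now intros q | now apply region_closure]. }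
destruct (extends_limit _ _ _ Xx Hcl) as [lx Hlx].
destruct (extends_limit _ _ _ Xt Hcl) as [lt Hlt].
exists lx, lt. split; [easy | split; [easy | split]].
- assert (Hpull : forall v p l, limit_within (Omega2 d) v (swap p) l ->
     limit_within (region (gamma2 d)) (fun q => v (swap q)) p l).
  { intros v p l. apply limit_within_comp; [apply continuous_swap | now intros q]. }
  apply (characteristic_traces (gamma2 d) (fun q => dplus w (swap q))
    (fun q => dminus w (swap q)) (sigma2 d) s); try easy.
  + intros x t Hp. now apply (dminus2_constant t x).
  + intros x t Hp. apply (dplus2_constant t x); [ring | easy].
  + intros p q Hp Ep Hq Eq.
    destruct (HN s (swap p) (swap q) Hs) as (a & b & Ha & Hb & E).
    * split; [exact Hp | exact Ep].
    * split; [exact Hq | rewrite <- Eq; apply Rplus_comm].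
    * exists a, b. repeat split; [now apply Hpull | now apply Hpull | exact E].
  + apply Hpull. now apply limit_within_plus.
  + apply Hpull. now apply limit_within_minus.
- apply (tangential_derivative (gamma2 d) (fun q => w (swap q)) (fun q => dt w (swap q))); try easy.
  + intros x t Hp. apply (Derive_correct (fun y => w (t, y))). exact (proj2 (Hex (t, x) Hp)).
  + apply AD_value_limit.
  + apply (limit_within_comp (region (gamma2 d)) (Omega2 d) swap (dt w));
      [apply continuous_swap | now intros q | exact Hlt].
Qed.

Lemma BC_traces (s : R) : 0 < s < 1 ->
  exists lx lt, limit_within (Omega3 d) (dx w) (1, s) lx /\
    limit_within (Omega3 d) (dt w) (1, s) lt /\
    lx + lt = sigma3 d * (lx - lt) /\ is_derive (fun t => w (1, t)) s lt.
Proof.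
intros Hs. destruct (admissible_curves d hd) as (_ & _ & Hg).
set (g := fun s => - gamma3 d s) in *.
assert (hw' := hw). destruct hw' as (_ & _ & _ & _ & (Hex & Xx & Xt) & _ & (_ & _ & HN) & _).
assert (Hin : forall q, region g q -> Omega3 d (turn q)) by (intros q; apply Omega3_turn).
assert (E1 : (1, s) = turn (s, 0)) by (unfold turn; simpl; f_equal; ring).
assert (Hcl : closure (Omega3 d) (1, s)).
{ rewrite E1. apply (closure_image (region g));
    [apply continuous_turn | easy | now apply region_closure]. }
destruct (extends_limit _ _ _ Xx Hcl) as [lx Hlx].
destruct (extends_limit _ _ _ Xt Hcl) as [lt Hlt].
assert (Hpull : forall v p l, limit_within (Omega3 d) v (turn p) l ->
   limit_within (region g) (fun q => v (turn q)) p l).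
{ intros v p l. apply limit_within_comp; [apply continuous_turn | easy]. }
exists lx, lt. split; [easy | split; [easy | split]].
- rewrite E1 in Hlx, Hlt.
  apply (characteristic_traces g (fun q => dminus w (turn q))
    (fun q => dplus w (turn q)) (sigma3 d) s); try easy.
  + intros x t Hp. apply (dplus3_constant x t). exact (Hin (x, t) Hp).
  + intros x t Hp. apply (dminus3_constant x t); [ring | now apply (Hin (x, t))].
  + intros p q [Hp1 Hp2] Ep [Hq1 Hq2] Eq. unfold g in Hp2, Hq2.
    destruct (HN s (turn p) (turn q) Hs) as (a & b & Ha & Hb & E).
    * split; [split; [exact Hp1 | simpl; lra] | simpl; lra].
    * split; [split; [exact Hq1 | simpl; lra] | simpl; lra].
    * exists a, b. repeat split; [now apply Hpull | now apply Hpull | exact E].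
  + apply Hpull. now apply limit_within_minus.
  + apply Hpull. now apply limit_within_plus.
- rewrite E1 in Hlt.
  apply (tangential_derivative g (fun q => w (turn q)) (fun q => dt w (turn q))); try easy.
  + intros x t Hp. apply (Derive_correct (fun y => w (1 - t, y))).
    exact (proj2 (Hex (1 - t, x) (Hin _ Hp))).
  + apply BC_value_limit.
  + now apply Hpull.
Qed.

Lemma derivative_of_zero (f : R -> R) (s l : R) :
  0 < s < 1 -> (forall x, 0 < x < 1 -> f x = 0) -> is_derive f s l -> l = 0.
Proof.
intros Hs Hf Hd. rewrite <- (is_derive_unique _ _ _ Hd).
rewrite (Derive_ext_loc f (fun _ => 0)); [apply Derive_const|].
generalize (locally_open_unit s Hs). apply filter_imp. exact Hf.
Qed.

(** A zero trace has zero slope; the characteristic relation then gives a zero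
    normal derivative, and the characteristics carry both zeros inside. *)
Lemma vanishing1 :
  sigma1 d <> -1 -> (forall x, 0 < x < 1 -> w (x, 0) = 0) -> forall p, Omega1 d p -> w p = 0.
Proof.
intros Hsig H0. destruct (admissible_curves d hd) as (Hg & _).
assert (Htr : forall s, 0 < s < 1 -> limit_within (Omega1 d) (dplus w) (s, 0) 0 /\
   limit_within (Omega1 d) (dminus w) (s, 0) 0).
{ intros s Hs. destruct (AB_traces s Hs) as (lx & lt & Hx & Ht & E & Hd).
  assert (lx = 0) by now apply (derivative_of_zero (fun x => w (x, 0)) s).
  assert (lt = 0).
  { assert (Hm : lt * (1 + sigma1 d) = 0) by (subst lx; lra).
    apply Rmult_integral in Hm. destruct Hm; [easy | lra]. }
  subst.
  assert (Lp := limit_within_plus _ _ _ _ _ _ Hx Ht). rewrite Rplus_0_r in Lp.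
  assert (Lm := limit_within_minus _ _ _ _ _ _ Hx Ht). rewrite Rminus_0_r in Lm.
  split; [exact Lp | exact Lm]. }
assert (hw' := hw). destruct hw' as (_ & _ & (Hex & _) & _).
intros [x t]. apply (region_zero (gamma1 d) w); [easy | |].
- intros y s Hp.
  assert (Z1 : dplus w (y, s) = 0).
  { apply (characteristic_zero (gamma1 d) (dplus w) (-1)); try easy; [tauto | | intros; now apply Htr].
    intros a b Hab. apply dplus1_constant; [ring | easy]. }
  assert (Z2 : dminus w (y, s) = 0).
  { apply (characteristic_zero (gamma1 d) (dminus w) 1); try easy; [tauto | | intros; now apply Htr].
    intros a b Hab. now apply dminus1_constant. }
  unfold dplus, dminus in Z1, Z2.
  replace 0 with (dt w (y, s)) by lra.
  apply Derive_correct. exact (proj2 (Hex _ Hp)).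
- intros y Hy. assert (L := AB_value_limit y Hy). rewrite (H0 y Hy) in L. exact L.
Qed.

Lemma vanishing2 :
  sigma2 d <> 1 -> (forall t, 0 < t < 1 -> w (0, t) = 0) -> forall p, Omega2 d p -> w p = 0.
Proof.
intros Hsig H0. destruct (admissible_curves d hd) as (_ & Hg & _).
assert (Htr : forall s, 0 < s < 1 ->
   limit_within (region (gamma2 d)) (fun q => dplus w (swap q)) (s, 0) 0 /\
   limit_within (region (gamma2 d)) (fun q => dminus w (swap q)) (s, 0) 0).
{ intros s Hs. destruct (AD_traces s Hs) as (lx & lt & Hx & Ht & E & Hd).
  assert (lt = 0) by now apply (derivative_of_zero (fun t => w (0, t)) s).
  assert (lx = 0).
  { assert (Hm : lx * (1 - sigma2 d) = 0) by (subst lt; lra).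
    apply Rmult_integral in Hm. destruct Hm; [easy | lra]. }
  subst.
  assert (Lp := limit_within_plus _ _ _ _ _ _ Hx Ht). rewrite Rplus_0_r in Lp.
  assert (Lm := limit_within_minus _ _ _ _ _ _ Hx Ht). rewrite Rminus_0_r in Lm.
  split; (apply (limit_within_comp _ (Omega2 d)); [apply continuous_swap | now intros q | easy]). }
assert (hw' := hw). destruct hw' as (_ & _ & _ & (Hex & _) & _).
intros [t x]. apply (region_zero (gamma2 d) (fun q => w (swap q))); [easy | |].
- intros y s Hp.
  assert (Z1 : dplus w (swap (y, s)) = 0).
  { apply (characteristic_zero (gamma2 d) (fun q => dplus w (swap q)) (-1)); try easy;
      [tauto | | intros; now apply Htr].
    intros a b Hab. apply (dplus2_constant b a); [ring | easy]. }
  assert (Z2 : dminus w (swap (y, s)) = 0).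
  { apply (characteristic_zero (gamma2 d) (fun q => dminus w (swap q)) 1); try easy;
      [tauto | | intros; now apply Htr].
    intros a b Hab. now apply (dminus2_constant b a). }
  unfold dplus, dminus in Z1, Z2.
  replace 0 with (dx w (s, y)) by (unfold swap in Z1, Z2; simpl in Z1, Z2; lra).
  apply (Derive_correct (fun r => w (r, y))). exact (proj1 (Hex (s, y) Hp)).
- intros y Hy. assert (L := AD_value_limit y Hy). rewrite (H0 y Hy) in L. exact L.
Qed.

Lemma vanishing3 :
  sigma3 d <> 1 -> (forall t, 0 < t < 1 -> w (1, t) = 0) -> forall p, Omega3 d p -> w p = 0.
Proof.
intros Hsig H0. destruct (admissible_curves d hd) as (_ & _ & Hg).
set (g := fun s => - gamma3 d s) in *.
assert (Hin : forall q, region g q -> Omega3 d (turn q)) by (intros q; apply Omega3_turn).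
assert (Htr : forall s, 0 < s < 1 ->
   limit_within (region g) (fun q => dplus w (turn q)) (s, 0) 0 /\
   limit_within (region g) (fun q => dminus w (turn q)) (s, 0) 0).
{ intros s Hs. destruct (BC_traces s Hs) as (lx & lt & Hx & Ht & E & Hd).
  assert (lt = 0) by now apply (derivative_of_zero (fun t => w (1, t)) s).
  assert (lx = 0).
  { assert (Hm : lx * (1 - sigma3 d) = 0) by (subst lt; lra).
    apply Rmult_integral in Hm. destruct Hm; [easy | lra]. }
  assert (E1 : (1, s) = turn (s, 0)) by (unfold turn; simpl; f_equal; ring).
  rewrite E1 in Hx, Ht.
  subst.
  assert (Lp := limit_within_plus _ _ _ _ _ _ Hx Ht). rewrite Rplus_0_r in Lp.
  assert (Lm := limit_within_minus _ _ _ _ _ _ Hx Ht). rewrite Rminus_0_r in Lm.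
  split; (apply (limit_within_comp _ (Omega3 d)); [apply continuous_turn | easy | easy]). }
assert (hw' := hw). destruct hw' as (_ & _ & _ & _ & (Hex & _) & _).
assert (HZ : forall x t, region g (x, t) -> w (turn (x, t)) = 0).
{ apply (region_zero g (fun q => w (turn q))); [easy | |].
  - intros y s Hp.
    assert (Z1 : dplus w (turn (y, s)) = 0).
    { apply (characteristic_zero g (fun q => dplus w (turn q)) 1); try easy;
        [tauto | | intros; now apply Htr].
      intros a b Hab. apply (dplus3_constant a b). exact (Hin (a, b) Hab). }
    assert (Z2 : dminus w (turn (y, s)) = 0).
    { apply (characteristic_zero g (fun q => dminus w (turn q)) (-1)); try easy;
        [tauto | | intros; now apply Htr].
      intros a b Hab. apply (dminus3_constant a b); [ring | now apply (Hin (a, b))]. }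
    unfold dplus, dminus in Z1, Z2.
    replace 0 with (-1 * dx w (turn (y, s))) by lra.
    apply (is_derive_comp (fun r => w (r, y)) (fun r => 1 - r)).
    + apply (Derive_correct (fun r => w (r, y))). exact (proj1 (Hex (turn (y, s)) (Hin _ Hp))).
    + auto_derive; [easy | ring].
  - intros y Hy. assert (L := BC_value_limit y Hy). rewrite (H0 y Hy) in L. exact L. }
intros [x t] Hp.
replace ((x, t) : point) with (turn (t, 1 - x)).
- apply HZ. apply Omega3_turn.
  replace (turn (t, 1 - x)) with ((x, t) : point); [easy|].
  unfold turn. simpl. f_equal. ring.
- unfold turn. simpl. f_equal. ring.
Qed.

End Sides.

(** * The square *)

Definition clamp_point (p : point) : point := (clamp (fst p), clamp (snd p)).

Lemma closure_square (x t : R) :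
  unit_interval x -> unit_interval t -> closure Omega0 (x, t).
Proof.
intros Hx Ht eps. unfold unit_interval in *.
set (del := Rmin eps 1 / 2).
assert (Hdel : 0 < del /\ del < eps /\ del < 1).
{ unfold del. assert (0 < Rmin eps 1) by (apply Rmin_glb_lt; [apply cond_pos | lra]).
  assert (Rmin eps 1 <= eps) by apply Rmin_l. assert (Rmin eps 1 <= 1) by apply Rmin_r. lra. }
assert (Hin : forall y, 0 <= y <= 1 -> 0 < y + del * (1 / 2 - y) < 1 /\
   Rabs (y + del * (1 / 2 - y) - y) < eps).
{ intros y Hy. split.
  - assert (0 <= (1 - del) * y) by (apply Rmult_le_pos; lra).
    assert (0 <= (1 - del) * (1 - y)) by (apply Rmult_le_pos; lra). lra.
  - replace (y + del * (1 / 2 - y) - y) with (del * (1 / 2 - y)) by ring.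
    rewrite Rabs_mult, (Rabs_right del) by lra.
    assert (Rabs (1 / 2 - y) <= 1) by (apply Rabs_le; lra).
    assert (del * Rabs (1 / 2 - y) <= del * 1) by (apply Rmult_le_compat_l; lra). lra. }
(* a small contraction towards the centre *)
exists (x + del * (1 / 2 - x), t + del * (1 / 2 - t)). split.
- split; [apply (proj2 (Hin x Hx)) | apply (proj2 (Hin t Ht))].
- split; [apply (proj1 (Hin x Hx)) | apply (proj1 (Hin t Ht))].
Qed.

Lemma continuous_clamp_point (p : point) : continuous clamp_point p.
Proof.
assert (Cc : forall r, continuous clamp r).
{ intros r. apply filterlim_locally. intros eps. exists eps. intros y Hy.
  eapply Rle_lt_trans; [apply clamp_lipschitz | exact Hy]. }
destruct p as [x t].
apply (filterlim_point (locally (x, t)) (fun q => clamp (fst q)) (fun q => clamp (snd q))).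
- eapply filterlim_comp; [apply continuous_fst | apply Cc].
- eapply filterlim_comp; [apply continuous_snd | apply Cc].
Qed.

Lemma continuous_clamped (f : point -> R) :
  continuous_on (closure Omega0) f -> forall p, continuous (fun q => f (clamp_point q)) p.
Proof.
intros Hf p.
assert (Hin : forall q, closure Omega0 (clamp_point q)).
{ intros q. apply closure_square; apply clamp_unit. }
apply (filterlim_comp _ _ _ clamp_point f _
  (within (closure Omega0) (locally (clamp_point p)))); [|now apply Hf].
apply (filterlim_within _); [apply continuous_clamp_point | now apply filter_forall].
Qed.

Lemma total_extension (v : point -> R) :
  extends_continuously Omega0 v ->
  exists V : point -> R, (forall p, continuous V p) /\ forall p, Omega0 p -> V p = v p.
Proof.
intros (f & Cf & Ef). exists (fun q => f (clamp_point q)). split.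
- now apply continuous_clamped.
- intros [x t] Hp. unfold clamp_point. simpl. destruct Hp as [Hx Ht]. simpl in Hx, Ht.
  rewrite !clamp_id by (unfold unit_interval; lra). now apply Ef.
Qed.

Lemma continuous_on_closure_zero (D D' : point -> Prop) (w : point -> R) (p : point) :
  continuous_on (closure D) w -> (forall q, D' q -> D q) ->
  (forall q, D' q -> w q = 0) -> closure D' p -> w p = 0.
Proof.
intros Cw Hsub H0 Hp.
assert (Hp' : closure D p).
{ intros eps. destruct (Hp eps) as (q & Hb & Hq). exists q. split; [easy | now apply Hsub]. }
apply cond_eq. intros eps Heps. rewrite Rminus_0_r.
destruct (proj1 (filterlim_locally _ _) (Cw p Hp') (mkposreal _ Heps)) as [del Hdel].
destruct (Hp del) as (q & Hb & Hq).
specialize (Hdel q Hb (closure_of D q (Hsub q Hq))).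
change (Rabs (w q - w p) < eps) in Hdel. rewrite H0 in Hdel by easy.
now rewrite Rminus_0_l, Rabs_Ropp in Hdel.
Qed.

(** Two-sided at interior times and one-sided at 0 and 1, so that one statement
    covers the closed interval. *)
Definition inside (t0 : R) : (R -> Prop) -> Prop := within (fun t => 0 < t < 1) (locally t0).

Lemma inside_proper (t0 : R) : 0 <= t0 <= 1 -> ProperFilter (inside t0).
Proof.
intros Ht. split; [|unfold inside; apply within_filter, locally_filter].
intros P [e He].
assert (Hm : 0 < Rmin e 1 / 2 /\ Rmin e 1 <= e /\ Rmin e 1 <= 1).
{ repeat split; [|apply Rmin_l | apply Rmin_r].
  assert (0 < Rmin e 1) by (apply Rmin_glb_lt; [apply cond_pos | lra]). lra. }
assert (Hr : exists r, 0 < r /\ r < e /\ r <= 1 / 2) by (exists (Rmin e 1 / 2); lra).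
destruct Hr as (r & Hr).
destruct (Rle_lt_dec t0 (1 / 2)).
- exists (t0 + r / 2). apply He; [|lra].
  change (Rabs (t0 + r / 2 - t0) < e). rewrite Rabs_right; lra.
- exists (t0 - r / 2). apply He; [|lra].
  change (Rabs (t0 - r / 2 - t0) < e). rewrite Rabs_left; lra.
Qed.

Lemma inside_interval (t0 : R) : inside t0 (fun t => 0 < t < 1).
Proof. unfold inside, within. now apply filter_forall. Qed.

Lemma inside_le (t0 : R) : filter_le (inside t0) (locally t0).
Proof. apply filter_le_within. Qed.

Lemma edge_derivative (f f1 : point -> R) :
  (forall p, continuous f p) -> (forall p, continuous f1 p) ->
  (forall x t, 0 < x < 1 -> 0 < t < 1 -> is_derive (fun y => f (y, t)) x (f1 (x, t))) ->
  forall x t, 0 < x < 1 -> 0 <= t <= 1 -> is_derive (fun y => f (y, t)) x (f1 (x, t)).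
Proof.
intros Cf Cf1 Hd x t Hx Ht. assert (HP := inside_proper t Ht).
apply (is_derive_of_limit (inside t) (fun y s => f (y, s)) (fun y s => f1 (y, s))).
- intros eps. destruct (proj1 (filterlim_locally _ _) (Cf1 (x, t)) eps) as [d1 H1].
  destruct (locally_open_unit x Hx) as [d2 H2].
  assert (Hm : 0 < Rmin d1 d2) by (apply Rmin_glb_lt; apply cond_pos).
  exists (mkposreal _ Hm).
  generalize (filter_and _ _ (inside_interval t) (inside_le t _ (locally_ball t d1))).
  apply filter_imp. intros s [Hs1 Hs2] y Hy. simpl in Hy.
  assert (Hy1 : Rabs (y - x) < d1) by (eapply Rlt_le_trans; [exact Hy | apply Rmin_l]).
  assert (Hy2 : Rabs (y - x) < d2) by (eapply Rlt_le_trans; [exact Hy | apply Rmin_r]).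
  split.
  + apply Hd; [now apply H2 | easy].
  + apply Rlt_le. apply (H1 (y, s)). now split.
- apply filter_forall. intros y.
  eapply filterlim_filter_le_1; [apply inside_le | apply continuous_section_t, Cf].
Qed.

Lemma running_max_derivative (f : R -> R) (t l : R) :
  0 < t -> is_derive f t l -> (forall s, 0 <= s <= t -> f s <= f t) -> 0 <= l.
Proof.
intros Ht Hd Hmax. destruct (Rle_lt_dec 0 l) as [|Hl]; [easy|exfalso].
apply is_derive_Reals in Hd. destruct (Hd (- l) ltac:(lra)) as [e He].
set (r := Rmin (e / 2) t).
assert (Hr : 0 < r /\ r <= e / 2 /\ r <= t).
{ unfold r. repeat split; [|apply Rmin_l | apply Rmin_r].
  apply Rmin_glb_lt; [generalize (cond_pos e); lra | lra]. }
specialize (He (- r) ltac:(lra)). rewrite Rabs_left in He by lra.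
specialize (He ltac:(generalize (cond_pos e); lra)).
specialize (Hmax (t + - r) ltac:(lra)).
assert (0 <= (f (t + - r) - f t) / - r).
{ replace ((f (t + - r) - f t) / - r) with ((f t - f (t + - r)) / r) by (field; lra).
  apply Rle_div_r; lra. }
apply Rabs_def2 in He. lra.
Qed.

Lemma Rpower_small (y eps : R) :
  0 < y -> 0 < eps -> exists del, 0 < del /\ forall t, 0 < t < del -> Rpower t y <= eps.
Proof.
intros Hy He. exists (Rpower eps (/ y)). split; [apply exp_pos|].
intros t Ht. apply Rle_trans with (Rpower (Rpower eps (/ y)) y).
- apply Rle_Rpower_l; lra.
- right. rewrite Rpower_mult, Rinv_l, Rpower_1; lra.
Qed.

Lemma nonlocal_integral_zero (beta : R) (P : R -> R -> R) (nu : R -> R) (t : R) :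
  0 < t < 1 -> (forall s, 0 < s < 1 -> beta * P t s = 0) ->
  beta * RInt (fun s => nu s * P t s) t 1 = 0.
Proof.
intros Ht HP. destruct (Req_dec beta 0) as [-> | Hb]; [ring|].
rewrite (RInt_ext (V := R_CompleteNormedModule) _ (fun _ => 0)).
- rewrite RInt_const. change (beta * ((1 - t) * 0) = 0). ring.
- intros s Hs. rewrite Rmin_left, Rmax_right in Hs by lra.
  destruct (Rmult_integral _ _ (HP s ltac:(lra))) as [|E]; [easy|]. rewrite E. apply Rmult_0_r.
Qed.

Section Square.

Context (d : data) (w : point -> R).
Hypothesis hd : admissible d.
Hypothesis hw : solves_problem_S d w.
Hypothesis hrhs : forall p, rhs d p = 0.
Hypothesis hsig2 : sigma2 d <> 1.
Hypothesis hsig3 : sigma3 d <> 1.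
Hypothesis hP2 : forall t s, 0 < t < 1 -> 0 < s < 1 -> beta2 d * P2 d t s = 0.
Hypothesis hP3 : forall t s, 0 < t < 1 -> 0 < s < 1 -> beta3 d * P3 d t s = 0.

Context (W Wx Wt : point -> R).
Hypothesis CW : forall p, continuous W p.
Hypothesis CWx : forall p, continuous Wx p.
Hypothesis CWt : forall p, continuous Wt p.
Hypothesis EW : forall x t, 0 <= x <= 1 -> 0 <= t <= 1 -> W (x, t) = w (x, t).
Hypothesis EWx : forall p, Omega0 p -> Wx p = dx w p.
Hypothesis EWt : forall p, Omega0 p -> Wt p = dt w p.

Let k2 : R := alpha2 d * (1 + sigma2 d) / (1 - sigma2 d).
Let k3 : R := alpha3 d * (sigma3 d + 1) / (sigma3 d - 1).

Lemma W_dx (x t : R) : 0 < x < 1 -> 0 <= t <= 1 -> is_derive (fun y => W (y, t)) x (Wx (x, t)).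
Proof.
revert x t. apply edge_derivative; [exact CW | exact CWx |].
intros x t Hx Ht. rewrite EWx by now split.
apply (is_derive_ext_loc (fun y => w (y, t))).
- generalize (locally_open_unit x Hx). apply filter_imp. intros y Hy. symmetry. apply EW; lra.
- apply Derive_correct. destruct hw as (_ & (Hex & _) & _).
  exact (proj1 (Hex (x, t) (conj Hx Ht))).
Qed.

Lemma W_dt (x t : R) : 0 <= x <= 1 -> 0 < t < 1 -> is_derive (fun s => W (x, s)) t (Wt (x, t)).
Proof.
intros Hx Ht.
apply (edge_derivative (fun q => W (swap q)) (fun q => Wt (swap q))); [ | | | easy | easy].
- intros p. apply (continuous_comp swap W); [apply continuous_swap | apply CW].
- intros p. apply (continuous_comp swap Wt); [apply continuous_swap | apply CWt].
- clear x t Hx Ht. intros t x Ht Hx. unfold swap. simpl. rewrite EWt by now split.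
  apply (is_derive_ext_loc (fun s => w (x, s))).
  + generalize (locally_open_unit t Ht). apply filter_imp. intros s Hs. symmetry. apply EW; lra.
  + apply (Derive_correct (fun s => w (x, s))).
    destruct hw as (_ & (Hex & _) & _). exact (proj2 (Hex (x, t) (conj Hx Ht))).
Qed.

Lemma Wx_dx (x t : R) : 0 < x < 1 -> 0 < t < 1 ->
  is_derive (fun y => Wx (y, t)) x (caputo_t (lam d) w (x, t)).
Proof.
intros Hx Ht. apply (is_derive_ext_loc (fun y => dx w (y, t))).
- generalize (locally_open_unit x Hx). apply filter_imp. intros y Hy. symmetry. apply EWx. now split.
- destruct hw as ((_ & HS & _) & _ & _ & _ & _ & (He & _) & _).
  specialize (He (x, t) (conj Hx Ht)). rewrite hrhs in He.
  replace (caputo_t (lam d) w (x, t)) with (dx (dx w) (x, t)) by lra.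
  apply Derive_correct. now apply (HS (x, t)).
Qed.

(** The normal derivative taken from the hyperbolic side is a multiple of the
    tangential one, which both sides share: this leaves a dynamic boundary
    condition for the square. *)
Lemma left_condition (t : R) : 0 < t < 1 -> Wx (0, t) = k2 * Wt (0, t).
Proof.
intros Ht. destruct (AD_traces d w hd hw hrhs t Ht) as (lx & lt & Hx & _ & E & Hd).
assert (Elt : lt = Wt (0, t)).
{ rewrite <- (is_derive_unique _ _ _ Hd).
  rewrite <- (is_derive_unique _ _ _ (W_dt 0 t ltac:(lra) Ht)).
  apply Derive_ext_loc. generalize (locally_open_unit t Ht). apply filter_imp.
  intros s Hs. symmetry. apply EW; lra. }
assert (hw' := hw).
destruct hw' as (_ & _ & _ & _ & _ & _ & _ & _ & _ & _ & (nu & Hnu) & _).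
destruct (Hnu t Ht) as (Hl & _ & Hr).
assert (En : nu t = lx).
{ apply (filterlim_locally_unique _ _ _ Hl).
  apply (limit_along_path (Omega2 d) (dx w) 0 t lx (at_left 0) (fun x => x) (fun _ => t) Hx).
  - intros P HP. now apply filter_le_within.
  - apply filterlim_const.
  - now apply Omega2_left. }
rewrite (nonlocal_integral_zero (beta2 d) (P2 d) nu t Ht) in Hr by (intros; now apply hP2).
assert (Ex : alpha2 d * nu t + 0 = Wx (0, t)).
{ apply (filterlim_locally_unique _ _ _ Hr).
  apply (filterlim_ext_loc (fun x => Wx (x, t))).
  - generalize (Omega0_right t Ht). apply filter_imp. intros x Hx'. now apply EWx.
  - eapply filterlim_filter_le_1; [apply filter_le_within | apply continuous_section_x, CWx]. }
rewrite <- Ex, En, <- Elt. unfold k2.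
replace lx with (lt * (1 + sigma2 d) / (1 - sigma2 d)); [field; lra|].
apply Rmult_eq_reg_r with (1 - sigma2 d); [|lra]. field_simplify; lra.
Qed.

Lemma right_condition (t : R) : 0 < t < 1 -> Wx (1, t) = k3 * Wt (1, t).
Proof.
intros Ht. destruct (BC_traces d w hd hw hrhs t Ht) as (lx & lt & Hx & _ & E & Hd).
assert (Elt : lt = Wt (1, t)).
{ rewrite <- (is_derive_unique _ _ _ Hd).
  rewrite <- (is_derive_unique _ _ _ (W_dt 1 t ltac:(lra) Ht)).
  apply Derive_ext_loc. generalize (locally_open_unit t Ht). apply filter_imp.
  intros s Hs. symmetry. apply EW; lra. }
assert (hw' := hw).
destruct hw' as (_ & _ & _ & _ & _ & _ & _ & _ & _ & _ & _ & (nu & Hnu)).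
destruct (Hnu t Ht) as (Hl & _ & Hr).
assert (En : nu t = lx).
{ apply (filterlim_locally_unique _ _ _ Hl).
  apply (limit_along_path (Omega3 d) (dx w) 1 t lx (at_right 1) (fun x => x) (fun _ => t) Hx).
  - intros P HP. now apply filter_le_within.
  - apply filterlim_const.
  - now apply Omega3_right. }
rewrite (nonlocal_integral_zero (beta3 d) (P3 d) nu t Ht) in Hr by (intros; now apply hP3).
assert (Ex : alpha3 d * nu t + 0 = Wx (1, t)).
{ apply (filterlim_locally_unique _ _ _ Hr).
  apply (filterlim_ext_loc (fun x => Wx (x, t))).
  - generalize (Omega0_left t Ht). apply filter_imp. intros x Hx'. now apply EWx.
  - eapply filterlim_filter_le_1; [apply filter_le_within | apply continuous_section_x, CWx]. }
rewrite <- Ex, En, <- Elt. unfold k3.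
replace lx with (lt * (sigma3 d + 1) / (sigma3 d - 1)); [field; lra|].
apply Rmult_eq_reg_r with (sigma3 d - 1); [|lra]. field_simplify; lra.
Qed.

Lemma corner_condition (x k : R) :
  (forall t, 0 < t < 1 -> Wx (x, t) = k * Wt (x, t)) -> Wx (x, 0) = k * Wt (x, 0).
Proof.
intros H. assert (HP := inside_proper 0 ltac:(lra)).
apply (filterlim_locally_unique (fun t => Wx (x, t)) (F := inside 0)).
- eapply filterlim_filter_le_1; [apply inside_le | apply continuous_section_t, CWx].
- apply (filterlim_ext_loc (fun t => k * Wt (x, t))).
  + generalize (inside_interval 0). apply filter_imp. intros t Ht. symmetry. now apply H.
  + apply (filterlim_Rmult _); [apply filterlim_const|].
    eapply filterlim_filter_le_1; [apply inside_le | apply continuous_section_t, CWt].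
Qed.

Lemma W_corners : W (0, 0) = 0 /\ W (1, 0) = 0.
Proof.
rewrite !EW by lra. destruct hw as (_ & _ & _ & _ & _ & _ & _ & HA & HB & _). now split.
Qed.

Lemma constant_initial_slope :
  (forall x, 0 < x < 1 -> is_derive (fun y => Wx (y, 0)) x 0) ->
  forall x, 0 <= x <= 1 -> Wx (x, 0) = 0.
Proof.
intros Hd x Hx.
assert (Hc : forall a b, 0 <= a -> a <= b -> b <= 1 -> Wx (a, 0) = Wx (b, 0)).
{ intros a b Ha Hab Hb. apply (constant_of_derive (fun y => Wx (y, 0))); [easy | |].
  - intros y Hy. apply Hd. lra.
  - intros y _. apply continuous_section_x, CWx. }
destruct (mvt_open (fun y => W (y, 0)) (fun y => Wx (y, 0)) 0 1) as [xi [Hxi E]]; [lra | | |].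
- intros y Hy. apply W_dx; lra.
- intros y _. apply continuous_section_x, CW.
- destruct W_corners as [E0 E1]. rewrite E0, E1 in E.
  rewrite <- (Hc 0 x), (Hc 0 xi) by lra. lra.
Qed.

(** A bounded time derivative makes the fractional derivative O(t^(1 - lam)) as t tends
    to 0, so the initial trace is affine. *)
Lemma fractional_initial_slope : 0 < lam d < 1 -> forall x, 0 <= x <= 1 -> Wx (x, 0) = 0.
Proof.
intros Hlam. apply constant_initial_slope. intros x Hx.
destruct (rectangle_maximum (fun p => Rabs (Wt p)) 1) as (x0 & t0 & _ & _ & HM); [lra | |].
{ intros p. apply (continuous_comp Wt Rabs); [apply CWt|].
  apply continuity_pt_filterlim, Rcontinuity_abs. }
set (M := Rabs (Wt (x0, t0))) in *.
set (C := Rabs (/ Gamma (1 - lam d)) * (M / (1 - lam d)) + 1).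
assert (HM0 : 0 <= M) by apply Rabs_pos.
assert (HC : 0 < C).
{ unfold C. assert (0 <= Rabs (/ Gamma (1 - lam d)) * (M / (1 - lam d))); [|lra].
  apply Rmult_le_pos; [apply Rabs_pos|]. apply Rle_div_r; lra. }
assert (Hbound : forall y t, 0 < y < 1 -> 0 < t < 1 ->
  Rabs (caputo_t (lam d) w (y, t)) <= C * Rpower t (1 - lam d)).
{ intros y t Hy Ht. destruct hw as ((_ & HS & _) & _).
  destruct (HS (y, t) (conj Hy Ht)) as (_ & _ & Hex).
  unfold caputo_t, ex_caputo_t, caputo, ex_caputo in *.
  destruct (Req_EM_T (lam d) 1) as [|_]; [lra|].
  destruct Hex as [Hex [l Hl]]. simpl in *.
  rewrite (is_RInt_gen_unique (V := R_CompleteNormedModule) _ _ Hl).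
  assert (Hb : Rabs l <= M * Rpower t (1 - lam d) / (1 - lam d)).
  { apply (caputo_integral_bound (lam d) t (fun s => w (y, s)) (fun s => Wt (y, s)) M Hlam); try easy.
    - intros z Hz. symmetry. apply (EWt (y, z)). split; simpl; lra.
    - intros z Hz. apply continuous_section_t, CWt.
    - intros z Hz. apply (HM y z); lra. }
  rewrite Rabs_mult.
  apply Rle_trans with (Rabs (/ Gamma (1 - lam d)) * (M * Rpower t (1 - lam d) / (1 - lam d))).
  - apply Rmult_le_compat_l; [apply Rabs_pos | easy].
  - replace (Rabs (/ Gamma (1 - lam d)) * (M * Rpower t (1 - lam d) / (1 - lam d)))
      with ((C - 1) * Rpower t (1 - lam d)) by (unfold C; field; lra).
    apply Rmult_le_compat_r; [apply Rlt_le, exp_pos | lra]. }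
apply (is_derive_of_limit (at_right 0) (fun y t => Wx (y, t)) (fun y t => caputo_t (lam d) w (y, t))).
- intros eps. destruct (locally_open_unit x Hx) as [del Hdel]. exists del.
  destruct (Rpower_small (1 - lam d) (eps / C)) as (e & He & Hs); [lra | |].
  { apply Rdiv_lt_0_compat; [apply cond_pos | easy]. }
  generalize (at_right_interval 0 (Rmin e 1) ltac:(apply Rmin_glb_lt; lra)).
  apply filter_imp. intros t Ht y Hy.
  assert (Rmin e 1 <= e) by apply Rmin_l. assert (Rmin e 1 <= 1) by apply Rmin_r.
  assert (Hy' : 0 < y < 1) by now apply Hdel.
  split; [apply Wx_dx; lra|]. rewrite Rminus_0_r.
  eapply Rle_trans; [apply Hbound; lra|].
  apply Rle_trans with (C * (eps / C)).
  + apply Rmult_le_compat_l; [lra | apply Hs; lra].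
  + right. field. lra.
- apply filter_forall. intros y.
  eapply filterlim_filter_le_1; [apply filter_le_within | apply continuous_section_t, CWx].
Qed.

Lemma heat_caputo (x t : R) : lam d = 1 -> 0 < x < 1 -> 0 < t < 1 ->
  caputo_t (lam d) w (x, t) = Wt (x, t).
Proof.
intros Hlam Hx Ht. rewrite EWt by now split.
unfold caputo_t, caputo. destruct (Req_EM_T (lam d) 1); [easy | lra].
Qed.

Section HeatTrace.

Context (P11 P12 dP12 q1 : R -> R).
Hypothesis hlam : lam d = 1.
Hypothesis hsig1 : sigma1 d <> -1.
Hypothesis hP1 : factorization (P1 d) P11 P12 dP12 q1.
Hypothesis h1a : beta1 d * (sigma1 d - 1) / (2 * (sigma1 d + 1)) >= 0.
Hypothesis h1b : forall x, unit_interval x -> P11 x * P12 x >= 0.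
Hypothesis h1c : forall x, unit_interval x -> q1 x >= 0.
Hypothesis hk2 : 0 <= k2.
Hypothesis hk3 : k3 <= 0.

Let k1 : R := (1 - sigma1 d) / (1 + sigma1 d).

(** At time 0 the heat equation equates the second derivative of the trace with
    the right-hand side of the transmission condition on AB, which is the memory
    equation for the slope; the side conditions survive at the corners. *)
Lemma heat_initial_slope : forall x, 0 <= x <= 1 -> Wx (x, 0) = 0.
Proof.
assert (Hs1 : 1 + sigma1 d <> 0) by lra.
assert (hw' := hw).
destruct hw' as (_ & _ & _ & _ & _ & _ & _ & _ & _ & (nu & Hnu) & _).
assert (Hnu1 : forall x, 0 < x < 1 -> nu x = k1 * Wx (x, 0)).
{ intros x Hx. destruct (AB_traces d w hd hw hrhs x Hx) as (lx & lt & _ & Ht & E & Hd).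
  assert (Elx : lx = Wx (x, 0)).
  { rewrite <- (is_derive_unique _ _ _ Hd).
    rewrite <- (is_derive_unique _ _ _ (W_dx x 0 Hx ltac:(lra))).
    apply Derive_ext_loc. generalize (locally_open_unit x Hx). apply filter_imp.
    intros s Hs. symmetry. apply EW; lra. }
  assert (En : nu x = lt).
  { apply (filterlim_locally_unique _ _ _ (proj1 (Hnu x Hx))).
    apply (limit_along_path (Omega1 d) (dt w) x 0 lt (at_left 0) (fun _ => x) (fun t => t) Ht).
    - apply filterlim_const.
    - intros P HP. now apply filter_le_within.
    - now apply Omega1_below. }
  rewrite En, <- Elx. unfold k1.
  apply Rmult_eq_reg_r with (1 + sigma1 d); [|easy]. field_simplify; lra. }
apply (memory_trace_slope_zero (fun x => Wx (x, 0)) (fun x => Wt (x, 0)) (fun x => W (x, 0))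
  (P1 d) P11 P12 dP12 q1 (alpha1 d * k1) (- (beta1 d * k1)) k2 k3).
- intros x. apply continuous_section_x, CWx.
- intros x. apply continuous_section_x, CWt.
- intros x. apply continuous_section_x, CW.
- intros x Hx. apply (edge_derivative Wx Wt); try easy; [|lra].
  intros y t Hy Ht. rewrite <- (heat_caputo y t) by easy. now apply Wx_dx.
- intros x Hx. apply W_dx; lra.
- apply W_corners.
- apply W_corners.
- exact hP1.
- intros x Hx. apply Rge_le. now apply h1b.
- intros x Hx. apply Rge_le. now apply h1c.
- unfold k1.
  replace (- (beta1 d * ((1 - sigma1 d) / (1 + sigma1 d))))
    with (2 * (beta1 d * (sigma1 d - 1) / (2 * (sigma1 d + 1)))) by (field; lra).
  lra.
- intros x Hx. destruct (Hnu x Hx) as (_ & _ & Hr).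
  assert (El : alpha1 d * nu x + beta1 d * RInt (fun s => nu s * P1 d x s) x 1 = Wt (x, 0)).
  { apply (filterlim_locally_unique _ _ _ Hr).
    apply (filterlim_ext_loc (fun t => Wt (x, t))).
    - generalize (Omega0_above x Hx). apply filter_imp. intros t [_ Ht]. symmetry.
      now apply heat_caputo.
    - eapply filterlim_filter_le_1; [apply filter_le_within | apply continuous_section_t, CWt]. }
  rewrite <- El, Hnu1 by easy.
  assert (EI : RInt (fun s => nu s * P1 d x s) x 1 =
     k1 * RInt (fun s => Wx (s, 0) * P1 d x s) x 1).
  { destruct hP1 as (HP & Hb & _).
    transitivity (RInt (fun s => scal k1 (Wx (s, 0) * P1 d x s)) x 1).
    - apply (RInt_ext (V := R_CompleteNormedModule)). intros s Hs.
      rewrite Rmin_left, Rmax_right in Hs by lra.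
      rewrite Hnu1 by lra. change (k1 * Wx (s, 0) * P1 d x s = k1 * (Wx (s, 0) * P1 d x s)). ring.
    - apply (RInt_scal (V := R_CompleteNormedModule)).
      apply (ex_RInt_ext (V := R_NormedModule) (fun s => P11 x * (Wx (s, 0) * P12 (clamp s)))).
      + intros s Hs. rewrite Rmin_left, Rmax_right in Hs by lra.
        rewrite HP, clamp_id by (unfold unit_interval; lra).
        change (P11 x * (Wx (s, 0) * P12 s) = Wx (s, 0) * (P11 x * P12 s)). ring.
      + apply (ex_RInt_continuous (V := R_CompleteNormedModule)). intros s _.
        apply (continuous_scal_r (V := R_NormedModule)).
        apply (continuous_mult (K := R_AbsRing)).
        * apply continuous_section_x, CWx.
        * now apply (deriv01_continuous P12 dP12). }
  rewrite EI. ring.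
- apply corner_condition. exact left_condition.
- exact hk2.
- apply corner_condition. exact right_condition.
- exact hk3.
Qed.

End HeatTrace.

Hypothesis hlam : 0 < lam d <= 1.
Hypothesis hk2 : 0 <= k2.
Hypothesis hk3 : k3 <= 0.
Hypothesis hslope : forall x, 0 <= x <= 1 -> Wx (x, 0) = 0.

Lemma initial_value (x : R) : 0 <= x <= 1 -> W (x, 0) = 0.
Proof.
intros Hx. transitivity (W (0, 0)); [symmetry | exact (proj1 W_corners)].
apply (constant_of_derive (fun y => W (y, 0))); [lra | |].
- intros y Hy. assert (Hd := W_dx y 0 ltac:(lra) ltac:(lra)).
  rewrite hslope in Hd by lra. exact Hd.
- intros y _. apply continuous_section_x, CW.
Qed.

Lemma nonpositive_fractional (T : R) : lam d < 1 -> 0 < T < 1 ->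
  forall x t, 0 <= x <= 1 -> 0 <= t <= T -> W (x, t) <= 0.
Proof.
intros Hl HT.
assert (HG : 0 < Gamma (1 - lam d)) by (apply Gamma_pos; lra).
apply (parabolic_maximum_principle W Wx (fun p => caputo_t (lam d) w p) T (/ Gamma (1 - lam d)));
  [easy | now apply Rinv_0_lt_compat | exact CW | exact CWx | exact initial_value | | | |].
- intros x t Hx Ht. split; [apply W_dx; lra | apply Wx_dx; lra].
- intros x t Hx Ht Hmax Hpos.
  assert (hw' := hw). destruct hw' as ((_ & HS & _) & _).
  assert (Hp : Omega0 (x, t)) by (split; simpl; lra).
  destruct (HS (x, t) Hp) as (_ & _ & Hex).
  unfold caputo_t, ex_caputo_t, caputo, ex_caputo in *.
  destruct (Req_EM_T (lam d) 1) as [|_]; [lra|].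
  destruct Hex as [_ [l HI]]. simpl in *.
  rewrite (is_RInt_gen_unique (V := R_CompleteNormedModule) _ _ HI).
  destruct (rectangle_maximum (fun p => Rabs (Wt p)) 1) as (x0 & t0 & _ & _ & HM); [lra | |].
  { intros p. apply (continuous_comp Wt Rabs); [apply CWt|].
    apply continuity_pt_filterlim, Rcontinuity_abs. }
  apply Rmult_le_compat_l; [now apply Rlt_le, Rinv_0_lt_compat|].
  assert (Hb : (W (x, t) - W (x, 0)) * Rpower t (- lam d) <= l).
  { apply (caputo_integral_at_running_max (lam d) t (fun s => w (x, s)) (fun s => W (x, s))
      (fun s => Wt (x, s)) (Rabs (Wt (x0, t0)))); try easy; try lra.
    - intros z Hz. symmetry. apply (EWt (x, z)). split; simpl; lra.
    - intros z Hz. apply W_dt; lra.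
    - intros z Hz. apply continuous_section_t, CWt.
    - intros z Hz. apply (HM x z); lra.
    - intros z. apply continuous_section_t, CW.
    - intros z Hz. apply Hmax. lra. }
  rewrite initial_value, Rminus_0_r in Hb by lra.
  assert (1 <= Rpower t (- lam d)).
  { unfold Rpower. apply Rle_trans with (1 + - lam d * ln t); [|apply exp_ineq1_le].
    assert (ln t <= 0) by (rewrite <- ln_1; apply ln_le; lra). nra. }
  apply Rle_trans with (W (x, t) * Rpower t (- lam d)); [|easy].
  rewrite <- (Rmult_1_r (W (x, t))) at 1. now apply Rmult_le_compat_l.
- intros t Ht Hmax Hpos. rewrite left_condition by lra. apply Rmult_le_pos; [easy|].
  apply (running_max_derivative (fun s => W (0, s)) t); [lra | apply W_dt; lra | easy].
- intros t Ht Hmax Hpos. rewrite right_condition by lra.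
  assert (0 <= Wt (1, t)).
  { apply (running_max_derivative (fun s => W (1, s)) t); [lra | apply W_dt; lra | easy]. }
  assert (0 <= - k3 * Wt (1, t)) by (apply Rmult_le_pos; lra). lra.
Qed.

(** The factor exp(-t) supplies the zero-order term that the classical time
    derivative lacks. *)
Lemma nonpositive_heat (T : R) : lam d = 1 -> 0 < T < 1 ->
  forall x t, 0 <= x <= 1 -> 0 <= t <= T -> W (x, t) <= 0.
Proof.
intros Hl HT.
set (e := fun p : point => exp (- snd p)).
assert (Ce : forall p, continuous e p).
{ intros [x t]. apply (continuous_comp (fun q : point => - snd q) exp); [|apply continuous_exp].
  eapply filterlim_comp; [apply continuous_snd | apply (filterlim_opp (V := R_NormedModule))]. }
assert (Htime : forall x t, 0 <= x <= 1 -> 0 < t < 1 ->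
  (forall s, 0 <= s <= t -> e (x, s) * W (x, s) <= e (x, t) * W (x, t)) ->
  W (x, t) <= Wt (x, t)).
{ intros x t Hx Ht Hmax.
  assert (H : 0 <= exp (- t) * (Wt (x, t) + -1 * W (x, t))).
  { apply (running_max_derivative (fun s => exp (- s) * W (x, s)) t); [lra | | exact Hmax].
    apply (is_derive_exp_weight (fun s => - s) (fun s => W (x, s))).
    - auto_derive; [easy | ring].
    - now apply W_dt. }
  generalize (exp_pos (- t)). nra. }
assert (Hz : forall x t, 0 <= x <= 1 -> 0 <= t <= T -> e (x, t) * W (x, t) <= 0).
{ apply (parabolic_maximum_principle (fun p => e p * W p) (fun p => e p * Wx p)
    (fun p => e p * Wt p) T 1); [easy | lra | | | | | | |].
  - intros p. now apply (continuous_mult (K := R_AbsRing)).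
  - intros p. now apply (continuous_mult (K := R_AbsRing)).
  - intros x Hx. rewrite initial_value by easy. ring.
  - intros x t Hx Ht. split.
    + apply (is_derive_scal (fun y => W (y, t))). apply W_dx; lra.
    + apply (is_derive_scal (fun y => Wx (y, t))).
      rewrite <- (heat_caputo x t) by (easy || lra). apply Wx_dx; lra.
  - intros x t Hx Ht Hmax _. rewrite Rmult_1_l.
    apply Rmult_le_compat_l; [apply Rlt_le, exp_pos|]. apply Htime; [lra | lra | easy].
  - intros t Ht Hmax Hpos. apply Rmult_le_pos; [apply Rlt_le, exp_pos|].
    rewrite left_condition by lra. apply Rmult_le_pos; [easy|].
    apply Rle_trans with (W (0, t)); [|apply Htime; [lra | lra | easy]].
    assert (0 < e (0, t)) by apply exp_pos. nra.
  - intros t Ht Hmax Hpos.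
    assert (H1 : 0 <= Wt (1, t)).
    { apply Rle_trans with (W (1, t)); [|apply Htime; [lra | lra | easy]].
      assert (0 < e (1, t)) by apply exp_pos. nra. }
    rewrite right_condition by lra.
    assert (0 < e (1, t)) by apply exp_pos.
    assert (0 <= - k3 * Wt (1, t)) by (apply Rmult_le_pos; lra).
    assert (0 <= e (1, t) * (- k3 * Wt (1, t))) by (apply Rmult_le_pos; lra). lra. }
intros x t Hx Ht. specialize (Hz x t Hx Ht). assert (0 < e (x, t)) by apply exp_pos. nra.
Qed.

Lemma nonpositive_square (p : point) : Omega0 p -> w p <= 0.
Proof.
destruct p as [x t]. intros [Hx Ht]. simpl in Hx, Ht. rewrite <- EW by lra.
destruct (Req_dec (lam d) 1) as [E | Hne].
- apply (nonpositive_heat t); lra.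
- apply (nonpositive_fractional t); lra.
Qed.

End Square.

(** * Uniqueness *)

Lemma Omega_vanishing (d : data) (w : point -> R) :
  admissible d -> solves_problem_S d w -> (forall p, rhs d p = 0) ->
  (forall p, Omega0 p -> w p = 0) -> forall p, closure (Omega d) p -> w p = 0.
Proof.
intros hd hw hrhs H0.
assert (Cw : continuous_on (closure (Omega d)) w) by apply hw.
assert (Hsig : sigma1 d <> -1 /\ sigma2 d <> 1 /\ sigma3 d <> 1).
{ destruct hd as (_ & _ & _ & _ & _ & _ & _ & _ & S1 & S2 & S3).
  repeat split; intros E; rewrite E in *.
  - apply S1. rewrite Rabs_left; lra.
  - apply S2. apply Rabs_R1.
  - apply S3. apply Rabs_R1. }
destruct Hsig as (S1 & S2 & S3).
assert (Hsq : forall x t, 0 <= x <= 1 -> 0 <= t <= 1 -> w (x, t) = 0).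
{ intros x t Hx Ht.
  assert (Hc : closure Omega0 (x, t)) by now apply closure_square.
  apply (continuous_on_closure_zero (Omega d) Omega0); try easy.
  unfold Omega. tauto. }
assert (HO : forall p, Omega d p -> w p = 0).
{ intros [x t] [Hp | [Hp | [Hp | [Hp | [Hp | [Hp | Hp]]]]]].
  - now apply H0.
  - apply (vanishing1 d w hd hw hrhs S1); [|easy]. intros s Hs. apply Hsq; lra.
  - apply (vanishing2 d w hd hw hrhs S2); [|easy]. intros s Hs. apply Hsq; lra.
  - apply (vanishing3 d w hd hw hrhs S3); [|easy]. intros s Hs. apply Hsq; lra.
  - destruct Hp as [Hx Ht]. simpl in Hx, Ht. apply Hsq; lra.
  - destruct Hp as [Hx Ht]. simpl in Hx, Ht. apply Hsq; lra.
  - destruct Hp as [Hx Ht]. simpl in Hx, Ht. apply Hsq; lra. }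
intros p Hp. now apply (continuous_on_closure_zero (Omega d) (Omega d)).
Qed.

Theorem theorem1 (d : data)
    (P11 P12 dP12 q1 P21 P22 dP22 q2 P31 P32 dP32 q3 : R -> R)
    (hd : admissible d)
    (hP1 : factorization (P1 d) P11 P12 dP12 q1)
    (hP2 : factorization (P2 d) P21 P22 dP22 q2)
    (hP3 : factorization (P3 d) P31 P32 dP32 q3)
    (hP22 : P22 1 = 0)
    (hP32 : P32 1 = 0)
    (h1a : beta1 d * (sigma1 d - 1) / (2 * (sigma1 d + 1)) >= 0)
    (h1b : forall x, unit_interval x -> P11 x * P12 x >= 0)
    (h1c : forall x, unit_interval x -> q1 x >= 0)
    (h2a : alpha2 d * (1 + sigma2 d) / (1 - sigma2 d) >= 0)
    (h2b : forall t, unit_interval t ->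
       beta2 d * (1 + sigma2 d) / (1 - sigma2 d) * (P21 t * P22 t) <= 0)
    (h2c : beta2 d * (1 + sigma2 d) / (2 * (1 - sigma2 d)) *
       (P21 0 / dP22 0) <= 0)
    (h2d : forall t, unit_interval t ->
       beta2 d * (1 + sigma2 d) / (2 * (1 - sigma2 d)) * q2 t <= 0)
    (h3a : alpha3 d * (sigma3 d - 1) / (sigma3 d + 1) <= 0)
    (h3b : forall t, unit_interval t ->
       beta3 d * (sigma3 d - 1) / (sigma3 d + 1) * (P31 t * P32 t) >= 0)
    (h3c : beta3 d * (sigma3 d - 1) / (2 * (sigma3 d + 1)) *
       (P31 0 / dP32 0) >= 0)
    (h3d : forall t, unit_interval t ->
       beta3 d * (sigma3 d - 1) / (2 * (sigma3 d + 1)) * q3 t >= 0) :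
  forall u v : point -> R,
    solves_problem_S d u -> solves_problem_S d v ->
    forall p, closure (Omega d) p -> u p = v p.
Proof.
assert (Hsig : 1 + sigma1 d <> 0 /\ 1 + sigma2 d <> 0 /\ 1 - sigma2 d <> 0 /\
   sigma3 d + 1 <> 0 /\ sigma3 d - 1 <> 0).
{ destruct hd as (_ & _ & _ & _ & _ & _ & _ & _ & S1 & S2 & S3).
  repeat split; intros E.
  - apply S1. replace (sigma1 d) with (-1) by lra. rewrite Rabs_left; lra.
  - apply S2. replace (sigma2 d) with (-1) by lra. rewrite Rabs_left; lra.
  - apply S2. replace (sigma2 d) with 1 by lra. apply Rabs_R1.
  - apply S3. replace (sigma3 d) with (-1) by lra. rewrite Rabs_left; lra.
  - apply S3. replace (sigma3 d) with 1 by lra. apply Rabs_R1. }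
destruct Hsig as (S1 & S2 & S2' & S3 & S3').
assert (hd' : admissible (homogeneous d)) by exact hd.
assert (Z2 : forall t s, 0 < t < 1 -> 0 < s < 1 -> beta2 d * P2 d t s = 0).
{ intros t s Ht Hs.
  assert (V := nonlocal_term_vanishes (P2 d) P21 P22 dP22 q2
    (beta2 d * (1 + sigma2 d) / (1 - sigma2 d)) hP2 hP22 h2b).
  specialize (V ltac:(replace (beta2 d * (1 + sigma2 d) / (1 - sigma2 d))
    with (2 * (beta2 d * (1 + sigma2 d) / (2 * (1 - sigma2 d)))) by (field; lra); lra)).
  specialize (V ltac:(intros r Hr; specialize (h2d r Hr);
    replace (beta2 d * (1 + sigma2 d) / (1 - sigma2 d))
    with (2 * (beta2 d * (1 + sigma2 d) / (2 * (1 - sigma2 d)))) by (field; lra); lra) t Ht).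
  destruct hP2 as (HP & _). rewrite HP by (unfold unit_interval; lra).
  replace (beta2 d * (P21 t * P22 s)) with
    (beta2 d * (1 + sigma2 d) / (1 - sigma2 d) * P21 t * P22 s * (1 - sigma2 d) / (1 + sigma2 d))
    by (field; lra).
  rewrite V. field. lra. }
assert (Z3 : forall t s, 0 < t < 1 -> 0 < s < 1 -> beta3 d * P3 d t s = 0).
{ intros t s Ht Hs.
  assert (E : - (beta3 d * (sigma3 d - 1) / (sigma3 d + 1)) =
    -2 * (beta3 d * (sigma3 d - 1) / (2 * (sigma3 d + 1)))) by (field; lra).
  assert (V := nonlocal_term_vanishes (P3 d) P31 P32 dP32 q3
    (- (beta3 d * (sigma3 d - 1) / (sigma3 d + 1))) hP3 hP32).
  specialize (V ltac:(intros r Hr; specialize (h3b r Hr); lra)).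
  specialize (V ltac:(rewrite E; lra)).
  specialize (V ltac:(intros r Hr; specialize (h3d r Hr); rewrite E; lra) t Ht).
  destruct hP3 as (HP & _). rewrite HP by (unfold unit_interval; lra).
  replace (beta3 d * (P31 t * P32 s)) with
    (- (beta3 d * (sigma3 d - 1) / (sigma3 d + 1)) * P31 t * P32 s * (sigma3 d + 1) / (1 - sigma3 d))
    by (field; lra).
  rewrite V. field. lra. }
assert (K3 : alpha3 d * (sigma3 d + 1) / (sigma3 d - 1) <= 0).
{ replace (alpha3 d * (sigma3 d + 1) / (sigma3 d - 1)) with
    (alpha3 d * (sigma3 d - 1) / (sigma3 d + 1) * ((sigma3 d + 1) / (sigma3 d - 1)) ^ 2)
    by (field; lra).
  assert (0 <= ((sigma3 d + 1) / (sigma3 d - 1)) ^ 2) by apply pow2_ge_0. nra. }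
assert (Hneg : forall w, solves_problem_S (homogeneous d) w -> forall p, Omega0 p -> w p <= 0).
{ intros w hw.
  assert (hw' := hw). destruct hw' as ((Cw & _) & (_ & Xx & Xt) & _).
  assert (Csq : continuous_on (closure Omega0) w).
  { intros p Hp. assert (Hsub : forall q, closure Omega0 q -> closure (Omega (homogeneous d)) q).
    { intros q Hq eps. destruct (Hq eps) as (r & Hb & Hr). exists r. split; [easy|]. now left. }
    eapply filterlim_filter_le_1; [|exact (Cw p (Hsub p Hp))].
    intros P HP. unfold within in *. revert HP. apply filter_imp. auto. }
  destruct (total_extension _ Xx) as (Wx & CWx & EWx).
  destruct (total_extension _ Xt) as (Wt & CWt & EWt).
  assert (CW := continuous_clamped w Csq).
  assert (EW : forall x t, 0 <= x <= 1 -> 0 <= t <= 1 -> w (clamp_point (x, t)) = w (x, t)).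
  { intros x t Hx Ht. unfold clamp_point. simpl. now rewrite !clamp_id. }
  assert (Hlam : 0 < lam d <= 1) by apply hd.
  apply (nonpositive_square (homogeneous d) w hd' hw (fun _ => eq_refl) ltac:(simpl; lra)
    ltac:(simpl; lra) Z2 Z3 _ Wx Wt CW CWx CWt EW EWx EWt Hlam (Rge_le _ _ h2a) K3).
  destruct (Req_dec (lam d) 1) as [E | Hne].
  - exact (heat_initial_slope (homogeneous d) w hd' hw (fun _ => eq_refl) ltac:(simpl; lra)
      ltac:(simpl; lra) Z2 Z3 _ Wx Wt CW CWx CWt EW EWx EWt P11 P12 dP12 q1 E ltac:(simpl; lra)
      hP1 h1a h1b h1c (Rge_le _ _ h2a) K3).
  - exact (fractional_initial_slope (homogeneous d) w hw (fun _ => eq_refl)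
      _ Wx Wt CW CWx CWt EW EWx EWt ltac:(simpl; lra)). }
intros u v Hu Hv p Hp.
assert (Huv := difference_solves d u v hd Hu Hv).
assert (Hvu := difference_solves d v u hd Hv Hu).
apply Rminus_diag_uniq.
apply (Omega_vanishing (homogeneous d) (fun p => u p - v p) hd' Huv (fun _ => eq_refl)); [|easy].
intros q Hq. generalize (Hneg _ Huv q Hq) (Hneg _ Hvu q Hq). simpl. lra.
Qed.
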